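(* Let $d\ge 2$, let $V=(v_1,\dots,v_n)$ be a positively spanning configuration of $n$ distinct unit vectors in $\mathbb{R}^d$, and let $\mathcal{K}=(K_1,\dots,K_{d-2})$ be a collection of compact convex bodies in $\mathbb{R}^d$ such that for every simplicial polytopal fan $\Delta$ with $\Delta^{(1)}=V$ the quadratic form $q_{\mathcal{K},\Delta}$ on $\mathbb{R}^n$ has kernel of dimension $d$ and exactly one positive eigenvalue. Let $C_1,C_2\subset\{1,\dots,n\}$ be hyperbolic circuits of $V$ with positive indices $p_1$ and $p_2$ such that $|C_1|=|C_2|=d+1$, $p_1\notin C_2$, $p_2\notin C_1$, and such that $\mathrm{clir}^{C_1}(V)$ and $\mathrm{clir}^{C_2}(V)$ are facets of $\mathrm{clir}(V)$ intersecting along a codimension $2$ face of $\mathrm{clir}(V)$. Then the dihedral angle of $M_{\mathcal{K}}(V)$ between the subsets $M^{C_1}_{\mathcal{K}}(V)$ and $M^{C_2}_{\mathcal{K}}(V)$ of its boundary equals $\frac{\pi}{2}$ at every point of their intersection.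
   Context: Fans: a fan in $\mathbb{R}^d$ is a finite collection of convex polyhedral cones, closed under taking faces, any two of which intersect in a common face; it is complete if its union is $\mathbb{R}^d$, simplicial if every cone is the positive hull of linearly independent vectors; $\Delta^{(1)}=V$ means that its rays are generated by $v_1,\dots,v_n$. The normal fan $\mathcal{N}(P)$ of a polyhedron $P$ consists of the normal cones $N_F(P)=\{v: \max_{x\in P}\langle v,x\rangle=\langle v,p\rangle\ \forall p\in F\}$ over nonempty faces $F$. A fan is polytopal if it is the normal fan of a polyhedron. Fans here are complete. $V$ also denotes the $n\times d$ matrix with rows $v_i$; $P(h)=\{x\in\mathbb{R}^d: Vx\le h\}$ for $h\in\mathbb{R}^n$; $\pi:\mathbb{R}^n\to\mathbb{R}^n/\operatorname{im}V$ is the projection. For a polytopal fan $\Delta$ with $\Delta^{(1)}=V$: $\widetilde T(\Delta)=\{h:\mathcal{N}(P(h))=\Delta\}$ and $T(\Delta)=\pi(\widetilde T(\Delta))$; $\widetilde T(\Delta)$ spans $\mathbb{R}^n$ when $\Delta$ is simplicial. $\mathrm{clir}(V)$ is the closure in $\mathbb{R}^n/\operatorname{im}V$ of the set of $\pi(h)$ such that $Vx\le h$ is compatible and irredundant (deleting any one inequality enlarges the solution set). It is a convex polyhedral cone and is the union of the sets $\operatorname{cl}T(\Delta)$ over simplicial polytopal $\Delta$ with $\Delta^{(1)}=V$. A circuit of $V$ is a set $C\subset\{1,\dots,n\}$ such that $(v_i)_{i\in C}$ is an inclusion-minimal linearly dependent family. It is hyperbolic with positive index $p=p(C)$ if $v_p=\sum_{i\in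 C^-}\lambda_i v_i$ with all $\lambda_i>0$, where $C^-=C\setminus\{p\}$. For such $C$, $\mathrm{clir}^C(V)=\{\pi(h)\in\mathrm{clir}(V): h_p=\sum_{i\in C^-}\lambda_i h_i\}$. $\operatorname{vol}(L_1,\dots,L_d)$ denotes the mixed volume of convex bodies in $\mathbb{R}^d$, and $q_{\mathcal{K},\Delta}$ is the unique quadratic form on $\operatorname{span}\widetilde T(\Delta)$ with $q_{\mathcal{K},\Delta}(h)=\operatorname{vol}(P(h),P(h),K_1,\dots,K_{d-2})$ for $h\in\widetilde T(\Delta)$. Its kernel contains $\operatorname{im}V$; under the assumption of the claim it descends to a form of signature $(+,-,\dots,-)$ on $\mathbb{R}^n/\operatorname{im}V$, so that one sheet of $\{q_{\mathcal{K},\Delta}=1\}$ is a hyperboloid model of $\mathbb{H}^{n-d-1}$. Since $q_{\mathcal{K},\Delta}\ge0$ on $\operatorname{cl}T(\Delta)$, the set $H_{\mathcal{K}}(\Delta)=\operatorname{cl}T(\Delta)\cap\{q_{\mathcal{K},\Delta}=1\}$ is a convex hyperbolic polyhedron (possibly with ideal vertices). The forms of two fans agree on $\operatorname{cl}T(\Delta)\cap\operatorname{cl}T(\Delta')$, and $M_{\mathcal{K}}(V)=\bigcup_\Delta H_{\mathcal{K}}(\Delta)$ (union over simplicial polytopal $\Delta$ with $\Delta^{(1)}=V$) is the resulting piecewise hyperbolic polyhedral complex; $M^{C}_{\mathcal{K}}(V)$ is the subcomplex of points of $M_{\mathcal{K}}(V)$ lying in $\mathrm{clir}^C(V)$. The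 dihedral angle of $M_{\mathcal{K}}(V)$ at a codimension $2$ cell $G$ of $M^{C_1}_{\mathcal{K}}(V)\cap M^{C_2}_{\mathcal{K}}(V)$ is the sum of the hyperbolic dihedral angles at $G$ of all top-dimensional cells $H_{\mathcal{K}}(\Delta)$ containing $G$; ''at every point'' means at every such cell $G$. *)

(* Defs.v *)
From HB Require Import structures.
From mathcomp Require Import all_boot all_order all_algebra.
From mathcomp Require Import all_classical all_reals all_analysis.

Set Implicit Arguments.
Unset Strict Implicit.
Unset Printing Implicit Defensive.

Import Order.TTheory GRing.Theory Num.Theory.
Import numFieldNormedType.Exports.

Local Open Scope classical_set_scope.
Local Open Scope ring_scope.

(* Points of R^m are column vectors.  A finite family of vectors is a matrix
   whose rows are the (transposed) members of the family; in particular the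
   configuration (v_1, ..., v_n) is V : 'M[R]_(n, d) with v_i = (row i V)^T. *)

Section ConvexGeometry.
Variable R : realType.

Definition dot m (u v : 'cV[R]_m) : R := (u^T *m v) 0 0.

Definition pos_hull k m (A : 'M[R]_(k, m)) : set 'cV[R]_m :=
  [set x | exists l : 'cV[R]_k, (forall i, 0 <= l i 0) /\ x = A^T *m l].

Definition lin_span m (S : set 'cV[R]_m) : set 'cV[R]_m :=
  [set x | exists (k : nat) (A : 'M[R]_(k, m)),
     (forall i, S (row i A)^T) /\ (x^T <= A)%MS].

(* The linear span of S has dimension k: S contains a basis of its span. *)
Definition lin_dim m (S : set 'cV[R]_m) (k : nat) : Prop :=
  exists A : 'M[R]_(k, m),
    [/\ row_free A, forall i, S (row i A)^T & forall x, S x -> (x^T <= A)%MS].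

Definition codim m (S : set 'cV[R]_m) (c : nat) : Prop :=
  exists k, lin_dim S k /\ (k + c)%N = m.

Definition face_at_level m (c : R) (S F : set 'cV[R]_m) : Prop :=
  F !=set0 /\ exists u : 'cV[R]_m,
    (forall x, S x -> dot u x <= c) /\ F = S `&` [set x | dot u x = c].

(* Nonempty faces of a convex polyhedron, the polyhedron itself included. *)
Definition is_face m (S F : set 'cV[R]_m) : Prop :=
  exists c : R, face_at_level c S F.

Definition codim_face m (c : nat) (S F : set 'cV[R]_m) : Prop :=
  is_face S F /\ codim F c.

(* P(h) *)
Definition polyhedron k m (A : 'M[R]_(k, m)) (b : 'cV[R]_k) : set 'cV[R]_m :=
  [set x | forall i, (A *m x) i 0 <= b i 0].

Definition normal_cone m (P F : set 'cV[R]_m) : set 'cV[R]_m :=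
  [set v | forall p x, F p -> P x -> dot v x <= dot v p].

Definition normal_fan m (P : set 'cV[R]_m) : set (set 'cV[R]_m) :=
  [set normal_cone P F | F in [set F | is_face P F]].

Definition is_fan m (D : set (set 'cV[R]_m)) : Prop :=
  [/\ finite_set D,
      forall C, D C -> exists (k : nat) (A : 'M[R]_(k, m)), C = pos_hull A,
      forall C F, D C -> is_face C F -> D F &
      forall C C', D C -> D C' ->
        is_face C (C `&` C') /\ is_face C' (C `&` C')].

Definition complete_fan m (D : set (set 'cV[R]_m)) : Prop :=
  \bigcup_(C in D) C = setT.

Definition simplicial_fan m (D : set (set 'cV[R]_m)) : Prop :=
  forall C, D C ->
    exists (k : nat) (A : 'M[R]_(k, m)), row_free A /\ C = pos_hull A.

Definition polytopal_fan m (D : set (set 'cV[R]_m)) : Prop :=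
  exists (k : nat) (A : 'M[R]_(k, m)) (b : 'cV[R]_k),
    polyhedron A b !=set0 /\ D = normal_fan (polyhedron A b).

(* Delta^(1) = V *)
Definition fan_rays n m (V : 'M[R]_(n, m)) (D : set (set 'cV[R]_m)) : Prop :=
  [set C | D C /\ lin_dim C 1] = [set pos_hull (row i V) | i in [set: 'I_n]].

Definition simplicial_polytopal n m (V : 'M[R]_(n, m))
    (D : set (set 'cV[R]_m)) : Prop :=
  [/\ is_fan D, complete_fan D, simplicial_fan D, polytopal_fan D &
      fan_rays V D].

End ConvexGeometry.

Section MixedVolume.
Variable R : realType.

(* d-dimensional Lebesgue measure as the iterated product measure: the
   recursion is the one to which lebesgue_measure \x _ (product_measure1)
   unfolds, a point of R^(d+1) being a scalar t stacked on a point of R^d. *)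
Fixpoint volume (d : nat) : set 'cV[R]_d -> \bar R :=
  match d with
  | 0 => fun A => (\1_A 0)%:E
  | d'.+1 => fun A =>
      (\int[@lebesgue_measure R]_t
         volume [set x : 'cV[R]_d' | A (col_mx (t%:M : 'cV[R]_1) x)])%E
  end.

Definition minkowski_sum d (L : seq (set 'cV[R]_d)) (S : {set 'I_d}) :
    set 'cV[R]_d :=
  [set x | exists f : 'I_d -> 'cV[R]_d,
     (forall i, i \in S -> nth set0 L i (f i)) /\ x = \sum_(i in S) f i].

(* Polarization of the volume, normalized by vol(L, ..., L) = vol(L); meant
   for a list L of d convex bodies in R^d. *)
Definition mixed_volume d (L : seq (set 'cV[R]_d)) : R :=
  (d`!)%:R^-1 * \sum_(S : {set 'I_d})
    (-1) ^+ (d - #|S|) * fine (volume (minkowski_sum L S)).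

Definition convex_body d (L : set 'cV[R]_d) : Prop :=
  [/\ L !=set0, compact L & convex_set (L : set (convex_lmodType 'cV[R]_d))].

End MixedVolume.

Section Quotient.
Variables (R : realType) (n d : nat) (V : 'M[R]_(n, d)).

(* R^n / im V, realized as R^m with m = n - rank V by taking as coordinates a
   basis of the linear functionals on R^n that vanish on im V. *)
Definition quot_dim : nat := \rank (kermx V).

Definition quot_proj (h : 'cV[R]_n) : 'cV[R]_quot_dim :=
  row_base (kermx V) *m h.

Definition quot_section : 'M[R]_(n, quot_dim) := pinvmx (row_base (kermx V)).

Lemma quot_sectionK (y : 'cV[R]_quot_dim) : quot_proj (quot_section *m y) = y.
Proof. by rewrite /quot_proj mulmxA mulmxVp ?mul1mx// row_base_free. Qed.

Lemma quot_proj_eq0 (h : 'cV[R]_n) :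
  quot_proj h = 0 <-> exists x, h = V *m x.
Proof.
have kerV : row_base (kermx V) *m V = 0.
  by apply/eqP; rewrite -sub_kermx eq_row_base.
rewrite /quot_proj; split=> [h0|[x ->]]; last by rewrite mulmxA kerV mul0mx.
suff /submxP[x hx] : (h^T <= V^T)%MS.
  by exists x^T; rewrite -[LHS]trmxK hx trmx_mul trmxK.
have kh0 : kermx V *m h = 0.
  have /submxP[M ->] : (kermx V <= row_base (kermx V))%MS by rewrite eq_row_base.
  by rewrite -mulmxA h0 mulmx0.
rewrite submxE.
have /submxP[M MV] : ((cokermx V^T)^T <= kermx V)%MS.
  rewrite sub_kermx; apply/eqP; apply: trmx_inj.
  by rewrite trmx_mul trmxK mulmx_coker trmx0.
by rewrite -[cokermx _]trmxK -trmx_mul MV -mulmxA kh0 mulmx0 trmx0.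
Qed.

Lemma quot_dimE : quot_dim = (n - \rank V)%N.
Proof. exact: mxrank_ker. Qed.

End Quotient.

Section Forms.
Variable R : realType.

(* Quadratic forms are given by symmetric matrices. *)
Definition bform m (Q : 'M[R]_m) (x y : 'cV[R]_m) : R := (x^T *m Q *m y) 0 0.

(* Eigenvalues are counted with multiplicity. *)
Definition one_positive_eigenvalue m (Q : 'M[R]_m) : Prop :=
  exists a : R, [/\ 0 < a, \rank (eigenspace Q a) = 1%N &
    forall b, 0 < b -> eigenvalue Q b -> b = a].

End Forms.

Section Circuits.
Variables (R : realType) (n d : nat) (V : 'M[R]_(n, d)).

Definition circuit (C : {set 'I_n}) : bool :=
  minset (fun B : {set 'I_n} => ~~ free [seq row i V | i in B]) C.

(* lam expresses v_p as a positive combination of the v_i, i in C^-. *)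
Definition hyperbolic_relation (C : {set 'I_n}) (p : 'I_n) (lam : 'I_n -> R) :
    Prop :=
  (forall i, i \in C :\ p -> 0 < lam i) /\
  row p V = \sum_(i in C :\ p) lam i *: row i V.

Definition hyperbolic_circuit (C : {set 'I_n}) (p : 'I_n) : Prop :=
  [/\ circuit C, p \in C & exists lam, hyperbolic_relation C p lam].

Definition compatible (h : 'cV[R]_n) : Prop := polyhedron V h !=set0.

Definition irredundant (h : 'cV[R]_n) : Prop :=
  forall i, exists x : 'cV[R]_d,
    (forall j, j != i -> (V *m x) j 0 <= h j 0) /\ ~ polyhedron V h x.

Definition clir : set 'cV[R]_(quot_dim V) :=
  closure [set quot_proj V h | h in [set h | compatible h /\ irredundant h]].

Definition clir_circuit (C : {set 'I_n}) (p : 'I_n) :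
    set 'cV[R]_(quot_dim V) :=
  clir `&` [set quot_proj V h | h in
    [set h : 'cV[R]_n | exists lam, hyperbolic_relation C p lam /\
                         h p 0 = \sum_(i in C :\ p) lam i * h i 0]].

End Circuits.
Arguments clir {R n d} V.
Arguments clir_circuit {R n d} V C p.

Section Complex.
Variables (R : realType) (n d : nat) (V : 'M[R]_(n, d)).
Variable K : 'I_(d - 2) -> set 'cV[R]_d.
Implicit Type D : set (set 'cV[R]_d).

Definition type_cone_lift D : set 'cV[R]_n :=
  [set h | normal_fan (polyhedron V h) = D].

Definition type_cone D : set 'cV[R]_(quot_dim V) :=
  [set quot_proj V h | h in type_cone_lift D].

Definition is_mixed_form D (Q : 'M[R]_n) : Prop :=
  Q^T = Q /\ forall h, type_cone_lift D h ->
    bform Q h h = mixed_volume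
      [:: polyhedron V h, polyhedron V h & [seq K j | j <- enum 'I_(d - 2)]].

(* q_{K,D}; the form is unique when D is simplicial and polytopal with rays V,
   because type_cone_lift D is then a nonempty open cone of R^n. *)
Definition mixed_form D : 'M[R]_n := xget 0 [set Q | is_mixed_form D Q].

(* The form induced on R^n / im V; independent of the chosen section because
   im V lies in the kernel of q_{K,D}. *)
Definition quot_form D : 'M[R]_(quot_dim V) :=
  (quot_section V)^T *m mixed_form D *m quot_section V.

Definition hcell D : set 'cV[R]_(quot_dim V) :=
  closure (type_cone D) `&` [set y | bform (quot_form D) y y = 1].

Definition hcomplex : set 'cV[R]_(quot_dim V) :=
  \bigcup_(D in [set D | simplicial_polytopal V D]) hcell D.

Definition hcomplex_circuit (C : {set 'I_n}) (p : 'I_n) :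
    set 'cV[R]_(quot_dim V) :=
  hcomplex `&` clir_circuit V C p.

End Complex.
Arguments type_cone {R n d} V D.
Arguments mixed_form {R n d} V K D.
Arguments quot_form {R n d} V K D.
Arguments hcell {R n d} V K D.
Arguments hcomplex_circuit {R n d} V K C p.

Section HyperbolicAngle.
Variables (R : realType) (m : nat).
Implicit Types (Q : 'M[R]_m) (H F G : set 'cV[R]_m).

(* Faces of a polyhedron H in the hyperboloid model: hyperbolic half-spaces are
   cut out by linear half-spaces, and the hyperbolic codimension of a face is
   the codimension of its linear span. *)
Definition hyp_face (c : nat) H F : Prop := face_at_level 0 H F /\ codim F c.

(* The vectors of span(F), orthogonal to G, that point from the codimension 2
   face G into the facet F. *)
Definition inward_normal Q F G (u : 'cV[R]_m) : Prop :=
  [/\ u <> 0,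
      exists f g, [/\ F f, lin_span G g & u = f - g] &
      forall g, G g -> bform Q u g = 0].

(* Q is of signature (+,-,...,-), hence -Q is the Riemannian metric on the
   plane orthogonal to G. *)
Definition is_dihedral_angle Q H G (theta : R) : Prop :=
  exists F1 F2 u1 u2,
    [/\ hyp_face 1 H F1 /\ hyp_face 1 H F2, F1 <> F2,
        G `<=` F1 /\ G `<=` F2,
        inward_normal Q F1 G u1 /\ inward_normal Q F2 G u2 &
        theta = acos (- bform Q u1 u2 /
          (Num.sqrt (- bform Q u1 u1) * Num.sqrt (- bform Q u2 u2)))].

Definition dihedral_angle Q H G : R :=
  xget 0 [set theta | is_dihedral_angle Q H G theta].

End HyperbolicAngle.

Section TotalAngle.
Variables (R : realType) (n d : nat) (V : 'M[R]_(n, d)).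
Variable K : 'I_(d - 2) -> set 'cV[R]_d.

Definition hcomplex_cell (c : nat) (G : set 'cV[R]_(quot_dim V)) : Prop :=
  exists D, simplicial_polytopal V D /\ hyp_face c (hcell V K D) G.

Definition hcomplex_angle (G : set 'cV[R]_(quot_dim V)) : R :=
  \sum_(D \in [set D | simplicial_polytopal V D /\ G `<=` hcell V K D])
    dihedral_angle (quot_form V K D) (hcell V K D) G.

End TotalAngle.
Arguments hcomplex_cell {R n d} V K c G.
Arguments hcomplex_angle {R n d} V K G.

(* Main.v *)
Require Import Defs.
From HB Require Import structures.
From mathcomp Require Import all_boot all_order all_algebra.
From mathcomp Require Import all_classical all_reals all_analysis.
From mathcomp Require Import measurable_realfun.
From mathcomp Require Import ring lra zify.
Import Order.TTheory GRing.Theory Num.Theory.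
Import numFieldNormedType.Exports.
Local Open Scope classical_set_scope.
Local Open Scope ring_scope.
Set Implicit Arguments.
Unset Strict Implicit.
Unset Printing Implicit Defensive.

(** Write t_k(h) = \sum_(i in C_k^-) lambda_i h_i - h_(p_k) for the slack of the
    circuit C_k.  It vanishes on im V, it is nonnegative on clir(V), and
    clir^(C_k) lies in the hyperplane t_k = 0.  As |C_k| = d + 1, the v_i with i
    in C_k^- form a basis, so when t_k(h) is small and positive the inequality
    p_k cuts a vertex off the polytope of the other inequalities, and the piece
    cut off is a simplex of fixed shape and of size t_k(h).

    The form.  Raising h_(p_k) by s adds to P(h) a frustum of this simplex which,
    up to translation, depends only on t_k(h) and s.  Cutting a convex body by a
    hyperplane is additive for L |-> vol(c L + K) (volume_scaled_sum_cut), and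
    volume is translation invariant, so the growth of vol(P(h), P(h), K) also
    depends only on t_k(h) and s.  Its second difference along e_(p_k) and any
    xi with t_k(xi) = 0 is therefore zero: q(e_(p_k), xi) = 0
    (mixed_form_orthogonal).  In other words e_(p_k) is q-normal to the wall
    t_k = 0.  Since p_1 is not in C_2, the normal e_(p_1) of the first wall lies
    in the second one, and the two walls are perpendicular.

    The cells.  It remains to see that a single cell contains G and that it
    fills the wedge t_1, t_2 >= 0 near a point of G.  The normal fan of P(h) is
    the set of cones spanned by the active sets of the points of P(h)
    (normal_fanE).  At a generic point h0 of G the active sets are independent,
    except at the two vertices where some p_k is active, whose active sets are
    C_1 and C_2 (generic_active).  For h near h0 with t_1(h), t_2(h) > 0 the
    active sets of P(h) are then the subsets of those of P(h0) that contain
    neither C_1^- nor C_2^- (local_fan), and this list does not depend on h.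
    So all these h have one and the same normal fan.

    Generic points of G exist because G is cut out of the closure of a type
    cone, which is convex (type_cone_liftD), and so is not covered by finitely
    many hyperplanes of its span (generic_point).  The two vertices differ
    because C_1^- <> C_2^-: with equal bases t_1 = 0 would imply t_2 = 0 on
    clir(V), against the hypothesis that clir^(C_1) is a facet (bases_differ).

    The metric conclusion is linear algebra in the wedge (right_wedge): the only
    two facets through G are t_1 = 0 and t_2 = 0, and any inward normals to them
    have product zero. *)

(** * Columns, neighbourhoods and bilinear forms *)

Section Columns.
Variables (R : pzRingType) (m : nat).
Implicit Types u w : 'cV[R]_m.

Lemma colD u w i : (u + w) i 0 = u i 0 + w i 0. Proof. by rewrite mxE. Qed.
Lemma colN u i : (- u) i 0 = - u i 0. Proof. by rewrite mxE. Qed.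
Lemma colB u w i : (u - w) i 0 = u i 0 - w i 0. Proof. by rewrite !mxE. Qed.
Lemma colZ (a : R) u i : (a *: u) i 0 = a * u i 0. Proof. by rewrite mxE. Qed.

End Columns.

Section ContinuousFunctionals.
Variables (R : realType) (T : topologicalType).
Implicit Types f g : T -> R.

Lemma closed_preim (U : topologicalType) (f : T -> U) (D : set U) :
  continuous f -> closed D -> closed (f @^-1` D).
Proof. by move=> cf; apply: preimage_closed => x _; exact: cf. Qed.

Lemma closed_sublevel f (a : R) : continuous f -> closed [set x | f x <= a].
Proof. by move=> cf; exact: (closed_preim cf (@closed_le R a)). Qed.

Lemma closed_superlevel f (a : R) : continuous f -> closed [set x | a <= f x].
Proof. by move=> cf; exact: (closed_preim cf (@closed_ge R a)). Qed.

Lemma near_lt f g x : {for x, continuous f} -> {for x, continuous g} -> f x < g x ->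
  \forall y \near x, f y < g y.
Proof.
move=> cf cg; rewrite -subr_gt0 => fg.
have H : nbhs (g x - f x) [set z | 0 < z] := open_nbhs_nbhs (conj (@open_gt R 0) fg).
apply: (@filterS _ (nbhs x) _ ((fun y => g y - f y) @^-1` [set z | 0 < z])).
  by move=> y /=; rewrite subr_gt0.
exact: (cvgB cg cf H).
Qed.

End ContinuousFunctionals.

(** These restate filter lemmas with the filter kept in the folded form [nbhs x].
    At a matrix, unification unfolds it into coordinates, and then the fact that
    it is a filter is no longer found. *)
Section Near.
Variables (T : topologicalType) (x : T).
Implicit Types P Q S : T -> Prop.

Lemma near_all P : (forall y, P y) -> \forall y \near x, P y.
Proof. exact: nearW. Qed.

Lemma near_sub P Q : (forall y, P y -> Q y) ->
  (\forall y \near x, P y) -> \forall y \near x, Q y.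
Proof. by move=> PQ; apply: filterS. Qed.

Lemma near_sub2 P Q S : (forall y, P y -> Q y -> S y) ->
  (\forall y \near x, P y) -> (\forall y \near x, Q y) -> \forall y \near x, S y.
Proof. by move=> PQ; apply: filterS2. Qed.

Lemma near_and P Q : (\forall y \near x, P y) -> (\forall y \near x, Q y) ->
  \forall y \near x, P y /\ Q y.
Proof. exact: near_sub2. Qed.

Lemma near_forall (I : finType) (P : I -> T -> Prop) :
  (forall i, \forall y \near x, P i y) -> \forall y \near x, forall i, P i y.
Proof. exact: filter_forall. Qed.

End Near.

Section MatrixFunctionals.
Variable R : realType.

Lemma mulmx_continuous k m (M : 'M[R]_(k, m)) i :
  continuous (fun x : 'cV[R]_m => (M *m x) i 0).
Proof.
rewrite (_ : (fun x : 'cV[R]_m => _) = (fun x : 'cV[R]_m => \sum_j M i j * x j 0)).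
  apply: continuous_big => [|j _].
    by move=> [a b]; exact: add_continuous.
  move=> x; apply: (@cvgM _ _ (nbhs x) (nbhs_filter x) (fun=> M i j) (fun y : 'cV[R]_m => y j 0)).
    exact: cvg_cst.
  exact: coord_continuous.
by apply/funext => y; rewrite mxE.
Qed.

Lemma mulmx_cV_continuous k m (M : 'M[R]_(k, m)) :
  continuous (fun x : 'cV[R]_m => M *m x).
Proof.
move=> y U /nbhs_ballP[e /= e0 eU].
have : \forall z \near y, forall i, ball ((M *m y) i 0) e ((M *m z) i 0).
  by apply: near_forall => i; exact: (mulmx_continuous (nbhsx_ballx _ e e0)).
by apply: near_sub => z H; apply: eU; split => // i j; rewrite ord1.
Qed.

(** A property that holds near h holds on a short segment issuing from h. *)
Lemma near_line m (P : 'cV[R]_m -> Prop) (h xi : 'cV[R]_m) : (\forall k \near h, P k) ->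
  exists2 e : R, 0 < e & forall s, 0 < s <= e -> P (h + s *: xi).
Proof.
move=> /nbhs_ballP[r /= r0 rP]; exists (r / (`|xi| + 1) / 2).
  by rewrite !divr_gt0// ltr_wpDl.
move=> s /andP[s0 sr]; apply: rP; rewrite -ball_normE /= opprD addNKr normrN normrZ gtr0_norm//.
have x1 : 0 < `|xi| + 1 by rewrite ltr_wpDl.
have : s * (`|xi| + 1) <= r / 2.
  by rewrite -ler_pdivlMr// mulrAC.
by rewrite mulrDr mulr1; lra.
Qed.

End MatrixFunctionals.

Section BilinearForms.
Variables (R : realType) (m : nat) (Q : 'M[R]_m).
Implicit Types x y z : 'cV[R]_m.

Lemma bformDl x y z : bform Q (x + y) z = bform Q x z + bform Q y z.
Proof. by rewrite /bform raddfD/= !mulmxDl mxE. Qed.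

Lemma bformDr x y z : bform Q z (x + y) = bform Q z x + bform Q z y.
Proof. by rewrite /bform mulmxDr mxE. Qed.

Lemma bformZl a x y : bform Q (a *: x) y = a * bform Q x y.
Proof. by rewrite /bform linearZ/= -!scalemxAl mxE. Qed.

Lemma bformZr a x y : bform Q x (a *: y) = a * bform Q x y.
Proof. by rewrite /bform -scalemxAr mxE. Qed.

Lemma bformC x y : Q^T = Q -> bform Q x y = bform Q y x.
Proof.
move=> QT; rewrite /bform.
have <- : (y^T *m Q *m x)^T = x^T *m Q *m y by rewrite !trmx_mul trmxK QT mulmxA.
by rewrite mxE.
Qed.

Lemma bformNr x y : bform Q x (- y) = - bform Q x y.
Proof. by rewrite -scaleN1r bformZr mulN1r. Qed.

Lemma bform_continuous : continuous (fun y => bform Q y y).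
Proof.
rewrite (_ : (fun y => _) = (fun y : 'cV[R]_m => \sum_i y i 0 * (Q *m y) i 0)).
  apply: continuous_big => [|i _]; first by move=> [a b]; exact: add_continuous.
  move=> y; apply: (@cvgM _ _ (nbhs y) (nbhs_filter y) (fun z : 'cV[R]_m => z i 0)
    (fun z : 'cV[R]_m => (Q *m z) i 0)); first exact: coord_continuous.
  exact: mulmx_continuous.
by apply/funext => y; rewrite /bform -mulmxA mxE; apply: eq_bigr => i _; rewrite mxE.
Qed.

End BilinearForms.

(** * Volume as a measure *)

Section Volume.
Variable R : realType.

Definition slice d (A : set 'cV[R]_d.+1) (t : R) : set 'cV[R]_d :=
  [set x | A (col_mx (t%:M : 'cV[R]_1) x)].

(** [volume] is defined on all sets by iterated integrals, whereas additivity and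
    finiteness are facts about measures.  A model presents R^d as an iterated
    product of measurable spaces carrying the product measure.  It is a record
    over an arbitrary space because this space changes with d. *)
Record volume_model d (disp : measure_display) (T : measurableType disp)
    (mu : {sigma_finite_measure set T -> \bar R}) (e : T -> 'cV[R]_d) : Prop :=
  VolumeModel {
    volume_modelE : forall A, volume A = mu (e @^-1` A);
    measurable_coord : forall i, measurable_fun setT (fun t => e t i 0);
    volume_box : forall r : R,
      (mu (e @^-1` [set x | forall i, (`|x i 0| <= r)%R]) < +oo)%E }.

Section SigmaFinitePack.
Context disp (T : measurableType disp) (mu : {measure set T -> \bar R}).
Context (mu_sigma_finite : sigma_finite setT mu).

Let nu : set T -> \bar R := mu.
HB.instance Definition _ := Measure.on nu.
HB.instance Definition _ :=
  Measure_isSigmaFinite.Build _ _ _ nu mu_sigma_finite.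

(** The product of a model with the line is again sigma-finite, because boxes
    exhaust it; this bundles such a measure, as the next product requires. *)
Lemma sigma_finite_pack :
  exists nu : {sigma_finite_measure set T -> \bar R}, (nu : set T -> \bar R) = mu.
Proof. by exists nu. Qed.

End SigmaFinitePack.

Lemma measurable_preimage_box disp (T : measurableType disp) d (e : T -> 'cV[R]_d) r :
  (forall i, measurable_fun setT (fun t => e t i 0)) ->
  measurable (e @^-1` [set x | forall i, (`|x i 0| <= r)%R]).
Proof.
move=> em.
have -> : e @^-1` [set x | forall i, (`|x i 0| <= r)%R] =
    \bigcap_(i in [set: 'I_d]) (fun z => e z i 0) @^-1` `[- r, r].
  apply/seteqP; split => z /= h i; first by move=> _ /=; rewrite in_itv/= -ler_norml.
  by have := h i I; rewrite /= in_itv/= -ler_norml.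
apply: fin_bigcap_measurable => // i _.
by rewrite -[X in measurable X]setTI; apply: em.
Qed.

Lemma measurable_cons disp (T : measurableType disp) d (e : T -> 'cV[R]_d) :
  (forall i, measurable_fun setT (fun t => e t i 0)) ->
  forall i, measurable_fun setT (fun p : measurableTypeR R * T =>
    (col_mx (p.1%:M : 'cV[R]_1) (e p.2) : 'cV[R]_(1 + d)) i 0).
Proof.
move=> em i.
case: (@splitP 1 d i) => j ij.
  have -> : i = @lshift 1 d j by apply: val_inj.
  apply: (eq_measurable_fun fst) => [[t z] _ /=|]; last exact: measurable_fst.
  by rewrite col_mxEu ord1 mxE mulr1n.
have -> : i = @rshift 1 d j by apply: val_inj.
apply: (eq_measurable_fun ((fun z => e z j 0) \o snd)) => [[t z] _ /=|].
  by rewrite col_mxEd.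
exact: measurableT_comp.
Qed.

Lemma volume_model_exists d : exists (disp : measure_display)
  (T : measurableType disp) (mu : {sigma_finite_measure set T -> \bar R})
  (e : T -> 'cV[R]_d), volume_model mu e.
Proof.
elim: d => [|d [disp [T [mu [e [eE em eb]]]]]].
  exists _, unit, (dirac tt : {sigma_finite_measure set unit -> \bar R}), (fun=> 0).
  split => [A|[]//|r].
    by rewrite /= /dirac !indicE.
  by rewrite (le_lt_trans (probability_le1 _ _))// ltry.
pose lam : {sigma_finite_measure set (measurableTypeR R) -> \bar R} :=
  @lebesgue_measure R.
pose m : {measure set (measurableTypeR R * T)%type -> \bar R} := (lam \x mu)%E.
pose e' (p : measurableTypeR R * T) := col_mx (p.1%:M : 'cV[R]_1) (e p.2).
have em' := measurable_cons em : forall i, measurable_fun setT (fun t => e' t i 0).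
have eb' (r : R) : (m (e' @^-1` [set x | forall i, (`|x i 0| <= r)%R]) < +oo)%E.
  have -> : e' @^-1` [set x | forall i, (`|x i 0| <= r)%R] =
      `[- r, r]%classic `*` e @^-1` [set x | forall i, (`|x i 0| <= r)%R].
    apply/seteqP; split => [[t z] /= h|[t z] /= [tr zr] i].
      split; first by have := h (@lshift 1 d 0); rewrite col_mxEu mxE mulr1n in_itv/= -ler_norml.
      by move=> i; have := h (@rshift 1 d i); rewrite col_mxEd.
    case: (@splitP 1 d i) => j ij.
      have -> : i = @lshift 1 d j by apply: val_inj.
      by rewrite /e' col_mxEu ord1 mxE mulr1n; move: tr; rewrite in_itv/= -ler_norml.
    have -> : i = @rshift 1 d j by apply: val_inj.
    by rewrite /e' col_mxEd.
  rewrite [X in (X < _)%E]product_measure1E//; last exact: measurable_preimage_box.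
  rewrite lte_mul_pinfty//.
  by rewrite [X in X \is a _]lebesgue_measure_itv/=; case: ifP.
have /sigma_finite_pack[nu nuE] : sigma_finite setT m.
  exists (fun n => e' @^-1` [set x | forall i, (`|x i 0| <= n%:R)%R]).
    apply/seteqP; split => // z _; exists (Num.bound `|e' z|) => //= i.
    apply: le_trans (ltW (archi_boundP _)) => //.
    by rewrite [leRHS]/Num.norm/= mx_normrE; apply/bigmax_geP; right; exists (i, 0).
  by move=> n; split => //; exact: measurable_preimage_box.
exists _, (measurableTypeR R * T)%type, nu, e'; split => [A||] //; rewrite nuE//.
rewrite /= /product_measure1; apply: eq_integral => t _ /=.
rewrite eE; congr (mu _); by apply/seteqP; split => z /=; rewrite xsectionE.
Qed.

(** An open set of R^d is a union of balls with rational centres and radii 1/(k+1),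
    hence a countable union of finite intersections of coordinate conditions. *)
Lemma measurable_preimage_open disp (T : measurableType disp) d (e : T -> 'cV[R]_d) :
  (forall i, measurable_fun setT (fun t => e t i 0)) ->
  forall A, open A -> measurable (e @^-1` A).
Proof.
move=> em A oA.
pose B (q : 'cV[rat]_d * nat) : set 'cV[R]_d :=
  [set x | forall i, `|x i 0 - ratr (q.1 i 0)| < q.2.+1%:R^-1].
have -> : e @^-1` A = \bigcup_(q in [set q | B q `<=` A]) e @^-1` B q.
  apply/seteqP; split => [z /= Az|z [q /= qA]]; last exact: qA.
  have /nbhs_ballP[r /= r0 rA] : nbhs (e z) A by apply: open_nbhs_nbhs.
  have [k kr] : exists k : nat, k.+1%:R^-1 < r / 2.
    have r2 : 0 < r / 2 by rewrite divr_gt0.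
    exists (Num.truncn (r / 2)^-1).
    by rewrite invf_plt ?posrE// truncnS_gt.
  have k0 : (0 : R) < k.+1%:R^-1 by rewrite invr_gt0.
  have /choice[q qP] : forall i, exists q : rat, `|e z i 0 - ratr q| < k.+1%:R^-1.
    move=> i; have /rat_in_itvoo[q] : e z i 0 - k.+1%:R^-1 < e z i 0 + k.+1%:R^-1.
      by rewrite ltrBlDr -addrA ltrDl addr_gt0.
    by rewrite in_itv/= -ltr_distlC => ?; exists q.
  exists (\col_i q i, k) => [x /= xB|i /=]; last by rewrite mxE.
  apply: rA; split => // i j; rewrite ord1.
  rewrite /ball/=; have := xB i; have := qP i; rewrite mxE => h1 h2.
  rewrite (splitr r) (le_lt_trans (ler_distD (ratr (q i)) _ _))// ltrD//.
    exact: lt_trans kr.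
  by rewrite distrC; apply: lt_trans kr.
rewrite bigcup_mkcond; apply: countable_bigcupT_measurable; first exact: countableP.
move=> q; case: ifPn => // _.
have -> : e @^-1` B q =
    \bigcap_(i in [set: 'I_d]) (fun z => e z i 0) @^-1` ball (ratr (q.1 i 0) : R) (q.2.+1%:R^-1).
  apply/seteqP; split => z /= h i; first by move=> _ /=; rewrite /ball/= distrC.
  by have := h i I; rewrite /= /ball/= distrC.
apply: fin_bigcap_measurable => // i _.
by rewrite -[X in measurable X]setTI; apply: em => //; exact: measurable_realfun.measurable_ball.
Qed.

Lemma measurable_preimage_closed disp (T : measurableType disp) d (e : T -> 'cV[R]_d) :
  (forall i, measurable_fun setT (fun t => e t i 0)) ->
  forall A, closed A -> measurable (e @^-1` A).
Proof.
move=> em A cA; rewrite -[A]setCK -preimage_setC; apply: measurableC.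
exact: (measurable_preimage_open em (closed_openC cA)).
Qed.

Lemma compact_in_box d (A : set 'cV[R]_d) : compact A ->
  exists r : R, A `<=` [set x | forall i, `|x i 0| <= r].
Proof.
move=> cA; have [M [_ MA]] := compact_bounded cA.
exists (M + 1) => x Ax i; apply: le_trans (MA (M + 1) _ x Ax); last by rewrite ltrDl.
by rewrite [leRHS]/Num.norm/= mx_normrE; apply/bigmax_geP; right; exists (i, 0).
Qed.

Lemma volume_compact_fin d (A : set 'cV[R]_d) : compact A -> volume A \is a fin_num.
Proof.
have [disp [T [mu [e [eE em eb]]]]] := volume_model_exists d.
move=> cA; have [r rA] := compact_in_box cA.
rewrite eE ge0_fin_numE//; apply: le_lt_trans (eb r).
apply: le_measure; rewrite ?inE; last exact: preimage_subset.
  by apply: measurable_preimage_closed => //; apply: compact_closed.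
exact: measurable_preimage_box.
Qed.

Lemma volumeUI d (A B : set 'cV[R]_d) : compact A -> compact B ->
  fine (volume (A `|` B)) + fine (volume (A `&` B)) = fine (volume A) + fine (volume B).
Proof.
move=> cA cB.
have fA := volume_compact_fin cA; have fB := volume_compact_fin cB.
have fI : volume (A `&` B) \is a fin_num.
  by apply: volume_compact_fin; apply: compact_closedI => //; exact: compact_closed.
have [disp [T [mu [e [eE em eb]]]]] := volume_model_exists d.
have mA : measurable (e @^-1` A) by apply: measurable_preimage_closed => //; exact: compact_closed.
have mB : measurable (e @^-1` B) by apply: measurable_preimage_closed => //; exact: compact_closed.
have -> : volume (A `|` B) = (volume A + volume B - volume (A `&` B))%E.
  by rewrite !eE preimage_setU preimage_setI measureUfinl// -ge0_fin_numE// -eE.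
rewrite fineB// ?fin_numD ?fA ?fB// fineD//; by rewrite subrK.
Qed.

Lemma lebesgue_measure_shift (a : R) (A : set R) : measurable A ->
  pushforward lebesgue_measure ((fun t => t + a) : R -> measurableTypeR R) A = lebesgue_measure A.
Proof.
move=> mA; apply/esym/lebesgue_measure_unique => //=.
  by move=> mf; apply: measurable_funD => //; exact: measurable_cst.
move=> mf _ [[x y]] _ <-.
rewrite /pushforward/=.
have -> : (fun t => t + a) @^-1` `]x, y] = `]x - a, y - a]%classic.
  by apply/seteqP; split => t /=; rewrite !in_itv/= ltrBlDr lerBrDr.
rewrite !lebesgue_measure_itv/= !lte_fin ltrD2r; case: ifP => // _.
by rewrite -!EFinB opprB addrA subrK.
Qed.

Lemma ge0_integral_shift (a : R) (f : R -> \bar R) :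
  measurable_fun setT f -> (forall t, 0 <= f t)%E ->
  (\int[@lebesgue_measure R]_t f (t - a)%R = \int[@lebesgue_measure R]_t f t)%E.
Proof.
move=> mf f0.
have mshift : measurable_fun [set: measurableTypeR R]
    ((fun t : R => t - a) : measurableTypeR R -> measurableTypeR R).
  by apply: measurable_funB => //; exact: measurable_cst.
have := ge0_integral_pushforward mshift (@lebesgue_measure R) measurableT mf (fun t _ => f0 t).
rewrite preimage_setT => <-.
by apply: eq_measure_integral => //= A mA AS; exact: lebesgue_measure_shift.
Qed.

Lemma closed_slice d (A : set 'cV[R]_d.+1) t : closed A -> closed (slice A t).
Proof.
move=> cA; rewrite -[slice A t]/((fun x : 'cV[R]_d => col_mx (t%:M : 'cV[R]_1) x) @^-1` A).
apply: closed_comp => // x _ U /nbhs_ballP[r /= r0 rU].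
apply/nbhs_ballP; exists r => //= y [_ xy]; apply: rU; split => // i j.
rewrite !mxE; case: splitP => k _; first exact: ballxx.
exact: xy.
Qed.

(** By induction on d: the slices of a translate are translates of slices, and
    the integral over the first coordinate is invariant under shifts.  Closedness
    is what makes the volume of the slices a measurable function. *)
Lemma volume_translate d (A : set 'cV[R]_d) (v : 'cV[R]_d) : closed A ->
  volume [set x | A (x - v)] = volume A.
Proof.
elim: d A v => [|d IH] A v cA.
  congr volume; apply/seteqP; split => x /=; by rewrite (flatmx0 (x - v)) (flatmx0 x).
pose w := @dsubmx _ 1 d _ v; pose a := v (@lshift 1 d 0) 0.
have vE : v = col_mx (a%:M : 'cV[R]_1) w.
  have <- : @usubmx _ 1 d _ v = a%:M by apply/matrixP => i j; rewrite !ord1 !mxE.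
  exact/esym/(@vsubmxK _ 1 d).
rewrite /=.
transitivity (\int[@lebesgue_measure R]_t volume (slice A (t - a)%R))%E.
  apply: eq_integral => t _; rewrite -(IH (slice A (t - a)) w); last exact: closed_slice.
  congr volume; rewrite /slice /=.
  suff E (x : 'cV[R]_d) : col_mx (t%:M : 'cV[R]_1) x - v = col_mx ((t - a)%:M : 'cV[R]_1) (x - w).
    by apply/seteqP; split => x /=; rewrite E.
  by rewrite {1}vE; apply/matrixP => i j; rewrite !mxE; case: splitP => k _;
    rewrite !mxE// mulrnBl.
apply: (@ge0_integral_shift a (fun t => volume (slice A t))) => [|t].
  have [disp [T [mu [e [eE em eb]]]]] := volume_model_exists d.
  have mA := measurable_preimage_closed (measurable_cons em) cA.
  apply: eq_measurable_fun (measurable_fun_xsection mu mA) => s _ /=.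
  by rewrite eE; congr (mu _); apply/seteqP; split => z /=; rewrite xsectionE.
have [disp [T [mu [e [-> em eb]]]]] := volume_model_exists d.
exact: measure_ge0.
Qed.

End Volume.

(** * Mixed volumes and hyperplane cuts *)

Section ScaledSum.
Variables (R : realType) (d : nat).
Implicit Types P K A : set 'cV[R]_d.

(** Convexity with a plain real parameter, free of the packed unit interval. *)
Definition segment_closed A := forall (x y : 'cV[R]_d) (t : R),
  0 <= t <= 1 -> A x -> A y -> A (t *: x + (1 - t) *: y).

Lemma convex_set_segment A :
  convex_set (A : set (convex_lmodType 'cV[R]_d)) -> segment_closed A.
Proof.
move=> cA x y t /andP[t0 t1] Ax Ay.
have t01 : Itv.spec (@Itv.num_sem R) (Itv.Real `[0%Z, 1%Z]) t.
  by rewrite /= /Itv.num_sem/= num_real in_itv/= t0 t1.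
have := cA x y (Itv.mk t01); rewrite !inE; exact.
Qed.

(** The set c P + K.  In the polarization formula for vol(P, P, K_1, ...) the body
    P occurs zero, one or two times in each sum; the parameter c covers the three
    cases at once. *)
Definition scaled_sum (c : R) P K : set 'cV[R]_d :=
  [set c *: z.1 + z.2 | z in P `*` K].

Lemma scaled_sum_compact c P K : compact P -> compact K -> compact (scaled_sum c P K).
Proof.
move=> cP cK; apply: continuous_compact; last exact: compact_setX.
apply: continuous_subspaceT => z.
apply: (@cvgD _ _ _ _ _ (fun z : 'cV[R]_d * 'cV[R]_d => c *: z.1) snd); last exact: cvg_snd.
exact: (@cvgZl_tmp _ _ _ _ _ c fst _ cvg_fst).
Qed.

Lemma scaled_sum_convex c P K :
  segment_closed P -> segment_closed K -> segment_closed (scaled_sum c P K).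
Proof.
move=> cP cK _ _ t t01 [[p k] /= [Pp Kk] <-] [[q l] /= [Pq Kl] <-].
exists (t *: p + (1 - t) *: q, t *: k + (1 - t) *: l); first by split; [exact: cP|exact: cK].
rewrite /= !scalerDr !scalerA ![c * _]mulrC; exact: addrACA.
Qed.

Lemma scaled_sum_translate c P K v :
  scaled_sum c [set x | P (x - v)] K = [set x | scaled_sum c P K (x - c *: v)].
Proof.
apply/seteqP; split => [_ [[p k] /= [Pp Kk] <-]|x /= [[p k] /= [Pp Kk]]].
  by exists (p - v, k) => //=; rewrite scalerBr addrAC.
move=> /eqP; rewrite eq_sym subr_eq => /eqP ->; exists (p + v, k) => /=.
  by rewrite addrK.
by rewrite scalerDr addrAC.
Qed.

(** If c p + k = c q + l with p and q on either side of the hyperplane, the same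
    convex combination that moves from p to q until it meets the hyperplane also
    writes this point as c r + m with r on the hyperplane. *)
Lemma scaled_sum_cut c P K (f : 'cV[R]_d -> R) (a : R) :
  (forall x y t, f (t *: x + (1 - t) *: y) = t * f x + (1 - t) * f y) ->
  segment_closed P -> segment_closed K ->
  scaled_sum c (P `&` [set x | f x <= a]) K `&` scaled_sum c (P `&` [set x | a <= f x]) K =
  scaled_sum c (P `&` [set x | f x = a]) K.
Proof.
move=> fE cP cK; apply/seteqP; split; last first.
  move=> _ [[p k] /= [[Pp pa] Kk] <-].
  by split; exists (p, k) => //=; split => //; split => //=; rewrite pa.
move=> _ [[[p k] /= [[Pp pa] Kk] <-] [[q l] /= [[Pq qa] Kl] E]].
have [pa'|pa'] := eqVneq (f p) a; first by exists (p, k).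
have fpq : 0 < f q - f p by rewrite subr_gt0 (lt_le_trans _ qa)// lt_neqAle pa'.
pose t := (f q - a) / (f q - f p).
have t01 : 0 <= t <= 1.
  apply/andP; split; last by rewrite ler_pdivrMr// mul1r lerB.
  by apply: divr_ge0; [rewrite subr_ge0|exact: ltW].
exists (t *: p + (1 - t) *: q, t *: k + (1 - t) *: l) => /=.
  split; last exact: cK.
  split; first exact: cP.
  have t1 : t * (f q - f p) = f q - a by rewrite mulfVK// gt_eqF.
  rewrite fE [LHS](_ : _ = f q - t * (f q - f p)); last by ring.
  by rewrite t1 subKr.
have -> : c *: (t *: p + (1 - t) *: q) + (t *: k + (1 - t) *: l) =
   t *: (c *: p + k) + (1 - t) *: (c *: q + l).
  by rewrite !scalerDr !scalerA ![c * _]mulrC; exact: addrACA.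
by rewrite E -scalerDl addrC subrK scale1r.
Qed.

Lemma scaled_sumU c P Q K :
  scaled_sum c (P `|` Q) K = scaled_sum c P K `|` scaled_sum c Q K.
Proof.
apply/seteqP; split => [_ [z [[Pz|Qz] Kz] <-]|_ [[z [Pz Kz] <-]|[z [Pz Kz] <-]]].
- by left; exists z.
- by right; exists z.
- by exists z => //; split => //; left.
- by exists z => //; split => //; right.
Qed.

Lemma scaled_sum0 P : P !=set0 -> scaled_sum 0 P [set 0] = [set 0].
Proof.
move=> [p Pp]; apply/seteqP; split => [_ [[q k] /= [_ ->] <-]|_ ->].
  by rewrite scale0r addr0.
by exists (p, 0) => //=; rewrite scale0r addr0.
Qed.

Lemma scaled_sumC A P K c :
  scaled_sum 1 A (scaled_sum c P K) = scaled_sum c P (scaled_sum 1 A K).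
Proof.
apply/seteqP; split.
  move=> _ [[a _] /= [Aa [[p k] /= [Pp Kk] <-]] <-].
  exists (p, 1 *: a + k) => /=; last exact: addrCA.
  by split => //; exists (a, k).
move=> _ [[p _] /= [Pp [[a k] /= [Aa Kk] <-]] <-].
exists (a, c *: p + k) => /=; last exact: addrCA.
by split => //; exists (p, k).
Qed.

(** For convex P, a sum of two points of P with weights 1 and c is (c + 1) times
    a point of P. *)
Lemma scaled_sumS P K (c : nat) : segment_closed P ->
  scaled_sum 1 P (scaled_sum c%:R P K) = scaled_sum c.+1%:R P K.
Proof.
move=> cP; apply/seteqP; split.
  move=> _ [[q _] /= [Pq [[p k] /= [Pp Kk] <-]] <-].
  have c0 : c.+1%:R != 0 :> R by rewrite pnatr_eq0.
  exists (c.+1%:R^-1 *: q + (1 - c.+1%:R^-1) *: p, k) => /=.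
    split => //; apply: cP => //.
    by rewrite invr_ge0 ler0n/= invf_le1 ?ltr0n// ler1n.
  rewrite scalerDr !scalerA mulfV// mulrBr mulr1 mulfV// addrA.
  by rewrite -[in c.+1%:R - 1]natr1 addrK.
move=> _ [[p k] /= [Pp Kk] <-]; exists (p, c%:R *: p + k) => /=.
  by split => //; exists (p, k).
by rewrite addrA -scalerDl nat1r.
Qed.

End ScaledSum.

Section MixedVolumeSplit.
Variables (R : realType) (d : nat).

Definition sum_of (L : seq (set 'cV[R]_d)) (s : seq 'I_d) : set 'cV[R]_d :=
  foldr (fun (i : 'I_d) X => scaled_sum 1 (nth set0 L i) X) [set 0] s.

Lemma minkowski_sumE (L : seq (set 'cV[R]_d)) (S : {set 'I_d}) :
  minkowski_sum L S = sum_of L (enum S).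
Proof.
have -> : minkowski_sum L S = [set x | exists f : 'I_d -> 'cV[R]_d,
    (forall i, i \in enum S -> nth set0 L i (f i)) /\ x = \sum_(i <- enum S) f i].
  apply/seteqP; split => x [f [fL ->]]; exists f; split.
  - by move=> i; rewrite mem_enum; exact: fL.
  - by rewrite big_enum.
  - by move=> i iS; apply: fL; rewrite mem_enum.
  - by rewrite big_enum.
elim: (enum S) (enum_uniq S) => [_|i s IH /= /andP[i_s us]].
  apply/seteqP; split => [_ [f [_ ->]]|x /= ->]; first by rewrite big_nil.
  by exists (fun=> 0); split => //; rewrite big_nil.
rewrite -IH//; apply/seteqP; split => x.
  move=> [f [fL ->]]; exists (f i, \sum_(j <- s) f j) => /=; last by rewrite scale1r big_cons.
  split; first by apply: fL; rewrite mem_head.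
  by exists f; split => // j js; apply: fL; rewrite inE js orbT.
move=> [[a _] /= [La [f [fL ->]]] <-].
exists (fun j => if j == i then a else f j); split => [j|].
  by rewrite inE; case: eqVneq => [->//|_ /=]; exact: fL.
rewrite big_cons eqxx scale1r; congr (_ + _); apply: eq_big_seq => j js.
by case: eqVneq js i_s => // -> ->.
Qed.

(** Collects the copies of P, at positions 0 and 1 of the list, into one scaled
    copy; the rest of the sum is independent of P. *)
Lemma sum_of_split (P : set 'cV[R]_d) (Ks : seq (set 'cV[R]_d)) s :
  P !=set0 -> segment_closed P ->
  sum_of [:: P, P & Ks] s = scaled_sum (count (fun i : 'I_d => (i < 2)%N) s)%:R P
    (sum_of [:: set0, set0 & Ks] [seq i : 'I_d <- s | (2 <= i)%N]).
Proof.
move=> P0 cP; elim: s => [|i s IH] /=; first by rewrite scaled_sum0.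
rewrite IH; case: ltnP => i2 /=.
  rewrite add1n -scaled_sumS//.
  by congr (scaled_sum _ _); case: (nat_of_ord i) i2 => [|[|]].
rewrite add0n -scaled_sumC; congr (scaled_sum _ _ _).
by case: (nat_of_ord i) i2 => [|[|]].
Qed.

Lemma sum_of_compact_convex (L : seq (set 'cV[R]_d)) s :
  (forall i : 'I_d, i \in s -> compact (nth set0 L i) /\ segment_closed (nth set0 L i)) ->
  compact (sum_of L s) /\ segment_closed (sum_of L s).
Proof.
elim: s => [_|i s IH H] /=.
  split; first exact: compact_set1.
  by move=> x y t _ -> ->; rewrite !scaler0 addr0.
have [|? ?] := IH; first by move=> j js; apply: H; rewrite inE js orbT.
have [] := H i (mem_head _ _).
by split; [exact: scaled_sum_compact|exact: scaled_sum_convex].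
Qed.

Lemma volume_scaled_sum_translate c (P K : set 'cV[R]_d) v : compact P -> compact K ->
  volume (scaled_sum c [set x | P (x - v)] K) = volume (scaled_sum c P K).
Proof.
move=> cP cK; rewrite scaled_sum_translate volume_translate//.
by apply: compact_closed => //; exact: scaled_sum_compact.
Qed.

(** L |-> vol(c L + K) is a valuation for the cut of P by the hyperplane f = a:
    scaling and adding K commute with the union of the two halves, and with their
    intersection by [scaled_sum_cut]. *)
Lemma volume_scaled_sum_cut c (P K : set 'cV[R]_d) (f : 'cV[R]_d -> R) (a : R) :
  continuous f ->
  (forall x y t, f (t *: x + (1 - t) *: y) = t * f x + (1 - t) * f y) ->
  compact P -> segment_closed P -> compact K -> segment_closed K ->
  let V X := fine (volume (scaled_sum c X K)) in
  V P + V (P `&` [set x | f x = a]) =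
  V (P `&` [set x | f x <= a]) + V (P `&` [set x | a <= f x]).
Proof.
move=> cf fE cP vP cK vK V.
have c1 : compact (P `&` [set x | f x <= a]).
  by apply: compact_closedI => //; exact: closed_sublevel.
have c2 : compact (P `&` [set x | a <= f x]).
  by apply: compact_closedI => //; exact: closed_superlevel.
rewrite /V -(volumeUI (@scaled_sum_compact _ _ c _ _ c1 cK) (@scaled_sum_compact _ _ c _ _ c2 cK)).
rewrite -scaled_sumU scaled_sum_cut// -setIUr.
congr (fine (volume (scaled_sum _ _ _)) + _).
apply/seteqP; split => [x Px|x []//]; split => //=.
by case: (lerP (f x) a) => [|/ltW]; [left|right].
Qed.

End MixedVolumeSplit.

(** * Farkas' lemma *)

Section Farkas.
Variable R : realType.

Lemma finite_eps (I : finType) (P : I -> R -> Prop) :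
  (forall i, exists2 e : R, 0 < e & forall e', 0 < e' <= e -> P i e') ->
  exists2 e : R, 0 < e & forall i e', 0 < e' <= e -> P i e'.
Proof.
move=> /(_ _)/cid2-/all_sig2[e e0 eP].
exists (\big[Num.min/1]_i e i).
  by elim/big_ind : _ => // x y x0 y0; rewrite lt_min x0.
move=> i e' /andP[e'0 ee]; apply: eP; rewrite e'0 (le_trans ee)//.
exact: bigmin_le_cond.
Qed.

(** Bartl's induction on the number of rows.  If the inequality v is not already
    implied by the rows of B, some x1 satisfies B x1 <= 0 and v x1 > 0, so that
    a x1 > 0.  Projecting along x1 onto the kernel of a removes the row a, and the
    coefficient of a that is lost is recovered from the values at x1. *)
Lemma farkas_cone k m (A : 'M[R]_(k, m)) (v : 'rV[R]_m) :
  (forall x : 'cV[R]_m, (forall i, (A *m x) i 0 <= 0) -> (v *m x) 0 0 <= 0) ->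
  exists l : 'rV[R]_k, (forall i, 0 <= l 0 i) /\ v = l *m A.
Proof.
elim: k A v => [|k IH] A v Av.
  exists 0; split => [[]//|]; rewrite mul0mx.
  apply/eqP; apply/contraT => v0.
  have /eqP v00 : (v *m v^T) 0 0 = 0.
    apply/eqP; rewrite eq_le Av => [|[]//].
    by rewrite mxE sumr_ge0// => i _; rewrite mxE -expr2 sqr_ge0.
  move: v00; rewrite mxE psumr_eq0 => [|i _]; last by rewrite mxE -expr2 sqr_ge0.
  move/allP => v00; case/eqP: v0; apply/rowP => i; rewrite mxE.
  by have := v00 i (mem_index_enum _); rewrite mxE mulf_eq0 orbb => /eqP.
move: A Av; rewrite -[k.+1]/(1 + k)%N => A Av.
set a := @usubmx _ 1 k m A; set B := @dsubmx _ 1 k m A.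
have AE (x : 'cV[R]_m) : (forall i, (A *m x) i 0 <= 0) <->
    (a *m x) 0 0 <= 0 /\ forall i, (B *m x) i 0 <= 0.
  have -> : A = col_mx a B by rewrite vsubmxK.
  rewrite mul_col_mx; split => [H|[ax Bx] i].
    split; first by have := H (@lshift 1 k 0); rewrite col_mxEu.
    by move=> i; have := H (@rshift 1 k i); rewrite col_mxEd.
  by rewrite mxE; case: splitP => j _ //; rewrite ord1.
have [vB|] := pselect (forall x : 'cV[R]_m, (forall i, (B *m x) i 0 <= 0) -> (v *m x) 0 0 <= 0).
  have [l [l0 ->]] := IH B v vB.
  exists (row_mx 0 l : 'rV_(1 + k)); rewrite -[A]vsubmxK.
  split; last by rewrite mul_row_col mul0mx add0r.
  by move=> i; rewrite mxE; case: splitP => j _ //; rewrite mxE.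
move=> /existsNP[x1 /not_implyP[Bx1 /negP]]; rewrite -ltNge => vx1.
have ax1 : 0 < (a *m x1) 0 0.
  by rewrite ltNge; apply/negP => ax1; move: vx1; rewrite ltNge Av//; apply/AE.
pose c := (a *m x1) 0 0.
pose M : 'M[R]_m := 1%:M - c^-1 *: (x1 *m a).
have aM : a *m M = 0.
  rewrite /M mulmxBr mulmx1 -scalemxAr mulmxA [a *m x1]mx11_scalar mul_scalar_mx.
  by rewrite scalerA mulVf ?gt_eqF// scale1r subrr.
have [x Bx|l [l0 vl]] := IH (B *m M) (v *m M).
  rewrite -mulmxA; apply/Av/AE; split; first by rewrite mulmxA aM mul0mx mxE.
  by move=> i; rewrite mulmxA.
exists (row_mx ((c^-1 * ((v *m x1) 0 0 - (l *m B *m x1) 0 0))%:M) l : 'rV_(1 + k)).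
rewrite -[A]vsubmxK; split.
  move=> i; rewrite mxE; case: splitP => j _ //; rewrite ord1 mxE mulr1n mulr_ge0//.
    by rewrite invr_ge0 ltW.
  rewrite subr_ge0 (le_trans _ (ltW vx1))// -mulmxA mxE sumr_le0// => s _.
  by rewrite mulr_ge0_le0.
rewrite mul_row_col mul_scalar_mx -/a -/B.
have Mx (u : 'rV[R]_m) : u *m M = u - (c^-1 * (u *m x1) 0 0) *: a.
  by rewrite mulmxBr mulmx1 -scalemxAr mulmxA {1}[u *m x1]mx11_scalar mul_scalar_mx scalerA.
move: vl; rewrite mulmxA !Mx => /(canRL (subrK _)) {1}->.
by rewrite mulrBr scalerBl addrC addrA addrAC.
Qed.

(** The cone version for the homogenized system A y <= t b, t >= 0, whose
    infeasibility at t = 1 says that it implies t <= 0. *)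
Lemma farkas_affine k m (A : 'M[R]_(k, m)) (b : 'cV[R]_k) :
  ~ (exists x : 'cV[R]_m, forall i, (A *m x) i 0 <= b i 0) ->
  exists l : 'rV[R]_k, [/\ forall i, 0 <= l 0 i, l *m A = 0 & (l *m b) 0 0 < 0].
Proof.
move=> Ab.
have [|l [l0 lE]] := @farkas_cone _ _ (block_mx A (- b) 0 (- 1%:M : 'M[R]_1))
    (row_mx (0 : 'rV_m) (1%:M : 'M[R]_1)).
  move=> x; rewrite -[x]vsubmxK; set y := usubmx x; set t := dsubmx x.
  rewrite mul_block_col mul_row_col !mul0mx add0r mul1mx add0r => H.
  rewrite leNgt; apply/negP => t0; apply: Ab; exists ((t 0 0)^-1 *: y) => i.
  have := H (lshift 1 i); rewrite col_mxEu mulNmx.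
  have -> : (A *m y - b *m t) i 0 = (A *m y) i 0 - t 0 0 * b i 0.
    by rewrite [LHS]mxE; congr (_ + _); rewrite !mxE big_ord1 mulrC !mxE.
  by rewrite subr_le0 -scalemxAr [X in _ -> X <= _]mxE ler_pdivrMl.
move: lE; rewrite -[l]hsubmxK mul_row_block mulmx0 addr0 => /eq_row_mx[Al bl].
exists (lsubmx l); split => //; first by move=> i; rewrite mxE.
move/matrixP: bl => /(_ 0 0); rewrite mulmxN mulmxN mulmx1 !mxE /= => E.
have := l0 (rshift k 0); lra.
Qed.

End Farkas.

(** * Normal fans through active sets *)

Section ActiveSets.
Variables (R : realType) (n d : nat) (V : 'M[R]_(n, d)).
Implicit Types (h : 'cV[R]_n) (x y : 'cV[R]_d) (A : {set 'I_n}).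

Definition active h x : {set 'I_n} := [set i | (V *m x) i 0 == h i 0].

Definition active_sets h : set {set 'I_n} := [set active h x | x in polyhedron V h].

(** The cone positively spanned by the v_i, i in A.  Multipliers range over all
    indices and vanish off A, so that cones of different A share one type. *)
Definition cone_of A : set 'cV[R]_d :=
  [set v | exists l : 'cV[R]_n,
     [/\ forall i, 0 <= l i 0, forall i, i \notin A -> l i 0 = 0 & v = V^T *m l]].

Lemma activeP h x i : reflect ((V *m x) i 0 = h i 0) (i \in active h x).
Proof. by rewrite inE; exact: eqP. Qed.

Lemma dot_comb (l : 'cV[R]_n) x : dot (V^T *m l) x = \sum_i l i 0 * (V *m x) i 0.
Proof. by rewrite /dot trmx_mul trmxK -mulmxA mxE; apply: eq_bigr => i _; rewrite mxE. Qed.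

Lemma dot_row i x : dot (row i V)^T x = (V *m x) i 0.
Proof. by rewrite /dot trmxK -row_mul mxE. Qed.

Lemma cone_of_gen A i : i \in A -> cone_of A (row i V)^T.
Proof.
move=> iA; exists (delta_mx i 0); split=> [j|j jA|]; first by rewrite mxE ler0n.
  by rewrite mxE andbT; case: eqVneq jA => // ->; rewrite iA.
by rewrite rowE trmx_mul trmx_delta.
Qed.

Lemma comb_le (l : 'cV[R]_n) h x : (forall i, 0 <= l i 0) -> polyhedron V h x ->
  dot (V^T *m l) x <= \sum_i l i 0 * h i 0.
Proof. by move=> l0 Px; rewrite dot_comb ler_sum// => i _; rewrite ler_wpM2l. Qed.

Lemma comb_eq (l : 'cV[R]_n) h x :
  (forall i, i \notin active h x -> l i 0 = 0) ->
  dot (V^T *m l) x = \sum_i l i 0 * h i 0.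
Proof.
move=> lA; rewrite dot_comb; apply: eq_bigr => i _.
by have [/activeP ->//|/lA ->] := boolP (i \in active h x); rewrite !mul0r.
Qed.

(** Complementary slackness. *)
Lemma comb_eq_active (l : 'cV[R]_n) h x : (forall i, 0 <= l i 0) -> polyhedron V h x ->
  dot (V^T *m l) x = \sum_i l i 0 * h i 0 -> forall i, 0 < l i 0 -> i \in active h x.
Proof.
move=> l0 Px; rewrite dot_comb => E i li.
have : \sum_j (l j 0 * h j 0 - l j 0 * (V *m x) j 0) = 0.
  by rewrite sumrB -E subrr.
move=> /eqP; rewrite psumr_eq0 => [|j _]; last by rewrite -mulrBr mulr_ge0// subr_ge0.
move=> /allP/(_ i (mem_index_enum _)); rewrite -mulrBr mulf_eq0 gt_eqF//= subr_eq0.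
by move=> /eqP/esym/activeP.
Qed.

Lemma cone_active_max h x y v : cone_of (active h x) v -> polyhedron V h y ->
  dot v y <= dot v x.
Proof. by move=> [l [l0 lA ->]] Py; rewrite (comb_eq lA) comb_le. Qed.

(** Otherwise Farkas' lemma for the active rows gives a direction that keeps the
    active inequalities and increases v, and a short step from x along it stays in
    P(h). *)
Lemma max_cone_active h x v : polyhedron V h x ->
  (forall y, polyhedron V h y -> dot v y <= dot v x) -> cone_of (active h x) v.
Proof.
move=> Px vmax.
pose W : 'M[R]_(n, d) := \matrix_(i, j) (if i \in active h x then V i j else 0).
have WE (z : 'cV[R]_d) i : (W *m z) i 0 = if i \in active h x then (V *m z) i 0 else 0.
  rewrite mxE; case: ifPn => iA; last by rewrite big1// => j _; rewrite mxE (negbTE iA) mul0r.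
  by rewrite mxE; apply: eq_bigr => j _; rewrite mxE iA.
have [z Wz|l [l0 lE]] := @farkas_cone _ _ _ W v^T.
  have [e e0 eP] : exists2 e : R, 0 < e & forall i e', 0 < e' <= e ->
      (V *m (x + e' *: z)) i 0 <= h i 0.
    apply: finite_eps => i; have [iA|iA] := boolP (i \in active h x).
      exists 1 => // e' /andP[e'0 _]; rewrite mulmxDr -scalemxAr colD colZ.
      move/activeP: (iA) => ->; rewrite gerDl pmulr_rle0//.
      by have := Wz i; rewrite WE iA.
    have gap : 0 < h i 0 - (V *m x) i 0.
      rewrite subr_gt0 lt_neqAle Px andbT.
      by apply: contra iA => /eqP/activeP.
    exists ((h i 0 - (V *m x) i 0) / (`|(V *m z) i 0| + 1)); first by rewrite divr_gt0// ltr_wpDl.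
    move=> e' /andP[e'0]; rewrite ler_pdivlMr ?ltr_wpDl// => ee'.
    rewrite mulmxDr -scalemxAr colD colZ -lerBrDl (le_trans _ ee')// ler_pM2l//.
    by rewrite (le_trans (ler_norm _))// lerDl.
  have /vmax : polyhedron V h (x + e *: z) by move=> i; apply: eP; rewrite e0 lexx.
  rewrite /dot mulmxDr -scalemxAr colD colZ gerDl pmulr_rle0//; exact.
exists (\col_i (if i \in active h x then l 0 i else 0)); split => [i|i iA|].
- by rewrite mxE; case: ifP.
- by rewrite mxE (negbTE iA).
- rewrite -[v]trmxK lE trmx_mul; apply/colP => j; rewrite !mxE; apply: eq_bigr => i _.
  by rewrite !mxE; case: ifP => _; rewrite ?mul0r ?mulr0.
Qed.

Lemma polyhedron_mid h x y : polyhedron V h x -> polyhedron V h y ->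
  polyhedron V h (2^-1 *: (x + y)).
Proof.
by move=> Px Py i; rewrite -scalemxAr mulmxDr colZ colD; have := Px i; have := Py i; lra.
Qed.

Lemma active_mid h x y : polyhedron V h x -> polyhedron V h y ->
  active h (2^-1 *: (x + y)) = active h x :&: active h y.
Proof.
move=> Px Py; apply/setP => i; rewrite !inE -scalemxAr mulmxDr 2!mxE.
have := Px i; have := Py i => ? ?; apply/eqP/andP => [?|[/eqP ? /eqP ?]]; last lra.
by split; apply/eqP; lra.
Qed.

Lemma active_setsI h A B : active_sets h A -> active_sets h B -> active_sets h (A :&: B).
Proof.
move=> [x Px <-] [y Py <-]; exists (2^-1 *: (x + y)); first exact: polyhedron_mid.
exact: active_mid.
Qed.

(** Each face F has a point whose active set is least among the points of F (a
    relative interior point), namely one with the fewest active inequalities,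
    since midpoints intersect active sets; the normal cone of F is spanned by this
    set.  Conversely the points of P(h) where a given active set remains active
    form a face. *)
Lemma normal_fanE h : normal_fan (polyhedron V h) = [set cone_of A | A in active_sets h].
Proof.
apply/seteqP; split.
  move=> _ [F [c [[x0 Fx0] [u [uc FE]]]] <-].
  have FP x : F x -> polyhedron V h x by rewrite FE => -[].
  have s0 : `[< exists2 x, F x & active h x = active h x0 >] by apply/asboolP; exists x0.
  have [B /asboolP[x Fx xB] Bmin] :=
    @arg_minnP _ _ (fun A => `[< exists2 x, F x & active h x = A >])
      (fun A : {set 'I_n} => #|A|) s0.
  have sub y : F y -> active h x \subset active h y.
    move=> Fy; have Fm : F (2^-1 *: (x + y)).
      have := Fx; have := Fy; rewrite FE => -[Py /= uy] [Px /= ux].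
      split; first exact: polyhedron_mid.
      rewrite /= /dot -scalemxAr mulmxDr colZ colD.
      by rewrite -/(dot u x) -/(dot u y) ux uy; lra.
    have : (#|active h x| <= #|active h (2^-1 *: (x + y))|)%N.
      by rewrite xB; apply: Bmin; apply/asboolP; exists (2^-1 *: (x + y)).
    rewrite (active_mid (FP _ Fx) (FP _ Fy)) => le; apply/finset.setIidPl/eqP.
    by rewrite eqEcard finset.subsetIl.
  exists (active h x); first by exists x => //; exact: FP.
  apply/seteqP; split => v /=.
    move=> [l [l0 lA ->]] p y Fp Py.
    rewrite (@comb_eq l h p); first exact: comb_le.
    by move=> i ip; apply: lA; apply: contra ip; exact/fintype.subsetP/sub.
  by move=> vN; apply: max_cone_active => [|y Py]; [exact: FP|exact: vN].
move=> _ [_ [x Px <-] <-].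
exists [set y | polyhedron V h y /\ active h x \subset active h y].
  exists (\sum_(i in active h x) h i 0); split; first by exists x; split.
  pose l : 'cV[R]_n := \col_i (i \in active h x)%:R.
  have l0 i : 0 <= l i 0 by rewrite mxE ler0n.
  have lE : \sum_(i in active h x) h i 0 = \sum_i l i 0 * h i 0.
    rewrite big_mkcond/=; apply: eq_bigr => i _; rewrite mxE.
    by case: ifP => _; rewrite ?mul1r ?mul0r.
  exists (V^T *m l); rewrite lE; split => [y Py|]; first exact: comb_le.
  apply/seteqP; split => y [Py /= H]; split => //=.
    apply: comb_eq => i iy; rewrite mxE; case: (boolP (i \in active h x)) => // ix.
    by rewrite (fintype.subsetP H) in iy.
  apply/fintype.subsetP => i ix; apply: (comb_eq_active l0 Py H).
  by rewrite mxE ix ltr01.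
apply/seteqP; split => v /=.
  by move=> H; apply: max_cone_active => // y Py; apply: H.
move=> [l [l0 lA ->]] p y [Pp px] Py.
rewrite (@comb_eq l h p); first exact: comb_le.
by move=> i ip; apply: lA; apply: contra ip; exact/fintype.subsetP.
Qed.

Lemma active_sets_translate h z : active_sets (h + V *m z) = active_sets h.
Proof.
have sub h' z' : active_sets h' `<=` active_sets (h' + V *m z').
  move=> _ [x Px <-]; exists (x + z').
    by move=> i; rewrite mulmxDr !colD lerD2r.
  by apply/setP => i; rewrite !inE mulmxDr !colD (inj_eq (addIr _)).
apply/seteqP; split => [A|A /sub//].
by move=> /(sub _ (- z)); rewrite mulmxN addrK.
Qed.

Lemma active_setsZ h a : 0 < a -> active_sets (a *: h) = active_sets h.
Proof.
have sub h' a' : 0 < a' -> active_sets h' `<=` active_sets (a' *: h').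
  move=> a0 _ [x Px <-]; exists (a' *: x).
    by move=> i; rewrite -scalemxAr !colZ ler_pM2l.
  by apply/setP => i; rewrite !inE -scalemxAr !colZ (inj_eq (mulfI (lt0r_neq0 a0))).
move=> a0; apply/seteqP; split => [A|A]; last exact: sub.
move=> aA; have : 0 < a^-1 by rewrite invr_gt0.
by move=> /sub/(_ _ aA); rewrite scalerA mulVf ?gt_eqF// scale1r.
Qed.

End ActiveSets.

(** * Type cones and polyhedra *)

Section TypeCone.
Variables (R : realType) (n d : nat) (V : 'M[R]_(n, d)).
Context (V_distinct : injective (fun i => row i V)).
Context (V_unit : forall i, \sum_j V i j ^+ 2 = 1).
Implicit Types (h : 'cV[R]_n) (D : set (set 'cV[R]_d)) (A : {set 'I_n}).

Lemma unit_row_ray i j : pos_hull (row i V) (row j V)^T -> j = i.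
Proof.
move=> [l [l0 E]]; apply: V_distinct => /=.
have {}E k : V j k = l 0 0 * V i k.
  by move/matrixP: E => /(_ k 0); rewrite !mxE big_ord1 !mxE mulrC.
suff l1 : l 0 0 = 1 by apply/rowP => k; rewrite !mxE E l1 mul1r.
have := V_unit j; under eq_bigr do rewrite E exprMn.
rewrite -mulr_sumr V_unit mulr1 => /eqP; rewrite sqrf_eq1 => /orP[/eqP//|/eqP l1].
by have := l0 0; rewrite l1 lerNr oppr0 ler10.
Qed.

Lemma unit_row_neq0 i : (row i V)^T <> 0.
Proof.
move=> /matrixP E; have := V_unit i; rewrite big1 => [/eqP|j _].
  by rewrite eq_sym oner_eq0.
by have := E j 0; rewrite !mxE => ->; rewrite expr0n.
Qed.

Lemma cone_of_set0 v : cone_of V finset.set0 v -> v = 0.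
Proof.
move=> [l [_ l0 ->]]; suff -> : l = 0 by rewrite mulmx0.
by apply/colP => i; rewrite mxE l0// inE.
Qed.

(** The ray spanned by v_i is a normal cone, spanned by some active set A.  Members
    of A are unit vectors on this ray, and v_i is the only one.  In particular
    every inequality is attained, and irredundantly. *)
Lemma active_singleton D h i : fan_rays V D -> type_cone_lift V D h ->
  active_sets V h [set i]%SET.
Proof.
move=> rays hD.
have : D (pos_hull (row i V)).
  have : [set pos_hull (row i V) | i in [set: 'I_n]] (pos_hull (row i V)) by exists i.
  by rewrite -rays => -[].
rewrite -hD normal_fanE => -[A hA AE].
suff -> : [set i]%SET = A by [].
apply/esym/eqP; rewrite finset.eqEsubset; apply/andP; split.
  apply/fintype.subsetP => j jA; rewrite inE; apply/eqP/unit_row_ray.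
  by rewrite -AE; exact: cone_of_gen.
rewrite finset.sub1set; apply: contraPT (@unit_row_neq0 i) => iA.
rewrite not_notE; apply: cone_of_set0.
have -> : finset.set0 = A.
  apply/esym/eqP; rewrite -finset.subset0; apply/fintype.subsetP => j jA.
  have := cone_of_gen V jA; rewrite AE => /unit_row_ray ji.
  by rewrite ji (negbTE iA) in jA.
rewrite AE; exists 1; split => [k|]; last by rewrite mulmx1.
by rewrite mxE ler0n.
Qed.

(** Recovers the active set from its cone: v_i in the cone is maximal where A is
    active, and its maximum over P(h) is h_i. *)
Lemma active_coneE h A i : (forall i, active_sets V h [set i]%SET) ->
  active_sets V h A -> (i \in A) <-> cone_of V A (row i V)^T.
Proof.
move=> h1 [x Px <-]; split; first exact: cone_of_gen.
move=> vx; have [y Py yi] := h1 i.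
have /activeP yE : i \in active V h y by rewrite yi inE.
have := cone_active_max vx Py; rewrite !dot_row yE => le.
by apply/activeP/eqP; rewrite eq_le le Px.
Qed.

(** Since cones determine active sets, equal normal fans mean equal families of
    active sets; all later comparisons of fans go through these families. *)
Lemma normal_fan_active h h' :
  (forall i, active_sets V h [set i]%SET) -> (forall i, active_sets V h' [set i]%SET) ->
  normal_fan (polyhedron V h) = normal_fan (polyhedron V h') ->
  active_sets V h = active_sets V h'.
Proof.
have sub k k' : (forall i, active_sets V k [set i]%SET) ->
    (forall i, active_sets V k' [set i]%SET) ->
    normal_fan (polyhedron V k) = normal_fan (polyhedron V k') ->
    active_sets V k `<=` active_sets V k'.
  move=> k1 k1' E A kA; have : normal_fan (polyhedron V k) (cone_of V A).
    by rewrite normal_fanE; exists A.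
  rewrite E normal_fanE => -[B kB BA]; suff -> : A = B by [].
  apply/setP => i; apply/idP/idP.
    by move/(active_coneE _ k1 kA); rewrite -BA => /(active_coneE _ k1' kB).
  by move/(active_coneE _ k1' kB); rewrite BA => /(active_coneE _ k1 kA).
by move=> h1 h1' E; apply/seteqP; split; apply: sub.
Qed.

Lemma type_cone_lift_active D h h' : fan_rays V D ->
  type_cone_lift V D h -> type_cone_lift V D h' -> active_sets V h = active_sets V h'.
Proof.
move=> rays hD hD'; apply: normal_fan_active => [i|i|].
- exact: active_singleton hD.
- exact: active_singleton hD'.
- by rewrite hD hD'.
Qed.

Lemma type_cone_lift_eq D h h' : type_cone_lift V D h ->
  active_sets V h' = active_sets V h -> type_cone_lift V D h'.
Proof. by rewrite /type_cone_lift/= !normal_fanE => <- ->. Qed.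

(** If z in P(h + h') is not such a sum, Farkas' lemma gives two nonnegative
    combinations mu V = nu V = v with mu h + nu h' < <v, z>.  By completeness v
    lies in the cone of an active set common to P(h) and P(h').  This bounds
    <v, z> by the sum of the maxima of v on P(h) and P(h'), which are at most
    mu h and nu h'. *)
Lemma polyhedronD D h h' z : fan_rays V D -> complete_fan D ->
  type_cone_lift V D h -> type_cone_lift V D h' -> polyhedron V (h + h') z ->
  exists x y, [/\ polyhedron V h x, polyhedron V h' y & z = x + y].
Proof.
move=> rays compl hD hD' Pz; apply: contrapT => nsum.
have [|l [l0 lA lb]] := @farkas_affine _ _ _ (col_mx V (- V)) (col_mx h (h' - V *m z)).
  move=> [x Hx]; apply: nsum; exists x, (z - x); split.
  - by move=> i; have := Hx (lshift n i); rewrite mul_col_mx !col_mxEu.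
  - move=> i; have := Hx (rshift n i).
    by rewrite mul_col_mx !col_mxEd mulNmx mulmxBr !colB colN; lra.
  - by rewrite addrC subrK.
move: lA lb; rewrite -[l]hsubmxK !mul_row_col; set mu := lsubmx l; set nu := rsubmx l.
move=> /eqP; rewrite mulmxN subr_eq0 => /eqP E.
have mu0 i : 0 <= mu^T i 0 by rewrite !mxE.
have nu0 i : 0 <= nu^T i 0 by rewrite !mxE.
pose v := V^T *m mu^T.
have vE : v = V^T *m nu^T by rewrite /v -!trmx_mul E.
have : setT v by [].
rewrite -compl -hD => -[C]; rewrite normal_fanE => -[A hA <-] [l' [l'0 l'A l'E]].
have hA' : active_sets V h' A by rewrite -(type_cone_lift_active rays hD hD').
have [x Px xA] := hA; have [y Py yA] := hA'.
have vz : dot v z <= dot v x + dot v y.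
  rewrite l'E (@comb_eq _ _ _ _ l' h x) ?(@comb_eq _ _ _ _ l' h' y) ?xA ?yA//.
  rewrite -big_split/= (le_trans (comb_le l'0 Pz))// ler_sum// => i _.
  by rewrite colD mulrDr.
have vx : dot v x <= (mu *m h) 0 0.
  by rewrite (le_trans (comb_le mu0 Px))// mxE ler_sum// => i _; rewrite mxE.
have vy : dot v y <= (nu *m h') 0 0.
  by rewrite vE (le_trans (comb_le nu0 Py))// mxE ler_sum// => i _; rewrite mxE.
have vz' : dot v z = (nu *m (V *m z)) 0 0.
  by rewrite vE /dot trmx_mul !trmxK mulmxA.
rewrite mulmxBr colD colB -vz'; lra.
Qed.

(** With P(h + h') = P(h) + P(h'), active sets of sums are intersections of active
    sets, and the family of active sets of P(h) is closed under intersection. *)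
Lemma type_cone_liftD D h h' : fan_rays V D -> complete_fan D ->
  type_cone_lift V D h -> type_cone_lift V D h' -> type_cone_lift V D (h + h').
Proof.
move=> rays compl hD hD'; apply: (type_cone_lift_eq hD).
have hh' := type_cone_lift_active rays hD hD'.
have actD x y : polyhedron V h x -> polyhedron V h' y ->
    polyhedron V (h + h') (x + y) /\ active V (h + h') (x + y) = active V h x :&: active V h' y.
  move=> Px Py; split => [i|]; first by rewrite mulmxDr !colD lerD.
  apply/setP => i; rewrite !inE mulmxDr !colD; have := Px i; have := Py i => ? ?.
  apply/eqP/andP => [?|[/eqP -> /eqP ->]//].
  by split; apply/eqP; lra.
apply/seteqP; split => A.
  move=> [z Pz <-]; have [x [y [Px Py ->]]] := polyhedronD rays compl hD hD' Pz.
  have [_ ->] := actD x y Px Py; apply: active_setsI; first by exists x.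
  by rewrite hh'; exists y.
move=> hA; have := hA; rewrite hh' => -[y Py yA]; have [x Px xA] := hA.
have [Pxy xyA] := actD x y Px Py.
by exists (x + y) => //; rewrite xyA xA yA finset.setIid.
Qed.

Lemma type_cone_liftZ D h a : 0 < a -> type_cone_lift V D h -> type_cone_lift V D (a *: h).
Proof. by move=> a0 hD; apply: (type_cone_lift_eq hD); exact: active_setsZ. Qed.

Lemma type_cone_lift_translate D h z : type_cone_lift V D h -> type_cone_lift V D (h + V *m z).
Proof. by move=> hD; apply: (type_cone_lift_eq hD); exact: active_sets_translate. Qed.

End TypeCone.

Section Polyhedra.
Variables (R : realType) (n d : nat) (V : 'M[R]_(n, d)).
Implicit Types (h : 'cV[R]_n) (A B : {set 'I_n}).

Lemma closed_box_compact m (X : set 'cV[R]_m) (r : R) : closed X ->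
  X `<=` [set x | forall i, `|x i 0| <= r] -> compact X.
Proof.
move=> cX Xr.
have -> : X = [set x^T | x in [set y : 'rV[R]_m | X y^T]].
  apply/seteqP; split => [x Xx|_ [y Xy <-]//].
  by exists x^T; rewrite /= trmxK.
have ctr k : continuous (fun y : 'M[R]_(k, m) => y^T).
  move=> y U /nbhs_ballP[e /= e0 eU]; apply/nbhs_ballP; exists e => //= z [_ yz].
  by apply: eU; split => // i j; rewrite !mxE; exact: yz.
apply: continuous_compact.
  by apply: continuous_subspaceT; exact: ctr.
apply: bounded_closed_compact; last exact: (closed_preim (@ctr _) cX).
exists `|r|; split; first exact: num_real.
move=> M rM y /= Xy; rewrite /Num.norm/= mx_normrE; apply/bigmax_leP; split => /=.
  by rewrite (le_trans _ (ltW rM)).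
move=> [i j] _ /=; rewrite (le_trans _ (ltW rM))// (le_trans _ (ler_norm r))//.
by have := Xr _ Xy j; rewrite mxE ord1.
Qed.

Lemma polyhedron_closed h : closed (polyhedron V h).
Proof.
have -> : polyhedron V h = \bigcap_(i in [set: 'I_n]) [set x | (V *m x) i 0 <= h i 0].
  by apply/seteqP; split => x /= H i; [move=> _; exact: H|exact: (H i I)].
apply: closed_bigI => i _.
by apply: closed_sublevel; exact: mulmx_continuous.
Qed.

Lemma polyhedron_compact h : pos_hull V = setT -> compact (polyhedron V h).
Proof.
move=> Vpos.
have /(_ _)/cid-/all_sig[f fP] : forall u, exists l : 'cV[R]_n,
    (forall i, 0 <= l i 0) /\ u = V^T *m l.
  by move=> u; have : setT u by []; rewrite -Vpos.
pose b u := `|\sum_i f u i 0 * h i 0|.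
have b0 u : 0 <= b u by exact: normr_ge0.
pose r := \sum_j (b (delta_mx j 0) + b (- delta_mx j 0)).
apply: (@closed_box_compact _ _ r) => [|x Px j]; first exact: polyhedron_closed.
have bd u : dot u x <= b u.
  have [f0 uE] := fP u; rewrite {1}uE (le_trans (comb_le f0 Px))//.
  exact: ler_norm.
have -> : x j 0 = dot (delta_mx j 0) x by rewrite /dot trmx_delta -rowE mxE.
have le : b (delta_mx j 0) + b (- delta_mx j 0) <= r.
  by rewrite /r (bigD1 j)//= lerDl sumr_ge0// => i _; rewrite addr_ge0.
rewrite ler_norml (le_trans (bd _)) ?andbT ?(le_trans _ le) ?lerDl//.
rewrite lerNl; have := bd (- delta_mx j 0); rewrite {1}/dot raddfN/= mulNmx colN -/(dot _ x).
by move/le_trans; apply; rewrite (le_trans _ le)// lerDr.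
Qed.

Lemma polyhedron_convex h : segment_closed (polyhedron V h).
Proof.
move=> x y t /andP[t0 t1] Px Py i; rewrite mulmxDr -!scalemxAr colD !colZ.
have t1' : 0 <= 1 - t by rewrite subr_ge0.
have := ler_wpM2l t0 (Px i); have := ler_wpM2l t1' (Py i); lra.
Qed.

(** A certificate of infeasibility from Farkas' lemma is linear in h, so it persists
    for nearby right-hand sides. *)
Lemma active_farkas h A : ~ (exists2 x, polyhedron V h x & A \subset active V h x) ->
  exists w : 'rV[R]_n, (w *m h) 0 0 < 0 /\
    forall k x, polyhedron V k x -> A \subset active V k x -> 0 <= (w *m k) 0 0.
Proof.
move=> nx.
pose I : 'M[R]_n := diag_mx (\row_i (i \in A)%:R).
have IE m (M : 'M[R]_(n, m)) i j : (I *m M) i j = (i \in A)%:R * M i j.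
  by rewrite mul_diag_mx !mxE.
have [|l [l0 lA lb]] := @farkas_affine _ _ _ (col_mx V (- (I *m V))) (col_mx h (- (I *m h))).
  move=> [x Hx]; apply: nx; exists x.
    by move=> i; have := Hx (lshift n i); rewrite mul_col_mx !col_mxEu.
  apply/fintype.subsetP => i iA; apply/activeP/eqP; rewrite eq_le.
  have := Hx (lshift n i); rewrite mul_col_mx !col_mxEu => -> /=.
  have := Hx (rshift n i); rewrite mul_col_mx !col_mxEd mulNmx -mulmxA !colN !IE iA.
  by rewrite !mul1r lerN2.
exists (lsubmx l - rsubmx l *m I); split.
  move: lb; rewrite -[l]hsubmxK mul_row_col !row_mxKl !row_mxKr mulmxN mulmxBl.
  by rewrite mulmxA.
move=> k x Pk Ak.
have -> : ((lsubmx l - rsubmx l *m I) *m k) 0 0 = (lsubmx l *m (k - V *m x)) 0 0 -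
    (rsubmx l *m (I *m (k - V *m x))) 0 0.
  move: lA; rewrite -[l]hsubmxK mul_row_col row_mxKl row_mxKr mulmxN => /eqP.
  rewrite subr_eq0 => /eqP E; rewrite -colB; congr (fun_of_matrix _ 0 0).
  have E0 : (lsubmx l - rsubmx l *m I) *m V = 0 by rewrite mulmxBl E mulmxA subrr.
  by rewrite mulmxA -mulmxBl mulmxBr mulmxA E0 mul0mx subr0.
have -> : I *m (k - V *m x) = 0.
  apply/colP => i; rewrite IE colB [RHS]mxE.
  case: (boolP (i \in A)) => [/(fintype.subsetP Ak)/activeP ->|_]; first by rewrite subrr mulr0.
  by rewrite mul0r.
rewrite mulmx0 [X in _ - X]mxE subr0 mxE sumr_ge0// => i _.
by apply: mulr_ge0; [rewrite mxE|rewrite colB subr_ge0].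
Qed.

Lemma near_active h A : ~ (exists2 x, polyhedron V h x & A \subset active V h x) ->
  \forall k \near h, ~ (exists2 x, polyhedron V k x & A \subset active V k x).
Proof.
move=> /active_farkas[w [wh wA]].
have : \forall k \near h, (w *m k) 0 0 < 0.
  by apply: near_lt wh; [exact: mulmx_continuous|exact: cst_continuous].
apply: near_sub => k wk [x Pk Ak].
by have := wA k x Pk Ak; rewrite leNgt wk.
Qed.

(** Linear independence of the v_i, i in A, without reindexing A. *)
Definition rows_indep A := forall mu : 'rV[R]_n,
  (forall i, i \notin A -> mu 0 i = 0) -> mu *m V = 0 -> mu = 0.

(** M solves the equations indexed by A, for every right-hand side; its columns
    off A vanish so that the solution depends only on the entries indexed by A. *)
Lemma rows_indep_solve A : rows_indep A ->
  exists M : 'M[R]_(d, n),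
    (forall (c : 'cV[R]_n) i, i \in A -> (V *m (M *m c)) i 0 = c i 0) /\
    (forall i k, i \notin A -> M k i = 0).
Proof.
move=> indA; pose I : 'M[R]_n := diag_mx (\row_i (i \in A)%:R).
have IE m (M : 'M[R]_(n, m)) i j : (I *m M) i j = (i \in A)%:R * M i j.
  by rewrite mul_diag_mx !mxE.
have IT : I^T = I by rewrite /I tr_diag_mx.
suff /submxP[M ME] : (I <= (I *m V)^T)%MS.
  exists (I *m M)^T; split=> [c i iA|i k iA]; last by rewrite mxE IE (negbTE iA) mul0r.
  have E : I *m V *m M^T = I by rewrite -[LHS]trmxK trmx_mul trmxK -ME IT.
  have := congr1 (fun X => (X *m (I *m c)) i 0) E.
  by rewrite -!mulmxA !IE iA !mul1r trmx_mul IT -!mulmxA.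
rewrite submxE; apply/eqP/matrixP => i j; rewrite IE [RHS]mxE.
set K := cokermx _.
have [iA|] := boolP (i \in A); last by rewrite mul0r.
rewrite mul1r.
pose c := (col j (I *m K))^T.
have cE k : c 0 k = (k \in A)%:R * K k j by rewrite mxE [LHS]mxE IE.
suff c0 : c = 0 by have := congr1 (fun u : 'rV_n => u 0 i) c0; rewrite /= cE iA mul1r [RHS]mxE.
apply: indA => [k kA|]; first by rewrite cE (negbTE kA) mul0r.
have VI : V^T *m I = (I *m V)^T by rewrite trmx_mul IT.
rewrite /c colE -[V]trmxK -trmx_mul mulmxA [V^T *m _]mulmxA VI.
by rewrite mulmx_coker mul0mx trmx0.
Qed.

End Polyhedra.

(** * Circuits and the fan near a degenerate corner *)

Section Circuits.
Variables (R : realType) (n d : nat) (V : 'M[R]_(n, d)).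
Implicit Types (h : 'cV[R]_n) (A B C : {set 'I_n}) (p : 'I_n) (lam : 'I_n -> R).

Lemma free_rows_indep B : free [seq row i V | i in B] -> rows_indep V B.
Proof.
move=> freeB mu muB; rewrite mulmx_sum_row => E.
have {}E : \sum_(i <- enum B) mu 0 i *: row i V = 0.
  rewrite big_enum -[RHS]E [RHS](bigID (mem B))/= [X in _ = _ + X]big1 ?addr0// => i iB.
  by rewrite muB// scale0r.
apply/rowP => i; rewrite [RHS]mxE; have [iB|/muB//] := boolP (i \in B).
pose s := enum B.
have sz : size [seq row j V | j <- s] = size s by rewrite size_map.
have k0 : forall k : 'I_(size [seq row j V | j <- s]), mu 0 (nth i s k) = 0.
  apply/(@freeP _ _ _ (in_tuple [seq row j V | j <- s])); first exact: freeB.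
  rewrite -[RHS]E (big_nth i) big_mkord -sz; apply: eq_bigr => k _.
  by rewrite (nth_map i)// -sz.
have iz : (index i s < size [seq row j V | j <- s])%N by rewrite sz index_mem mem_enum.
by have := k0 (Ordinal iz); rewrite /= nth_index// mem_enum.
Qed.

Lemma circuit_indep C p : circuit V C -> p \in C -> rows_indep V (C :\ p).
Proof.
move=> /minsetP[_ minC] pC; apply: free_rows_indep; apply: contraT => nfree.
have /setP/(_ p) := minC _ nfree (subD1set C p).
by rewrite !inE eqxx pC.
Qed.

Lemma mulmx1_rect k m (P : 'M[R]_(k, m)) (Q : 'M[R]_(m, k)) :
  k = m -> P *m Q = 1%:M -> Q *m P = 1%:M.
Proof. by move=> km; subst m; exact: mulmx1C. Qed.

(** d independent equations in d unknowns: the square matrix of the rows in B has a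
    right inverse, hence a left inverse. *)
Lemma rows_indep_inj B (z : 'cV[R]_d) : rows_indep V B -> #|B| = d ->
  (forall i, i \in B -> (V *m z) i 0 = 0) -> z = 0.
Proof.
move=> /rows_indep_solve[M [VM _]] cardB z0.
pose P : 'M[R]_(#|B|, d) := \matrix_(a, j) V (enum_val a) j.
pose Q : 'M[R]_(d, #|B|) := \matrix_(j, b) M j (enum_val b).
have PQ : P *m Q = 1%:M.
  apply/matrixP => a b; have := VM (delta_mx (enum_val b) 0) _ (enum_valP a).
  rewrite mulmxA -colE mxE mxE => E; rewrite !mxE.
  under eq_bigr do rewrite !mxE.
  by move: E; rewrite !mxE andbT (inj_eq enum_val_inj).
have := mulmx1_rect cardB PQ => QP; rewrite -[z]mul1mx -QP -mulmxA.
suff -> : P *m z = 0 by rewrite mulmx0.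
apply/colP => a; rewrite [RHS]mxE -(z0 _ (enum_valP a)) !mxE.
by apply: eq_bigr => j _; rewrite mxE.
Qed.

Definition slack_row lam C p : 'rV[R]_n :=
  \row_i ((if i \in C :\ p then lam i else 0) - (i == p)%:R).

(** The amount by which the inequality p cuts off the point where the inequalities
    of C \ p are equalities. *)
Definition slack lam C p h : R := (slack_row lam C p *m h) 0 0.

Lemma slackE lam C p h : slack lam C p h = \sum_(i in C :\ p) lam i * h i 0 - h p 0.
Proof.
rewrite /slack mxE [in RHS]big_mkcond/=.
have -> : h p 0 = \sum_i (i == p)%:R * h i 0.
  rewrite (bigD1 p)//= eqxx mul1r big1 ?addr0// => i ip.
  by rewrite (negbTE ip) mul0r.
rewrite -sumrB; apply: eq_bigr => i _; rewrite mxE mulrBl.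
by case: ifP => // _; rewrite mul0r.
Qed.

Lemma hyperbolic_row lam C p (x : 'cV[R]_d) : hyperbolic_relation V C p lam ->
  (V *m x) p 0 = \sum_(i in C :\ p) lam i * (V *m x) i 0.
Proof.
move=> [_ E]; rewrite -dot_row E /dot raddf_sum/= raddf_sum/= mulmx_suml summxE.
by apply: eq_bigr => i _; rewrite trmxK -scalemxAl colZ -row_mul; congr (_ * _); rewrite mxE.
Qed.

Lemma slack_im lam C p (x : 'cV[R]_d) : hyperbolic_relation V C p lam ->
  slack lam C p (V *m x) = 0.
Proof. by move=> rel; rewrite slackE (hyperbolic_row x rel) subrr. Qed.

Lemma slackD lam C p h k : slack lam C p (h + k) = slack lam C p h + slack lam C p k.
Proof. by rewrite /slack mulmxDr mxE. Qed.

Lemma slackZ lam C p a h : slack lam C p (a *: h) = a * slack lam C p h.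
Proof. by rewrite /slack -scalemxAr mxE. Qed.

Lemma slack_delta lam C p i : slack lam C p (delta_mx i 0) =
  (if i \in C :\ p then lam i else 0) - (i == p)%:R.
Proof. by rewrite /slack -colE !mxE. Qed.

Lemma slack_continuous lam C p : continuous (slack lam C p).
Proof. exact: mulmx_continuous. Qed.

End Circuits.

Section LocalFan.
Variables (R : realType) (n d : nat) (V : 'M[R]_(n, d)).
Implicit Types (h : 'cV[R]_n) (A B C : {set 'I_n}).

Lemma gap_eps (a b c : R) : b < a ->
  exists2 e : R, 0 < e & forall e', 0 < e' <= e -> b - e' * c < a.
Proof.
move=> ba; exists ((a - b) / (`|c| + 1)); first by rewrite divr_gt0 ?subr_gt0// ltr_wpDl.
move=> e' /andP[e'0]; rewrite ler_pdivlMr ?ltr_wpDl// => ee'.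
have cc : - c < `|c| + 1 by rewrite (le_lt_trans (ler_norm _))// normrN ltrDl.
have : e' * - c < e' * (`|c| + 1) by rewrite ltr_pM2l.
by rewrite mulrN; lra.
Qed.

(** A strict inequality at x0 persists at the point obtained by following a change
    of right-hand side with M and then moving by e(h) in the direction - M w. *)
Lemma near_gap h0 (x0 : 'cV[R]_d) (M : 'M[R]_(d, n)) (w : 'cV[R]_n) (e : 'cV[R]_n -> R) j :
  {for h0, continuous e} -> (V *m x0) j 0 - e h0 * (V *m (M *m w)) j 0 < h0 j 0 ->
  \forall h \near h0, (V *m (x0 + M *m (h - h0 - e h *: w))) j 0 < h j 0.
Proof.
move=> ce gap.
have E h : (V *m (x0 + M *m (h - h0 - e h *: w))) j 0 =
    (V *m M *m h) j 0 + ((V *m x0) j 0 - (V *m M *m h0) j 0) - e h * (V *m (M *m w)) j 0.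
  rewrite mulmxDr colD !mulmxBr -!scalemxAr !colB colZ !mulmxA; ring.
have : \forall h \near h0, (V *m M *m h) j 0 + ((V *m x0) j 0 - (V *m M *m h0) j 0) -
    e h * (V *m (M *m w)) j 0 < h j 0.
  apply: near_lt; last by rewrite [X in X - _]addrC subrK.
  - apply: continuousB.
      by apply: continuousD; [exact: mulmx_continuous|exact: cst_continuous].
    by apply: continuousM; [exact: ce|exact: cst_continuous].
  - exact: coord_continuous.
by apply: near_sub => h; rewrite E.
Qed.

(** At a point with independent active set A0 the equalities of A0 can be
    prescribed at will: keep those in A, relax the others by a small constant e. *)
Lemma near_active_indep h0 (x0 : 'cV[R]_d) A : polyhedron V h0 x0 ->
  rows_indep V (active V h0 x0) -> A \subset active V h0 x0 ->
  \forall h \near h0, active_sets V h A.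
Proof.
move=> Px0 /rows_indep_solve[M [VM _]] sA.
pose w : 'cV[R]_n := \col_i (i \in active V h0 x0 :\: A)%:R.
have wE i : i \in active V h0 x0 -> w i 0 = (i \notin A)%:R.
  by move=> iA; rewrite mxE finset.in_setD iA andbT.
have [e e0 eP] : exists2 e : R, 0 < e & forall j e', 0 < e' <= e ->
    j \notin active V h0 x0 -> (V *m x0) j 0 - e' * (V *m (M *m w)) j 0 < h0 j 0.
  apply: finite_eps => j; have [jA|jA] := boolP (j \in active V h0 x0); first by exists 1.
  have gap : (V *m x0) j 0 < h0 j 0.
    by rewrite lt_neqAle Px0 andbT; apply: contra jA => /eqP/activeP.
  by have [e e0 eP] := gap_eps ((V *m (M *m w)) j 0) gap; exists e => // e' e'e _; exact: eP.
have : \forall h \near h0, forall j, j \notin active V h0 x0 ->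
    (V *m (x0 + M *m (h - h0 - e *: w))) j 0 < h j 0.
  apply: near_forall => j; have [jA|jA] := boolP (j \in active V h0 x0).
    exact: near_all.
  have ee : 0 < e <= e by rewrite e0 lexx.
  have K := @near_gap h0 x0 M w (fun=> e) j (@cst_continuous _ _ _ _) (eP j e ee jA).
  by apply: near_sub K => h H _.
apply: near_sub => h hj.
have hi i : i \in active V h0 x0 ->
    (V *m (x0 + M *m (h - h0 - e *: w))) i 0 = h i 0 - e * (i \notin A)%:R.
  move=> iA; rewrite mulmxDr colD VM// !colB colZ wE//.
  by move/activeP: iA => ->; ring.
exists (x0 + M *m (h - h0 - e *: w)).
  move=> i; have [iA|/hj/ltW//] := boolP (i \in active V h0 x0).
  by rewrite hi// gerBl mulr_ge0 ?ler0n// ltW.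
apply/setP => i; rewrite inE; have [iA|iA] := boolP (i \in active V h0 x0).
  rewrite hi// -subr_eq0 addrAC subrr add0r oppr_eq0 mulf_eq0 gt_eqF//=.
  by case: (i \in A); rewrite ?eqxx ?oner_eq0.
rewrite lt_eqF ?hj//; apply/esym; apply: contraNF iA; exact: (fintype.subsetP sA).
Qed.

Section Corner.
Variables (C : {set 'I_n}) (p : 'I_n) (lam : 'I_n -> R).
Context (C_circuit : circuit V C) (pC : p \in C).
Context (C_rel : hyperbolic_relation V C p lam) (C_card : #|C| = d.+1).
Context (h0 : 'cV[R]_n) (x0 : 'cV[R]_d).
Context (Px0 : polyhedron V h0 x0) (actx0 : active V h0 x0 = C).

Let t := slack lam C p.

Lemma corner_slack0 : t h0 = 0.
Proof.
rewrite /t slackE -[RHS](@slack_im _ _ _ V lam C p x0)// slackE.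
have hi i : i \in C -> h0 i 0 = (V *m x0) i 0 by rewrite -actx0 => /activeP.
rewrite hi//; congr (_ - _); apply: eq_bigr => i; rewrite inE => /andP[_ iC].
by rewrite hi.
Qed.

(** At a corner with active set C only the d inequalities of the base C \ p can be
    prescribed.  Those outside A are relaxed by a common amount f(h), and the
    value of v_p is then h_p + t(h) - f(h) L, with L > 0 the weight of the relaxed
    ones.  So f(h) = t(h) / L makes p active, and a constant f leaves p inactive
    once t(h) is small. *)
Lemma near_active_corner A : A \subset C -> ~~ (C :\ p \subset A) ->
  \forall h \near h0, 0 < t h -> active_sets V h A.
Proof.
move=> AC nBA.
have /rows_indep_solve[M [VM _]] := circuit_indep C_circuit pC.
pose w : 'cV[R]_n := \col_i (i \in C :\ p :\: A)%:R.
have wE i : i \in C :\ p -> w i 0 = (i \notin A)%:R.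
  by move=> iB; rewrite mxE finset.in_setD iB andbT.
have w0 i : 0 <= w i 0 by rewrite mxE ler0n.
pose L := \sum_(i in C :\ p) lam i * w i 0.
have L0 : 0 < L.
  have [k kB kA] := fintype.subsetPn nBA.
  rewrite /L (bigD1 k)//= ltr_pwDl//; last first.
    by rewrite sumr_ge0// => i /andP[iB _]; rewrite mulr_ge0// ltW// C_rel.1.
  by rewrite wE// kA mulr1 C_rel.1.
have [e e0 eP] : exists2 e : R, 0 < e & forall j e', 0 < e' <= e ->
    j \notin C -> (V *m x0) j 0 - e' * (V *m (M *m w)) j 0 < h0 j 0.
  apply: finite_eps => j; have [jC|jC] := boolP (j \in C); first by exists 1.
  have gap : (V *m x0) j 0 < h0 j 0.
    by rewrite lt_neqAle Px0 andbT; apply: contra jC => /eqP/activeP; rewrite actx0.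
  by have [e e0 eP] := gap_eps ((V *m (M *m w)) j 0) gap; exists e => // e' e'e _; exact: eP.
pose f h := if p \in A then t h / L else e.
have cf : {for h0, continuous f}.
  rewrite /f; case: (p \in A); last exact: cst_continuous.
  by apply: continuousM; [exact: slack_continuous|exact: cst_continuous].
have : \forall h \near h0, forall j, j \notin C ->
    (V *m (x0 + M *m (h - h0 - f h *: w))) j 0 < h j 0.
  apply: near_forall => j; have [jC|jC] := boolP (j \in C).
    exact: near_all.
  have : (V *m x0) j 0 - f h0 * (V *m (M *m w)) j 0 < h0 j 0.
    rewrite /f; case: ifP => _; last by apply: eP; rewrite ?e0 ?lexx.
    rewrite corner_slack0 mul0r mul0r subr0 lt_neqAle Px0 andbT.
    by apply: contra jC => /eqP/activeP; rewrite actx0.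
  by move=> /(near_gap cf) K; apply: near_sub K => h H _.
have : \forall h \near h0, t h < e * L.
  apply: near_lt; [exact: slack_continuous|exact: cst_continuous|].
  by rewrite corner_slack0 mulr_gt0.
apply: near_sub2 => h te hj t0.
have f0 : 0 < f h by rewrite /f; case: ifP => _ //; rewrite divr_gt0.
set x := x0 + M *m (h - h0 - f h *: w).
have hB i : i \in C :\ p -> (V *m x) i 0 = h i 0 - f h * (i \notin A)%:R.
  move=> iB; rewrite mulmxDr colD VM// !colB colZ wE//.
  have : i \in active V h0 x0 by move: iB; rewrite actx0 inE => /andP[].
  by move/activeP => ->; ring.
have hp : (V *m x) p 0 = h p 0 + (t h - f h * L).
  rewrite (hyperbolic_row x C_rel) /t slackE /L mulr_sumr [RHS]addrC addrAC subrK -sumrB.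
  apply: eq_bigr => i iB; rewrite hB// wE//; ring.
have hpA : if p \in A then (V *m x) p 0 = h p 0 else (V *m x) p 0 < h p 0.
  rewrite hp /f; case: (p \in A); first by rewrite mulfVK ?gt_eqF// subrr addr0.
  by rewrite gtrDl subr_lt0.
exists x.
  move=> i; have [iC|/hj/ltW//] := boolP (i \in C).
  have [->|ip] := eqVneq i p; first by move: hpA; case: ifP => _ => [->|/ltW].
  by rewrite hB ?inE ?ip// gerBl mulr_ge0 ?ler0n// ltW.
apply/setP => i; rewrite inE; have [iC|iC] := boolP (i \in C).
  have [->|ip] := eqVneq i p.
    by move: hpA; case: (p \in A) => [->|/lt_eqF ->]; rewrite ?eqxx.
  rewrite hB ?inE ?ip// -subr_eq0 addrAC subrr add0r oppr_eq0 mulf_eq0 gt_eqF//=.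
  by case: (i \in A); rewrite ?eqxx ?oner_eq0.
rewrite lt_eqF ?hj//; apply/esym; apply: contraNF iC; exact: (fintype.subsetP AC).
Qed.

(** Where the whole base is active, v_p exceeds h_p by the slack. *)
Lemma corner_inactive h A : 0 < t h -> active_sets V h A -> ~~ (C :\ p \subset A).
Proof.
move=> t0 [x Px <-]; apply/negP => sB; have := Px p.
rewrite (hyperbolic_row x C_rel) leNgt => /negP; apply.
rewrite -subr_gt0 [ltRHS](_ : _ = t h)// /t slackE; congr (_ - _).
by apply: eq_bigr => i /(fintype.subsetP sB)/activeP ->.
Qed.

(** In the simplex cut off by p each v_i, i in the base, is within t(h) / lambda_i
    of h_i.  For j outside C, v_j is a combination of the base vectors, so its
    value is within a multiple of t(h) of its value at the corner, which is less
    than h_j. *)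
Lemma near_corner_simplex : \forall h \near h0, forall x : 'cV[R]_d,
  (forall i, i \in C :\ p -> (V *m x) i 0 <= (h : 'cV[R]_n) i 0) -> h p 0 <= (V *m x) p 0 ->
  forall j, j \notin C -> (V *m x) j 0 < h j 0.
Proof.
have indB := circuit_indep C_circuit pC.
have cardB : #|C :\ p| = d by have := cardsD1 p C; rewrite pC C_card add1n => -[].
have [M [VM M0]] := rows_indep_solve indB.
have Mx (c c' : 'cV[R]_n) : (forall i, i \in C :\ p -> c i 0 = c' i 0) -> M *m c = M *m c'.
  move=> cc; apply/colP => k; rewrite !mxE; apply: eq_bigr => i _.
  by have [/cc ->//|/M0 ->] := boolP (i \in C :\ p); rewrite !mul0r.
have MV (x : 'cV[R]_d) : M *m (V *m x) = x.
  apply/eqP; rewrite -subr_eq0; apply/eqP/(rows_indep_inj indB cardB) => i iB.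
  by rewrite mulmxBr colB VM// subrr.
have Mh0 : M *m h0 = x0.
  rewrite -[RHS]MV; apply: Mx => i; rewrite inE -actx0 => /andP[_ /activeP ->//].
pose k j := \sum_(i in C :\ p) `|(V *m M) j i| / lam i.
have : \forall h \near h0, forall j, j \notin C -> (V *m M *m h) j 0 + t h * k j < h j 0.
  apply: near_forall => j; have [jC|jC] := boolP (j \in C); first exact: near_all.
  have : \forall h \near h0, (V *m M *m h) j 0 + t h * k j < h j 0.
    apply: near_lt.
    - apply: continuousD; first exact: mulmx_continuous.
      by apply: continuousM; [exact: slack_continuous|exact: cst_continuous].
    - exact: coord_continuous.
    rewrite corner_slack0 mul0r addr0 -mulmxA Mh0 lt_neqAle Px0 andbT.
    by apply: contra jC => /eqP/activeP; rewrite actx0.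
  by move=> K; apply: near_sub K => h H _.
apply: near_sub => h hj x xB xp j jC; apply: le_lt_trans (hj j jC).
have -> : (V *m x) j 0 = (V *m M *m h) j 0 -
    \sum_(i in C :\ p) (V *m M) j i * (h i 0 - (V *m x) i 0).
  rewrite -{1}(MV x) mulmxA; apply/eqP; rewrite eq_sym subr_eq addrC -subr_eq -colB -mulmxBr.
  rewrite mxE (bigID (mem (C :\ p)))/= [X in _ + X]big1 ?addr0.
    by apply/eqP; apply: eq_bigr => i _; rewrite colB.
  move=> i iB; rewrite mxE big1 ?mul0r// => l _; by rewrite M0// mulr0.
rewrite lerD2l -sumrN /k mulr_sumr ler_sum// => i iB.
have d0 : 0 <= h i 0 - (V *m x) i 0 by rewrite subr_ge0 xB.
have l0 : 0 < lam i by exact: C_rel.1.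
have dt : lam i * (h i 0 - (V *m x) i 0) <= t h.
  have tE : t h = \sum_(i in C :\ p) lam i * (h i 0 - (V *m x) i 0) + ((V *m x) p 0 - h p 0).
    rewrite /t slackE (hyperbolic_row x C_rel) addrA -big_split/=; congr (_ - _).
    by apply: eq_bigr => k' _; rewrite -mulrDr subrK.
  rewrite tE (bigD1 i)//= -addrA lerDl addr_ge0 ?subr_ge0// sumr_ge0// => k' /andP[kB _].
  by rewrite mulr_ge0 ?subr_ge0 ?xB// ltW// C_rel.1.
rewrite -mulNr (le_trans (ler_wpM2r d0 (ler_norm _)))// normrN mulrCA.
by rewrite ler_wpM2l// ler_pdivlMr// mulrC.
Qed.

End Corner.

(** The family F consists of the subsets of active sets of P(h0) containing neither
    base; each of the finitely many sets A is decided for all h near h0. *)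
Lemma local_fan C1 p1 lam1 C2 p2 lam2 h0 :
  circuit V C1 -> p1 \in C1 -> hyperbolic_relation V C1 p1 lam1 -> #|C1| = d.+1 ->
  circuit V C2 -> p2 \in C2 -> hyperbolic_relation V C2 p2 lam2 -> #|C2| = d.+1 ->
  (forall x, polyhedron V h0 x -> [\/ active V h0 x = C1, active V h0 x = C2 |
     rows_indep V (active V h0 x)]) ->
  exists F : set {set 'I_n}, \forall h \near h0,
    0 < slack lam1 C1 p1 h -> 0 < slack lam2 C2 p2 h -> active_sets V h = F.
Proof.
move=> c1 pC1 r1 d1 c2 pC2 r2 d2 gen.
exists [set A : {set 'I_n} | [/\ exists2 x, polyhedron V h0 x & A \subset active V h0 x,
  ~~ (C1 :\ p1 \subset A) & ~~ (C2 :\ p2 \subset A)]].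
suff : \forall h \near h0, forall A : {set 'I_n},
    0 < slack lam1 C1 p1 h -> 0 < slack lam2 C2 p2 h -> active_sets V h A <->
    [/\ exists2 x, polyhedron V h0 x & A \subset active V h0 x,
      ~~ (C1 :\ p1 \subset A) & ~~ (C2 :\ p2 \subset A)].
  by apply: near_sub => h hA t1 t2; apply/seteqP; split => A /(hA _ t1 t2).
apply: near_forall => A.
have [B1|nB1] := boolP (C1 :\ p1 \subset A).
  apply: near_all => h t1 t2; split => [/(corner_inactive r1 t1)|[]//].
  by rewrite B1.
have [B2|nB2] := boolP (C2 :\ p2 \subset A).
  apply: near_all => h t1 t2; split => [/(corner_inactive r2 t2)|[]//].
  by rewrite B2.
have [[x Px xA]|nx] := pselect (exists2 x, polyhedron V h0 x & A \subset active V h0 x); last first.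
  apply: near_sub (near_active nx) => h nh t1 t2; split=> [[x Px xA]|[]//].
  by case: nh; exists x => //; rewrite xA.
have act : \forall h \near h0,
    0 < slack lam1 C1 p1 h -> 0 < slack lam2 C2 p2 h -> active_sets V h A.
  have [xC|xC|xI] := gen x Px.
  - rewrite xC in xA.
    by apply: near_sub (near_active_corner c1 pC1 r1 Px xC xA nB1) => h H t1 _; exact: H.
  - rewrite xC in xA.
    by apply: near_sub (near_active_corner c2 pC2 r2 Px xC xA nB2) => h H _ t2; exact: H.
  - by apply: near_sub (near_active_indep Px xI xA) => h H _ _.
by apply: near_sub act => h H t1 t2; split => // _; [split => //; exists x|exact: H].
Qed.

End LocalFan.

(** * The mixed form is orthogonal to a corner cut *)

Section MixedForm.
Variables (R : realType) (n d : nat) (V : 'M[R]_(n, d)).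
Variable K : 'I_(d - 2) -> set 'cV[R]_d.
Context (V_pos_span : pos_hull V = setT).
Context (K_body : forall j, convex_body (K j)).
Implicit Types (h : 'cV[R]_n).

Let Ks := [seq K j | j <- enum 'I_(d - 2)].
Let KS (S : {set 'I_d}) := sum_of [:: set0, set0 & Ks] [seq i : 'I_d <- enum S | (2 <= i)%N].
Let c (S : {set 'I_d}) : R := (count (fun i : 'I_d => (i < 2)%N) (enum S))%:R.

(** The volume attached to the index set S in the polarization formula, as a
    function of the body X put in the first two places. *)
Definition polarization_term S (X : set 'cV[R]_d) : R := fine (volume (scaled_sum (c S) X (KS S))).

Lemma KS_compact_convex S : compact (KS S) /\ segment_closed (KS S).
Proof.
apply: sum_of_compact_convex => i; rewrite mem_filter => /andP[i2 _].
have -> : nth set0 [:: set0, set0 & Ks] i = nth set0 Ks (i - 2).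
  by case: (nat_of_ord i) i2 => [|[|k]]// _; rewrite subn2.
have id2 : (i - 2 < d - 2)%N by rewrite ltn_sub2r// (leq_ltn_trans i2).
rewrite (nth_map (Ordinal id2)); last by rewrite size_enum_ord.
have [_ Kc Kv] := K_body (nth (Ordinal id2) (enum 'I_(d - 2)) (i - 2)).
by split => //; exact: convex_set_segment.
Qed.

Lemma mixed_volume_polarization_term h : polyhedron V h !=set0 ->
  mixed_volume [:: polyhedron V h, polyhedron V h & Ks] =
  (d`!)%:R^-1 * \sum_(S : {set 'I_d}) (-1) ^+ (d - #|S|) * polarization_term S (polyhedron V h).
Proof.
move=> P0; congr (_ * _); apply: eq_bigr => S _; congr (_ * _).
by rewrite minkowski_sumE sum_of_split//; exact: polyhedron_convex.
Qed.

Lemma polyhedron_translate h z :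
  polyhedron V (h + V *m z) = [set x | polyhedron V h (x - z)].
Proof.
by apply/seteqP; split => x Px i; have := Px i; rewrite mulmxBr colB colD lerBlDr.
Qed.

Lemma polarization_term_translate S (X : set 'cV[R]_d) y : compact X ->
  polarization_term S [set x | X (x - y)] = polarization_term S X.
Proof.
have [Kc Kv] := KS_compact_convex S.
by move=> cX; rewrite /polarization_term volume_scaled_sum_translate.
Qed.

Section OneCircuit.
Variables (C : {set 'I_n}) (p : 'I_n) (lam : 'I_n -> R).
Context (C_circuit : circuit V C) (pC : p \in C) (C_rel : hyperbolic_relation V C p lam).

(** The frustum between heights h_p and h_p + s of the simplex cut off by p. *)
Let cut h (s : R) : set 'cV[R]_d := [set x |
  (forall i, i \in C :\ p -> (V *m x) i 0 <= h i 0) /\ h p 0 <= (V *m x) p 0 <= h p 0 + s].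

(** On the simplex cut off by p the inequalities outside C hold strictly, so the
    shape of P(h) near it is governed by C alone. *)
Definition simplex_corner h := forall x : 'cV[R]_d,
  (forall i, i \in C :\ p -> (V *m x) i 0 <= h i 0) -> h p 0 <= (V *m x) p 0 ->
  forall j, j \notin C -> (V *m x) j 0 < h j 0.

Lemma polyhedron_cut h s : 0 <= s -> simplex_corner h ->
  polyhedron V (h + s *: delta_mx p 0) `&` [set x | h p 0 <= (V *m x) p 0] = cut h s.
Proof.
have E i : (h + s *: delta_mx p 0) i 0 = h i 0 + s * (i == p)%:R.
  by rewrite colD colZ mxE andbT.
move=> s0 simp; apply/seteqP; split => x /=.
  move=> [Px xp]; split; last by have := Px p; rewrite E eqxx mulr1 xp.
  by move=> i; rewrite !inE => /andP[ip _]; have := Px i; rewrite E (negbTE ip) mulr0 addr0.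
move=> [xB /andP[xp xs]]; split => // i; rewrite E.
have [->|ip] := eqVneq i p; first by rewrite mulr1.
rewrite mulr0 addr0; have [iC|iC] := boolP (i \in C); first by apply: xB; rewrite !inE ip.
exact/ltW/simp.
Qed.

Lemma polyhedron_low h s : 0 <= s ->
  polyhedron V (h + s *: delta_mx p 0) `&` [set x | (V *m x) p 0 <= h p 0] = polyhedron V h.
Proof.
have E i : (h + s *: delta_mx p 0) i 0 = h i 0 + s * (i == p)%:R.
  by rewrite colD colZ mxE andbT.
move=> s0; apply/seteqP; split => x /=.
  move=> [Px xp] i; have := Px i; rewrite E; have [->//|_] := eqVneq i p.
  by rewrite mulr0 addr0.
move=> Px; split; last exact: Px.
by move=> i; rewrite E (le_trans (Px i))// lerDl mulr_ge0// ler0n.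
Qed.

Lemma cut_compact h s : 0 <= s -> simplex_corner h -> compact (cut h s).
Proof.
move=> s0 simp; rewrite -polyhedron_cut//.
apply: compact_closedI; first exact: polyhedron_compact.
by apply: closed_superlevel; exact: mulmx_continuous.
Qed.

(** Raising h_p by s adds the frustum to P(h), the two meeting in its lower face. *)
Lemma polarization_term_cut S h s : 0 <= s -> simplex_corner h ->
  polarization_term S (polyhedron V (h + s *: delta_mx p 0)) -
    polarization_term S (polyhedron V h) =
  polarization_term S (cut h s) - polarization_term S (cut h s `&` [set x | (V *m x) p 0 = h p 0]).
Proof.
move=> s0 simp; have [Kc Kv] := KS_compact_convex S.
have fE (x y : 'cV[R]_d) t :
    (V *m (t *: x + (1 - t) *: y)) p 0 = t * (V *m x) p 0 + (1 - t) * (V *m y) p 0.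
  by rewrite mulmxDr -!scalemxAr colD !colZ.
have := @volume_scaled_sum_cut R d (c S) (polyhedron V (h + s *: delta_mx p 0)) (KS S)
  (fun x => (V *m x) p 0) (h p 0) (@mulmx_continuous R n d V p) fE
  (@polyhedron_compact _ _ _ V _ V_pos_span) (@polyhedron_convex _ _ _ V _) Kc Kv.
rewrite /= -!/(polarization_term S _) polyhedron_cut// polyhedron_low//.
have -> : polyhedron V (h + s *: delta_mx p 0) `&` [set x | (V *m x) p 0 = h p 0] =
    cut h s `&` [set x | (V *m x) p 0 = h p 0].
  rewrite -polyhedron_cut//; apply/seteqP; split => x /=; last by move=> [[]].
  by move=> [Px E]; split => //; split => //; rewrite E.
move=> /eqP; rewrite -subr_eq => /eqP <-; ring.
Qed.

(** Frusta with the same slack are translates: the translation is fixed by the base,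
    and equality of the slacks makes it fit the inequality p. *)
Lemma cut_translate h h' : slack lam C p h = slack lam C p h' ->
  exists y, forall s, cut h' s = [set x | cut h s (x - y)] /\
    cut h' s `&` [set x | (V *m x) p 0 = h' p 0] =
    [set x | (cut h s `&` [set x | (V *m x) p 0 = h p 0]) (x - y)].
Proof.
have [M [VM _]] := rows_indep_solve (circuit_indep C_circuit pC) => tt.
pose y := M *m (h' - h).
have yB i : i \in C :\ p -> (V *m y) i 0 = h' i 0 - h i 0 by move=> iB; rewrite VM// colB.
have yp : (V *m y) p 0 = h' p 0 - h p 0.
  rewrite (hyperbolic_row y C_rel) (eq_bigr (fun i => lam i * h' i 0 - lam i * h i 0)).
    by rewrite sumrB; move: tt; rewrite !slackE; lra.
  by move=> i iB; rewrite yB// mulrBr.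
have cutE s x : cut h' s x <-> cut h s (x - y).
  split => [[xB xp]|[xB xp]]; split.
  - by move=> i iB; rewrite mulmxBr colB yB//; have := xB i iB; lra.
  - by rewrite mulmxBr colB yp; lra.
  - by move=> i iB; have := xB i iB; rewrite mulmxBr colB yB//; lra.
  - by move: xp; rewrite mulmxBr colB yp; lra.
exists y => s; split; first by apply/seteqP; split => x /cutE.
apply/seteqP; split => x /=; rewrite mulmxBr colB yp => -[/cutE ? ?]; split => //; lra.
Qed.

Lemma polarization_term_difference S h h' s : 0 <= s -> simplex_corner h -> simplex_corner h' ->
  slack lam C p h = slack lam C p h' ->
  polarization_term S (polyhedron V (h' + s *: delta_mx p 0)) -
    polarization_term S (polyhedron V h') =
  polarization_term S (polyhedron V (h + s *: delta_mx p 0)) -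
    polarization_term S (polyhedron V h).
Proof.
move=> s0 simp simp' tt; rewrite !polarization_term_cut//.
have c1 : compact (cut h s) by exact: cut_compact.
have cE : [set x | (V *m x) p 0 = h p 0] =
    [set x | (V *m x) p 0 <= h p 0] `&` [set x : 'cV[R]_d | h p 0 <= (V *m x) p 0].
  by apply/seteqP; split => x /= => [->//|[? ?]]; apply/eqP; rewrite eq_le; apply/andP.
have c2 : compact (cut h s `&` [set x | (V *m x) p 0 = h p 0]).
  apply: compact_closedI => //; rewrite cE.
  by apply: closedI; [apply: closed_sublevel|apply: closed_superlevel]; exact: mulmx_continuous.
have [y /(_ s)[-> ->]] := cut_translate tt.
by rewrite (polarization_term_translate _ _ c1) (polarization_term_translate _ _ c2).
Qed.

(** By [polarization_term_difference] the second difference of the mixed volume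
    along xi and e_p is zero, and for a quadratic form it is twice the bilinear
    value.  The term V z is harmless by translation invariance; it allows e_p to
    be replaced by any representative modulo im V. *)
Lemma mixed_form_orthogonal D (Q : 'M[R]_n) (hb xi : 'cV[R]_n) z : is_mixed_form V K D Q ->
  (\forall h \near hb, [/\ type_cone_lift V D h, polyhedron V h !=set0 & simplex_corner h]) ->
  slack lam C p xi = 0 -> bform Q xi (delta_mx p 0 + V *m z) = 0.
Proof.
move=> [QT QE] near_hb xi0.
set eta := delta_mx p 0 + V *m z.
have [e1 e10 H1] := near_line xi near_hb.
have [e2 e20 H2] := near_line eta near_hb.
have [e3 e30 H3] := near_line (xi + eta) near_hb.
have H0 := nbhs_singleton near_hb.
pose s := Num.min e1 (Num.min e2 e3).
have s0 : 0 < s by rewrite !lt_min e10 e20.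
have {}H1 := H1 s; have {}H2 := H2 s; have {}H3 := H3 s.
rewrite s0 ge_min lexx in H1; rewrite s0 !ge_min lexx !orbT in H2.
rewrite s0 !ge_min lexx !orbT in H3.
have {H1} [D1 P1 S1] := H1 isT; have {H2} [D2 P2 S2] := H2 isT.
have {H3} [D3 P3 S3] := H3 isT; have [D0 P0 S0] := H0.
have FE h : type_cone_lift V D h -> polyhedron V h !=set0 -> bform Q h h =
    (d`!)%:R^-1 * \sum_(S : {set 'I_d}) (-1) ^+ (d - #|S|) * polarization_term S (polyhedron V h).
  by move=> hD hP; rewrite QE// mixed_volume_polarization_term.
have etaE (h : 'cV[R]_n) S : polarization_term S (polyhedron V (h + s *: eta)) =
    polarization_term S (polyhedron V (h + s *: delta_mx p 0)).
  rewrite /eta scalerDr scalemxAr addrA polyhedron_translate polarization_term_translate//.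
  exact: polyhedron_compact.
have dif S : polarization_term S (polyhedron V (hb + s *: (xi + eta))) -
      polarization_term S (polyhedron V (hb + s *: xi)) =
    polarization_term S (polyhedron V (hb + s *: eta)) -
      polarization_term S (polyhedron V hb).
  rewrite scalerDr addrA !etaE; apply: polarization_term_difference => //; first exact: ltW.
  by rewrite slackD slackZ xi0 mulr0 addr0.
have : bform Q (hb + s *: (xi + eta)) (hb + s *: (xi + eta)) - bform Q (hb + s *: xi) (hb + s *: xi)
    = bform Q (hb + s *: eta) (hb + s *: eta) - bform Q hb hb.
  rewrite !FE// -!mulrBr -!sumrB; congr (_ * _); apply: eq_bigr => S _.
  by rewrite -!mulrBr dif.
(* Bilinearity must not split eta itself. *)
clearbody eta.
rewrite !scalerDr addrA !(bformDl, bformDr) !(bformZl, bformZr) (bformC eta hb QT) (bformC xi hb QT)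
  (bformC eta xi QT) => E.
have : s * s * bform Q xi eta = 0 by nra.
by move/eqP; rewrite !mulf_eq0 gt_eqF//= => /eqP.
Qed.

End OneCircuit.

End MixedForm.

(** * Dihedral angle of a right wedge *)

Section Dot.
Variables (R : realType) (m : nat).
Implicit Types u x y : 'cV[R]_m.

Lemma dotDr u x y : dot u (x + y) = dot u x + dot u y.
Proof. by rewrite /dot mulmxDr colD. Qed.

Lemma dotZr u (a : R) x : dot u (a *: x) = a * dot u x.
Proof. by rewrite /dot -scalemxAr colZ. Qed.

Lemma dotNr u x : dot u (- x) = - dot u x.
Proof. by rewrite /dot mulmxN colN. Qed.

Lemma dotBr u x y : dot u (x - y) = dot u x - dot u y.
Proof. by rewrite dotDr dotNr. Qed.

Lemma dotNl u x : dot (- u) x = - dot u x.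
Proof. by rewrite /dot raddfN/= mulNmx colN. Qed.

Lemma dot_continuous u : continuous (dot u).
Proof. exact: mulmx_continuous. Qed.

End Dot.

Section LinearSpans.
Variables (R : realType) (m : nat).
Implicit Types S : set 'cV[R]_m.

(** A maximal free family drawn from S. *)
Lemma lin_dim_exists S : exists k, lin_dim S k.
Proof.
have [k kP kmax] : exists2 k, (exists A : 'M[R]_(k, m), row_free A /\ forall i, S (row i A)^T) &
    forall k', (exists A : 'M[R]_(k', m), row_free A /\ forall i, S (row i A)^T) -> (k' <= k)%N.
  pose P k := `[< exists A : 'M[R]_(k, m), row_free A /\ forall i, S (row i A)^T >].
  have P0 : exists k, P k.
    exists 0%N; apply/asboolP; exists 0; split => [|[]//].
    by rewrite /row_free mxrank0.
  have Pm k : P k -> (k <= m)%N.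
    move/asboolP => [A [/eqP rA _]]; rewrite -[X in (X <= _)%N]rA; exact: rank_leq_col.
  have [k /asboolP kP kmax] := ex_maxnP P0 Pm.
  by exists k => // k' k'P; apply/kmax/asboolP.
have [A [Afree AS]] := kP; exists k, A; split => // x Sx.
apply: contrapT => /negP xA.
have : (k + 1 <= k)%N; last by rewrite addn1 ltnn.
apply: kmax; exists (col_mx A x^T); split; last first.
  move=> i; case: (split_ordP i) => j ->; first by rewrite rowKu.
  by rewrite rowKd ord1 row_id trmxK.
have xn0 : x^T != 0 by apply: contraNneq xA => ->; exact: sub0mx.
rewrite /row_free -addsmxE mxrank_disjoint_sum ?(eqP Afree) ?rank_rV ?xn0//.
apply/eqP; rewrite -mxrank_eq0; have : (\rank (A :&: x^T)%MS <= 1)%N.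
  by rewrite (leq_trans (mxrankS (capmxSr _ _)))// rank_rV xn0.
rewrite leq_eqVlt ltnS leqn0 => /orP[/eqP r1|//]; case/negP: xA.
have : (x^T <= A :&: x^T)%MS; last by move/submx_trans; apply; exact: capmxSl.
rewrite -(geq_leqif (mxrank_leqif_sup (capmxSr A x^T))) r1 rank_rV xn0//.
Qed.

Section Kernel.
Variables (r : nat) (L : 'M[R]_(r, m)) (E : 'M[R]_(m, r)).
Context (LE : L *m E = 1%:M).

Lemma kernel_rank : (\rank (kermx L^T) + r)%N = m.
Proof.
have rL : \rank L = r.
  apply/eqP; rewrite eqn_leq rank_leq_row -[X in (X <= _)%N](@mxrank1 R) -LE.
  exact: mxrankM_maxl.
by rewrite mxrank_ker mxrank_tr rL subnK// -[X in (X <= _)%N]rL rank_leq_col.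
Qed.

Lemma kernel_sub (y : 'cV[R]_m) : (y^T <= kermx L^T)%MS = (L *m y == 0).
Proof.
rewrite sub_kermx -trmx_mul; apply/eqP/eqP => [H|->]; last exact: trmx0.
by rewrite -[LHS]trmxK H trmx0.
Qed.

Lemma rows_kernel S k (A : 'M[R]_(k, m)) : (forall x, S x -> L *m x = 0) ->
  (forall i, S (row i A)^T) -> (A <= kermx L^T)%MS.
Proof.
move=> SL AS; apply/row_subP => i; rewrite -[row i A]trmxK kernel_sub.
by apply/eqP/SL.
Qed.

Lemma codim_kernel_le S c : (forall x, S x -> L *m x = 0) -> codim S c -> (r <= c)%N.
Proof.
move=> SL [k [[A [Afree AS _]] kc]].
have := mxrankS (rows_kernel SL AS); rewrite (eqP Afree).
by have := kernel_rank; lia.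
Qed.

Lemma codim_kernel_span S k (A : 'M[R]_(k, m)) : (forall x, S x -> L *m x = 0) ->
  (k + r)%N = m -> row_free A -> (forall i, S (row i A)^T) ->
  forall y : 'cV[R]_m, L *m y = 0 -> (y^T <= A)%MS.
Proof.
move=> SL kr Afree AS y /eqP; rewrite -kernel_sub => yk; apply: submx_trans yk _.
rewrite -(geq_leqif (mxrank_leqif_sup (rows_kernel SL AS))) (eqP Afree).
by have := kernel_rank; lia.
Qed.

(** To find the codimension of a set S inside ker L it is enough that every
    subspace containing S contains ker L. *)
Lemma codim_kernel S : (forall x, S x -> L *m x = 0) ->
  (forall k (A : 'M[R]_(k, m)), (forall x, S x -> (x^T <= A)%MS) ->
     forall y : 'cV[R]_m, L *m y = 0 -> (y^T <= A)%MS) ->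
  codim S r.
Proof.
move=> SL span; have [k [A [Afree AS SA]]] := lin_dim_exists S.
exists k; split; first by exists A.
have kA : (kermx L^T <= A)%MS.
  apply/row_subP => i; rewrite -[row i _]trmxK; apply: (span _ A SA).
  by apply/eqP; rewrite -kernel_sub trmxK row_sub.
have := mxrankS kA; have := mxrankS (rows_kernel SL AS); rewrite (eqP Afree).
by have := kernel_rank; lia.
Qed.

End Kernel.

End LinearSpans.

Section DualPair.
Variables (R : realType) (m : nat) (w1 w2 u1 u2 : 'cV[R]_m).

Lemma dual_pair : dot w1 u1 = 1 -> dot w1 u2 = 0 -> dot w2 u1 = 0 -> dot w2 u2 = 1 ->
  (col_mx w1^T w2^T : 'M[R]_(1 + 1, m)) *m (row_mx u1 u2 : 'M[R]_(m, 1 + 1)) = 1%:M.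
Proof.
move=> w11 w12 w21 w22.
rewrite mul_col_row -[1%:M]submxK; congr block_mx; apply/matrixP => i j; rewrite !ord1.
- by rewrite -/(dot _ _) w11 !mxE.
- by rewrite -/(dot _ _) w12 !mxE.
- by rewrite -/(dot _ _) w21 !mxE.
- by rewrite -/(dot _ _) w22 !mxE.
Qed.

Lemma pair_kernelP (y : 'cV[R]_m) : (col_mx w1^T w2^T : 'M[R]_(1 + 1, m)) *m y = 0 <->
  dot w1 y = 0 /\ dot w2 y = 0.
Proof.
rewrite mul_col_mx; split => [E|[E1 E2]].
  split.
    have := congr1 (fun X : 'cV[R]_(1 + 1) => X (lshift 1 0) 0) E.
    by rewrite /= col_mxEu [RHS]mxE.
  by have := congr1 (fun X : 'cV[R]_(1 + 1) => X (rshift 1 0) 0) E; rewrite /= col_mxEd [RHS]mxE.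
rewrite [w1^T *m y]mx11_scalar -/(dot w1 y) E1 [w2^T *m y]mx11_scalar -/(dot w2 y) E2.
by rewrite !raddf0 col_mx0.
Qed.

End DualPair.

(** H is the cell, G the face, g a point of G.  The walls are w1 = 0 and w2 = 0, with
    dual vectors u1 and u2; by Q1 and Q2 each u_k is Q-orthogonal to its wall, and
    by H_local the cell fills the wedge w1, w2 >= 0 near g up to scaling. *)
Section RightWedge.
Variables (R : realType) (m : nat) (Q : 'M[R]_m) (H G : set 'cV[R]_m).
Variables (w1 w2 u1 u2 g : 'cV[R]_m).
Context (QT : Q^T = Q).
Context (w11 : dot w1 u1 = 1) (w12 : dot w1 u2 = 0).
Context (w21 : dot w2 u1 = 0) (w22 : dot w2 u2 = 1).
Context (Hw1 : forall y, H y -> 0 <= dot w1 y) (Hw2 : forall y, H y -> 0 <= dot w2 y).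
Context (Gg : G g) (GH : G `<=` H).
Context (Gw1 : forall y, G y -> dot w1 y = 0) (Gw2 : forall y, G y -> dot w2 y = 0).
Context (G_codim : codim G 2).
Context (H_local : forall y, 0 <= dot w1 y -> 0 <= dot w2 y ->
  exists s r, [/\ 0 < s, 0 < r & H (r *: (g + s *: y))]).
Context (Q1 : forall y, dot w1 y = 0 -> bform Q y u1 = 0).
Context (Q2 : forall y, dot w2 y = 0 -> bform Q y u2 = 0).

Let L : 'M[R]_(1 + 1, m) := col_mx w1^T w2^T.

Let LE : L *m row_mx u1 u2 = 1%:M.
Proof. exact: dual_pair. Qed.

Let LP y : L *m y = 0 <-> dot w1 y = 0 /\ dot w2 y = 0.
Proof. exact: pair_kernelP. Qed.

Let decomp y : exists2 z, L *m z = 0 & y = z + dot w1 y *: u1 + dot w2 y *: u2.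
Proof.
exists (y - dot w1 y *: u1 - dot w2 y *: u2); last by rewrite addrAC subrK subrK.
by apply/LP; rewrite !dotBr !dotZr w11 w12 w21 w22; split; ring.
Qed.

Let in_span k (A : 'M[R]_(k, m)) (a y : 'cV[R]_m) (s r : R) : 0 < s -> 0 < r ->
  (a^T <= A)%MS -> ((r *: (a + s *: y))^T <= A)%MS -> (y^T <= A)%MS.
Proof.
move=> s0 r0 aA ay.
have -> : y^T = (r * s)^-1 *: ((r *: (a + s *: y))^T - r *: a^T).
  rewrite -!linearZ/= -linearB/= scalerDr addrAC subrr add0r -linearZ/= !scalerA.
  by rewrite mulVf ?scale1r// gt_eqF// mulr_gt0.
by rewrite scalemx_sub// addmx_sub// eqmx_opp scalemx_sub.
Qed.

Let facet (w : 'cV[R]_m) := H `&` [set y | dot w y = 0].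

(** A functional w that is nonpositive on H and zero at g is nonpositive on the
    wedge, so it is a combination of w1 and w2 with coefficients w u1, w u2 <= 0.
    If both vanish the face is H, of codimension 0; if neither does, the face
    lies in w1 = w2 = 0, of codimension 2. *)
Lemma facet_containing_G F : hyp_face 1 H F -> G `<=` F -> F = facet w1 \/ F = facet w2.
Proof.
move=> [[_ [w [wH FE]]] Fcodim] GF.
have wg : dot w g = 0 by have := GF g Gg; rewrite FE => -[].
have wle y : 0 <= dot w1 y -> 0 <= dot w2 y -> dot w y <= 0.
  move=> y1 y2; have [s [r [s0 r0 /wH]]] := H_local y1 y2.
  by rewrite dotZr dotDr dotZr wg add0r pmulr_rle0// pmulr_rle0.
have wL z : L *m z = 0 -> dot w z = 0.
  move=> /LP[z1 z2]; apply/eqP; rewrite eq_le wle ?z1 ?z2//=.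
  by rewrite -oppr_le0 -dotNr wle// dotNr ?z1 ?z2 oppr0.
have wE y : dot w y = dot w1 y * dot w u1 + dot w2 y * dot w u2.
  have [z Lz {1}->] := decomp y.
  by rewrite !dotDr !dotZr wL// add0r.
have a0 : dot w u1 <= 0 by apply: wle; rewrite ?w11 ?w21 ?ler01.
have b0 : dot w u2 <= 0 by apply: wle; rewrite ?w12 ?w22 ?ler01.
have [k [[A [Afree AF FA]] k1]] := Fcodim.
have gA : (g^T <= A)%MS by apply/FA/GF.
have span y : 0 <= dot w1 y -> 0 <= dot w2 y -> dot w y = 0 -> (y^T <= A)%MS.
  move=> y1 y2 wy; have [s [r [s0 r0 Hy]]] := H_local y1 y2.
  apply: (in_span s0 r0 gA); apply: FA; rewrite FE; split => //=.
  by rewrite dotZr dotDr dotZr wg wy mulr0 addr0 mulr0.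
have [a1|a1] := eqVneq (dot w u1) 0; have [b1|b1] := eqVneq (dot w u2) 0.
- have full (y : 'cV[R]_m) : (y^T <= A)%MS.
    have w0 z : dot w z = 0 by rewrite wE a1 b1 !mulr0 addr0.
    have [z /LP[z1 z2] ->] := decomp y; rewrite !linearD/= !linearZ/=.
    apply: addmx_sub; first apply: addmx_sub.
    + by apply: span; rewrite ?z1 ?z2.
    + by apply/scalemx_sub/span; rewrite ?w11 ?w21 ?ler01.
    + by apply/scalemx_sub/span; rewrite ?w12 ?w22 ?ler01.
  have : (1%:M <= A)%MS.
    by apply/row_subP => i; rewrite -[row i _]trmxK; exact: full.
  by move=> /mxrankS; rewrite mxrank1 (eqP Afree); lia.
- right; rewrite FE; apply/seteqP; split => y /= [Hy]; rewrite wE a1 mulr0 add0r.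
    by move/eqP; rewrite mulf_eq0 (negbTE b1) orbF => /eqP.
  by move=> ->; rewrite mul0r.
- left; rewrite FE; apply/seteqP; split => y /= [Hy]; rewrite wE b1 mulr0 addr0.
    by move/eqP; rewrite mulf_eq0 (negbTE a1) orbF => /eqP.
  by move=> ->; rewrite mul0r.
- suff : (1 + 1 <= 1)%N by [].
  apply: (codim_kernel_le LE _ Fcodim) => y; rewrite FE => -[Hy /=]; rewrite wE => wy.
  apply/LP; have := Hw1 Hy; have := Hw2 Hy.
  have {}a0 : dot w u1 < 0 by rewrite lt_neqAle a1.
  have {}b0 : dot w u2 < 0 by rewrite lt_neqAle b1.
  move=> y2 y1.
  have p1 : dot w1 y * dot w u1 <= 0 by rewrite mulr_ge0_le0// ltW.
  have p2 : dot w2 y * dot w u2 <= 0 by rewrite mulr_ge0_le0// ltW.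
  have /eqP : dot w1 y * dot w u1 = 0 by lra.
  have /eqP : dot w2 y * dot w u2 = 0 by lra.
  by rewrite !mulf_eq0 (negbTE a1) (negbTE b1) !orbF => /eqP -> /eqP ->.
Qed.

Let G_span y : lin_span G y -> L *m y = 0.
Proof.
move=> [k [A [AG yA]]]; apply/eqP; rewrite -kernel_sub; apply: (submx_trans yA).
apply: rows_kernel AG => x Gx; apply/LP; split; [exact: Gw1|exact: Gw2].
Qed.

Let orth_G v : (forall y, G y -> bform Q v y = 0) -> forall y, L *m y = 0 -> bform Q v y = 0.
Proof.
move=> vG y Ly; have [k [[A [Afree AG GA]] k2]] := G_codim.
have GL x : G x -> L *m x = 0 by move=> Gx; apply/LP; split; [exact: Gw1|exact: Gw2].
have /submxP[c yE] := codim_kernel_span LE GL k2 Afree AG Ly.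
rewrite -[y]trmxK yE trmx_mul /bform mulmxA.
suff -> : v^T *m Q *m A^T = 0 by rewrite mul0mx mxE.
apply/rowP => i; rewrite [RHS]mxE -(vG _ (AG i)) /bform tr_row colE mulmxA -colE.
by rewrite [RHS]mxE.
Qed.

(** v1 lies in the first wall and is orthogonal to G, which spans w1 = w2 = 0.  As
    v2 is a multiple of u1 modulo this space, and u1 is orthogonal to the first
    wall, the product is zero. *)
Lemma inward_normals_orthogonal v1 v2 : inward_normal Q (facet w1) G v1 ->
  inward_normal Q (facet w2) G v2 -> bform Q v1 v2 = 0.
Proof.
move=> [_ [f1 [g1 [[_ /= f1w] /G_span/LP[g1w _] v1E]]] v1G].
move=> [_ [f2 [g2 [[_ /= f2w] /G_span/LP[_ g2w] v2E]]] v2G].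
have v1w : dot w1 v1 = 0 by rewrite v1E dotBr f1w g1w subrr.
have v2w : dot w2 v2 = 0 by rewrite v2E dotBr f2w g2w subrr.
have [z Lz ->] := decomp v2; rewrite v2w scale0r addr0 bformDr bformZr Q1// mulr0 addr0.
exact: orth_G.
Qed.

Lemma wedge_angles theta : is_dihedral_angle Q H G theta -> theta = pi / 2.
Proof.
move=> [F1 [F2 [v1 [v2 [[F1f F2f] F12 [GF1 GF2] [n1 n2] ->]]]]].
suff -> : bform Q v1 v2 = 0 by rewrite oppr0 mul0r acos0.
have [E1|E1] := facet_containing_G F1f GF1; have [E2|E2] := facet_containing_G F2f GF2.
- by case: F12; rewrite E1 E2.
- by rewrite E1 in n1; rewrite E2 in n2; exact: inward_normals_orthogonal n1 n2.
- rewrite E1 in n1; rewrite E2 in n2; rewrite bformC//.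
  exact: inward_normals_orthogonal n2 n1.
- by case: F12; rewrite E1 E2.
Qed.

End RightWedge.

Section WedgeFacet.
Variables (R : realType) (m : nat) (Q : 'M[R]_m) (H G : set 'cV[R]_m).
Variables (w w' u' g : 'cV[R]_m).
Context (wu : dot w u' = 0) (wu' : dot w' u' = 1).
Context (w_neq0 : exists u, dot w u = 1).
Context (Hw : forall y, H y -> 0 <= dot w y).
Context (Gg : G g) (GH : G `<=` H).
Context (Gw : forall y, G y -> dot w y = 0) (Gw' : forall y, G y -> dot w' y = 0).
Context (H_local : forall y, 0 <= dot w y -> 0 <= dot w' y ->
  exists s r, [/\ 0 < s, 0 < r & H (r *: (g + s *: y))]).
Context (QT : Q^T = Q) (Q' : forall y, dot w' y = 0 -> bform Q y u' = 0).

Let F := H `&` [set y | dot w y = 0].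

Lemma wedge_facet : hyp_face 1 H F.
Proof.
split.
  split; first by exists g; split; [exact: GH|exact: Gw].
  exists (- w); split => [x /Hw|]; first by rewrite dotNl oppr_le0.
  apply/seteqP; split => x /= [Hx wx]; split => //=; first by rewrite dotNl wx oppr0.
  by move: wx; rewrite dotNl => /eqP; rewrite oppr_eq0 => /eqP.
have [u wu1] := w_neq0.
have LE : w^T *m u = 1%:M by rewrite [LHS]mx11_scalar -/(dot w u) wu1.
have LP y : w^T *m y = 0 <-> dot w y = 0.
  split => [E|E]; first by rewrite /dot E mxE.
  by rewrite [LHS]mx11_scalar -/(dot w y) E raddf0.
apply: (codim_kernel LE) => [x [_ /= wx]|k A FA y /LP wy]; first exact/LP.
have gA : (g^T <= A)%MS by apply: FA; split; [exact: GH|exact: Gw].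
have half z : dot w z = 0 -> 0 <= dot w' z -> (z^T <= A)%MS.
  move=> wz wz'; have [s [r [s0 r0 Hz]]] := H_local (eq_ind_r (fun a => 0 <= a) (lexx 0) wz) wz'.
  have zA : ((r *: (g + s *: z))^T <= A)%MS.
    by apply: FA; split => //=; rewrite dotZr dotDr dotZr wz mulr0 addr0 Gw// mulr0.
  have -> : z^T = (r * s)^-1 *: ((r *: (g + s *: z))^T - r *: g^T).
    rewrite -!linearZ/= -linearB/= scalerDr addrAC subrr add0r -linearZ/= !scalerA.
    by rewrite mulVf ?scale1r// gt_eqF// mulr_gt0.
  by rewrite scalemx_sub// addmx_sub// eqmx_opp scalemx_sub.
have [|y'0] := lerP 0 (dot w' y); first exact: half.
rewrite -[y]opprK linearN/= eqmx_opp; apply: half; first by rewrite dotNr wy oppr0.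
by rewrite dotNr oppr_ge0 ltW.
Qed.

Lemma wedge_facet_off : exists2 y, F y & 0 < dot w' y.
Proof.
have [||s [r [s0 r0 Hu]]] := @H_local u'; rewrite ?wu ?wu' ?ler01//.
exists (r *: (g + s *: u')).
  by split => //=; rewrite dotZr dotDr dotZr wu mulr0 addr0 Gw// mulr0.
by rewrite dotZr dotDr dotZr wu' mulr1 Gw'// add0r mulr_gt0.
Qed.

Lemma wedge_inward_normal : exists v, inward_normal Q F G v.
Proof.
have [||s [r [s0 r0 Hu]]] := @H_local u'; rewrite ?wu ?wu' ?ler01//.
exists (r *: (s *: u')); split.
- move=> E; have : dot w' (r *: (s *: u')) = 0 by rewrite E /dot mulmx0 mxE.
  by rewrite !dotZr wu' mulr1 => /eqP; rewrite mulf_eq0 !gt_eqF.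
- exists (r *: (g + s *: u')), (r *: g); split.
  + by split => //=; rewrite dotZr dotDr dotZr wu mulr0 addr0 Gw// mulr0.
  + exists 1%N, g^T; split; first by move=> i; rewrite row_id trmxK.
    by rewrite linearZ/= scalemx_sub.
  + by rewrite scalerDr addrAC subrr add0r.
- move=> y Gy; rewrite !bformZl bformC// Q' ?mulr0//; exact: Gw'.
Qed.

End WedgeFacet.

(** Existence of the angle comes from the two walls themselves, its value from the
    fact that they are the only facets through G. *)
Lemma right_wedge (R : realType) (m : nat) (Q : 'M[R]_m) (H G : set 'cV[R]_m)
    (w1 w2 u1 u2 g : 'cV[R]_m) :
  Q^T = Q ->
  dot w1 u1 = 1 -> dot w1 u2 = 0 -> dot w2 u1 = 0 -> dot w2 u2 = 1 ->
  (forall y, H y -> 0 <= dot w1 y /\ 0 <= dot w2 y) ->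
  G g -> G `<=` H -> (forall y, G y -> dot w1 y = 0 /\ dot w2 y = 0) ->
  codim G 2 ->
  (forall y, 0 <= dot w1 y -> 0 <= dot w2 y ->
     exists s r, [/\ 0 < s, 0 < r & H (r *: (g + s *: y))]) ->
  (forall y, dot w1 y = 0 -> bform Q y u1 = 0) ->
  (forall y, dot w2 y = 0 -> bform Q y u2 = 0) ->
  dihedral_angle Q H G = pi / 2.
Proof.
move=> QT w11 w12 w21 w22 Hw Gg GH Gw Gc Hl Q1 Q2.
have Hw1 y : H y -> 0 <= dot w1 y by case/Hw.
have Hw2 y : H y -> 0 <= dot w2 y by case/Hw.
have Gw1 y : G y -> dot w1 y = 0 by case/Gw.
have Gw2 y : G y -> dot w2 y = 0 by case/Gw.
have Hl' y : 0 <= dot w2 y -> 0 <= dot w1 y ->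
    exists s r, [/\ 0 < s, 0 < r & H (r *: (g + s *: y))] by move=> *; exact: Hl.
rewrite /dihedral_angle; case: xgetP => [theta _ /= th|/= none].
  exact: (wedge_angles QT w11 w12 w21 w22 Hw1 Hw2 Gg Gw1 Gw2 Gc Hl Q1 th).
have [v1 n1] := wedge_inward_normal w12 w22 Gg Gw1 Gw2 Hl QT Q2.
have [v2 n2] := wedge_inward_normal w21 w11 Gg Gw2 Gw1 Hl' QT Q1.
have [y [Hy /= w1y] w2y] := wedge_facet_off w12 w22 Gg Gw1 Gw2 Hl.
case: (none (acos (- bform Q v1 v2 /
  (Num.sqrt (- bform Q v1 v1) * Num.sqrt (- bform Q v2 v2))))).
exists (H `&` [set y | dot w1 y = 0]), (H `&` [set y | dot w2 y = 0]), v1, v2; split => //.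
- split; first by apply: (wedge_facet (w' := w2) (g := g) (G := G)) => //; exists u1.
  by apply: (wedge_facet (w' := w1) (g := g) (G := G)) => //; exists u2.
- move=> E; have : (H `&` [set y | dot w2 y = 0]) y by rewrite -E.
  by move=> [_ /= w2y0]; rewrite w2y0 ltxx in w2y.
- by split => x Gx; split => //=; [exact: GH|exact: Gw1|exact: GH|exact: Gw2].
Qed.

(** * The quotient by the image of V *)

Section Cones.
Variables (R : realType) (m : nat).
Implicit Types S : set 'cV[R]_m.

Lemma closure_add S x y : (forall a b, S a -> S b -> S (a + b)) ->
  closure S x -> closure S y -> closure S (x + y).
Proof.
move=> SD Sx Sy B /(@add_continuous _ (x, y)) [[B1 B2] /= [xB1 yB2] sub].
have [a [Sa B1a]] := Sx _ xB1; have [b [Sb B2b]] := Sy _ yB2.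
by exists (a + b); split; [exact: SD|exact: (sub (a, b))].
Qed.

Lemma closure_scale S x (c : R) : (forall a, S a -> S (c *: a)) ->
  closure S x -> closure S (c *: x).
Proof.
move=> SZ Sx B /(@scaler_continuous _ _ c x) /Sx[a [Sa Ba]].
by exists (c *: a); split; [exact: SZ|].
Qed.

Lemma closure_near S x (P : 'cV[R]_m -> Prop) : closure S x ->
  (\forall y \near x, P y) -> exists2 y, S y & P y.
Proof. by move=> Sx /Sx[y [Sy Py]]; exists y. Qed.

(** Otherwise 1, 2, 3, ... would all be roots. *)
Lemma poly_pos_nonroot (P : {poly R}) : P != 0 -> exists2 s : R, 0 < s & P.[s] != 0.
Proof.
move=> P0; apply: contrapT => nex.
have allroot s : 0 < s -> root P s.
  by move=> s0; apply: contrapT => /negP ns; apply: nex; exists s.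
pose rs := [seq (j.+1%:R : R) | j <- iota 0 (size P)].
have : (size rs < size P)%N.
  apply: max_poly_roots => //.
    by apply/allP => _ /mapP[j _ ->]; apply: allroot; rewrite ltr0n.
  rewrite map_inj_uniq ?iota_uniq// => i j /eqP.
  by rewrite eqr_nat => /eqP[].
by rewrite size_map size_iota ltnn.
Qed.

(** The coefficients are powers of one parameter s: each l_i becomes a nonzero
    polynomial in s, and s is chosen off the roots of their product. *)
Lemma generic_combination (I : finType) (B : pred I) k (l : I -> 'rV[R]_m) (A : 'M[R]_(k, m)) :
  (forall i, B i -> l i *m A^T != 0) ->
  exists2 c : 'cV[R]_k, forall r, 0 < c r 0 &
    forall i, B i -> (l i *m (A^T *m c)) 0 0 != 0.
Proof.
move=> lA.
pose P i : {poly R} := \poly_(r < k) (if insub r is Some r' then (l i *m A^T) 0 r' else 0).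
have PE i s : (P i).[s] = (l i *m (A^T *m (\col_(r < k) s ^+ r))) 0 0.
  rewrite horner_poly mulmxA [RHS]mxE; apply: eq_bigr => r _.
  rewrite [X in _ = _ * X]mxE; case: insubP => [j _ /val_inj ->//|]; by rewrite ltn_ord.
have P0 : \prod_(i | B i) P i != 0.
  apply/prodf_neq0 => i /lA; apply: contraNneq => Pi0; apply/eqP/rowP => r.
  have : (P i)`_r = 0 by rewrite Pi0 coef0.
  rewrite coef_poly ltn_ord; case: insubP => [j _ /val_inj ->|]; last by rewrite ltn_ord.
  by move=> ->; rewrite mxE.
have [s s0] := poly_pos_nonroot P0.
rewrite horner_prod => /prodf_neq0 Ps.
exists (\col_(r < k) s ^+ r) => [r|i Bi]; first by rewrite mxE exprn_gt0.
by rewrite -PE; exact: Ps.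
Qed.

End Cones.

Section Quotient.
Variables (R : realType) (n d : nat) (V : 'M[R]_(n, d)).
Implicit Types (h : 'cV[R]_n) (y : 'cV[R]_(quot_dim V)).

Lemma quot_section_proj h : exists z, quot_section V *m quot_proj V h = h + V *m z.
Proof.
have : quot_proj V (quot_section V *m quot_proj V h - h) = 0.
  have := quot_sectionK (quot_proj V h).
  by rewrite /quot_proj mulmxBr => ->; rewrite subrr.
by move=> /quot_proj_eq0[z E]; exists z; rewrite -E addrC subrK.
Qed.

Lemma quot_projD h k : quot_proj V (h + k) = quot_proj V h + quot_proj V k.
Proof. exact: mulmxDr. Qed.

Lemma quot_projZ a h : quot_proj V (a *: h) = a *: quot_proj V h.
Proof. by rewrite /quot_proj scalemxAr. Qed.

Lemma type_coneP D y : type_cone V D y <-> type_cone_lift V D (quot_section V *m y).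
Proof.
split=> [[h hD <-]|H]; last by exists (quot_section V *m y); rewrite ?quot_sectionK.
by have [z ->] := quot_section_proj h; exact: type_cone_lift_translate.
Qed.

(** The slack as a functional on the quotient, in the form that [dot] expects. *)
Definition slack_fun lam C p : 'cV[R]_(quot_dim V) := (slack_row lam C p *m quot_section V)^T.

Lemma slack_funE lam C p y : dot (slack_fun lam C p) y = slack lam C p (quot_section V *m y).
Proof. by rewrite /dot /slack_fun trmxK /slack mulmxA. Qed.

Lemma slack_fun_proj lam C p h : hyperbolic_relation V C p lam ->
  dot (slack_fun lam C p) (quot_proj V h) = slack lam C p h.
Proof.
move=> rel; rewrite slack_funE; have [z ->] := quot_section_proj h.
by rewrite slackD slack_im// addr0.
Qed.

(** An irredundant h_p is less than the bound that the other inequalities put on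
    v_p; this passes to the closure. *)
Lemma clir_slack_ge0 lam C p y : hyperbolic_relation V C p lam -> clir V y ->
  0 <= dot (slack_fun lam C p) y.
Proof.
move=> rel cy.
have : closed [set y | 0 <= dot (slack_fun lam C p) y].
  by apply: closed_superlevel; exact: dot_continuous.
apply; apply: closure_subset cy => _ [h [_ irr] <-] /=.
have [x [xh nPx]] := irr p; rewrite slack_fun_proj// slackE.
have hp : h p 0 < (V *m x) p 0.
  rewrite ltNge; apply/negP => xp; apply: nPx => i.
  by have [->|/xh] := eqVneq i p.
rewrite subr_ge0 ltW// (lt_le_trans hp)// (hyperbolic_row x rel) ler_sum// => i.
move=> iB; rewrite ler_wpM2l//; first by rewrite ltW// rel.1.
by apply: xh; move: iB; rewrite !inE => /andP[].
Qed.

Lemma hyperbolic_relation_unique C p lam lam' : circuit V C -> p \in C ->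
  hyperbolic_relation V C p lam -> hyperbolic_relation V C p lam' ->
  {in C :\ p, lam =1 lam'}.
Proof.
move=> cC pC [_ E] [_ E'] i iB.
pose mu : 'rV[R]_n := \row_j (if j \in C :\ p then lam j - lam' j else 0).
have : mu = 0.
  apply: (circuit_indep cC pC) => [j jB|]; first by rewrite mxE (negbTE jB).
  rewrite mulmx_sum_row (eq_bigr (fun j => if j \in C :\ p then
    lam j *: row j V - lam' j *: row j V else 0)).
    by rewrite -big_mkcond/= sumrB -E -E' subrr.
  by move=> j _; rewrite mxE; case: ifP => _; rewrite ?scale0r// scalerBl.
by move=> /rowP/(_ i); rewrite !mxE iB => /eqP; rewrite subr_eq0 => /eqP.
Qed.

Lemma clir_circuit_slack C p lam y : circuit V C -> p \in C ->
  hyperbolic_relation V C p lam -> clir_circuit V C p y -> dot (slack_fun lam C p) y = 0.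
Proof.
move=> cC pC rel [_ [h [lam' [rel' hE]] <-]]; rewrite slack_fun_proj// slackE.
apply/eqP; rewrite subr_eq0 hE; apply/eqP/eq_bigr => i iB.
by rewrite (hyperbolic_relation_unique cC pC rel rel').
Qed.

(** Type cones are invariant under im V, so a point of the closure in the quotient
    is approached by type cone points near its chosen lift. *)
Lemma type_cone_near D g (P : 'cV[R]_n -> Prop) : closure (type_cone V D) g ->
  (\forall h \near quot_section V *m g, P h) -> exists2 h, type_cone_lift V D h & P h.
Proof.
move=> cg Pg.
have [y /type_coneP yD Py] := closure_near cg (@mulmx_cV_continuous _ _ _ (quot_section V) g _ Pg).
by exists (quot_section V *m y).
Qed.

End Quotient.

(** * Two corner cuts *)

Section Cells.
Variables (R : realType) (n d : nat) (V : 'M[R]_(n, d)).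
Variable K : 'I_(d - 2) -> set 'cV[R]_d.
Context (V_distinct : injective (fun i => row i V)).
Context (V_unit : forall i, \sum_j V i j ^+ 2 = 1).
Implicit Types (D : set (set 'cV[R]_d)) (y : 'cV[R]_(quot_dim V)).

Lemma closure_type_coneD D y z : fan_rays V D -> complete_fan D ->
  closure (type_cone V D) y -> closure (type_cone V D) z -> closure (type_cone V D) (y + z).
Proof.
move=> rays compl; apply: closure_add => _ _ [h hD <-] [k kD <-].
by exists (h + k); [exact: type_cone_liftD|exact: quot_projD].
Qed.

Lemma closure_type_coneZ D a y : 0 < a ->
  closure (type_cone V D) y -> closure (type_cone V D) (a *: y).
Proof.
move=> a0; apply: closure_scale => _ [h hD <-].
by exists (a *: h); [exact: type_cone_liftZ|exact: quot_projZ].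
Qed.

Lemma closure_type_cone_comb D y k (A : 'M[R]_(k, quot_dim V)) (c : 'cV[R]_k) :
  fan_rays V D -> complete_fan D -> closure (type_cone V D) y ->
  (forall r, closure (type_cone V D) (row r A)^T) -> (forall r, 0 < c r 0) ->
  closure (type_cone V D) (y + A^T *m c).
Proof.
move=> rays compl cy cA c0.
have -> : A^T *m c = \sum_r c r 0 *: (row r A)^T.
  rewrite -[LHS]trmxK trmx_mul trmxK mulmx_sum_row raddf_sum/=.
  by apply: eq_bigr => r _; rewrite linearZ/= mxE.
elim: (index_enum _) => [|r s IH]; first by rewrite big_nil addr0.
rewrite big_cons addrCA; apply: closure_type_coneD => //.
by apply: closure_type_coneZ.
Qed.

Lemma hcell_scale D y : closure (type_cone V D) y -> 0 < bform (quot_form V K D) y y ->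
  exists2 r, 0 < r & hcell V K D (r *: y).
Proof.
move=> cy q0; have s0 : 0 < Num.sqrt (bform (quot_form V K D) y y) by rewrite sqrtr_gt0.
exists (Num.sqrt (bform (quot_form V K D) y y))^-1; first by rewrite invr_gt0.
split; first by apply: closure_type_coneZ; rewrite ?invr_gt0.
rewrite /= bformZl bformZr mulrA -invfM -expr2 sqr_sqrtr ?ltW// mulVf// gt_eqF//.
Qed.

(** Without a mixed form the default value 0 of [mixed_form] would leave the cell
    empty. *)
Lemma hcell_mixed_form D y : hcell V K D y -> is_mixed_form V K D (mixed_form V K D).
Proof.
move=> [_ /=]; rewrite /quot_form /mixed_form; case: xgetP => [Q ->//|_].
rewrite mulmx0 mul0mx /bform mulmx0 mul0mx mxE => /eqP.
by rewrite eq_sym oner_eq0.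
Qed.

Lemma quot_form_sym D : is_mixed_form V K D (mixed_form V K D) ->
  (quot_form V K D)^T = quot_form V K D.
Proof.
move=> [QT _]; rewrite /quot_form; move: (quot_section V) => S.
by rewrite !trmx_mul trmxK QT mulmxA.
Qed.

Lemma quot_formE D y z : bform (quot_form V K D) y z =
  bform (mixed_form V K D) (quot_section V *m y) (quot_section V *m z).
Proof. by rewrite /bform /quot_form; move: (quot_section V) => S; rewrite trmx_mul !mulmxA. Qed.

End Cells.

Section TwoCircuits.
Variables (R : realType) (n d : nat) (V : 'M[R]_(n, d)).
Variable K : 'I_(d - 2) -> set 'cV[R]_d.
Context (d_ge2 : (2 <= d)%N).
Context (V_distinct : injective (fun i => row i V)).
Context (V_unit : forall i, \sum_j V i j ^+ 2 = 1).
Context (V_pos_span : pos_hull V = setT).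
Context (K_body : forall j, convex_body (K j)).
Variables (C1 C2 : {set 'I_n}) (p1 p2 : 'I_n) (lam1 lam2 : 'I_n -> R).
Context (c1 : circuit V C1) (pC1 : p1 \in C1) (r1 : hyperbolic_relation V C1 p1 lam1).
Context (c2 : circuit V C2) (pC2 : p2 \in C2) (r2 : hyperbolic_relation V C2 p2 lam2).
Context (d1 : #|C1| = d.+1) (d2 : #|C2| = d.+1).
Context (p1C2 : p1 \notin C2) (p2C1 : p2 \notin C1).
Implicit Types (h : 'cV[R]_n) (D : set (set 'cV[R]_d)) (y : 'cV[R]_(quot_dim V)).

Let s1 := slack lam1 C1 p1.
Let s2 := slack lam2 C2 p2.
Let w1 := slack_fun V lam1 C1 p1.
Let w2 := slack_fun V lam2 C2 p2.
Let u1 := - quot_proj V (delta_mx p1 0).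
Let u2 := - quot_proj V (delta_mx p2 0).

Let p12 : p1 != p2.
Proof. by apply: contraNneq p1C2 => ->. Qed.

Let card_base (C : {set 'I_n}) p : p \in C -> #|C| = d.+1 -> #|C :\ p| = d.
Proof. by move=> pC dC; have := cardsD1 p C; rewrite pC dC add1n => -[]. Qed.

Let w11 : dot w1 u1 = 1.
Proof. by rewrite dotNr slack_fun_proj// slack_delta !inE !eqxx/= sub0r opprK. Qed.

Let w12 : dot w1 u2 = 0.
Proof.
rewrite dotNr slack_fun_proj// slack_delta !inE (negbTE p2C1) andbF.
by rewrite eq_sym (negbTE p12) subrr oppr0.
Qed.

Let w21 : dot w2 u1 = 0.
Proof.
by rewrite dotNr slack_fun_proj// slack_delta !inE (negbTE p1C2) andbF (negbTE p12) subrr oppr0.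
Qed.

Let w22 : dot w2 u2 = 1.
Proof. by rewrite dotNr slack_fun_proj// slack_delta !inE !eqxx/= sub0r opprK. Qed.

Let L : 'M[R]_(1 + 1, quot_dim V) := col_mx w1^T w2^T.

Let LE : L *m row_mx u1 u2 = 1%:M.
Proof. exact: dual_pair. Qed.

Let LP y : L *m y = 0 <-> dot w1 y = 0 /\ dot w2 y = 0.
Proof. exact: pair_kernelP. Qed.

(** If both circuits had the base B, both v_(p_1) and v_(p_2) would be interior to
    its cone, and v_(p_1) = e v_(p_2) + \sum_(i in B) (lambda1_i - e lambda2_i) v_i
    with positive coefficients for small e > 0.  The resulting inequality on
    clir(V) is t_1 >= e t_2, so t_2 = 0 on clir^(C_1), whose codimension would be
    at least 2. *)
Lemma bases_differ : codim (clir_circuit V C1 p1) 1 -> C1 :\ p1 <> C2 :\ p2.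
Proof.
move=> facet1 B12; suff : (1 + 1 <= 1)%N by [].
apply: (codim_kernel_le LE _ facet1) => y yC; apply/LP.
have w1y := clir_circuit_slack c1 pC1 r1 yC.
split => //; apply/eqP; rewrite eq_le.
have yclir := yC.1; rewrite (clir_slack_ge0 r2 yclir) andbT.
have [e e0 eP] : exists2 e : R, 0 < e & forall i e', 0 < e' <= e ->
    i \in C1 :\ p1 -> 0 < lam1 i - e' * lam2 i.
  apply: finite_eps => i; have [iB|iB] := boolP (i \in C1 :\ p1); last by exists 1.
  have [e e0 eP] := @gap_eps R 0 (- lam1 i) (- lam2 i) (etrans (oppr_lt0 _) (r1.1 i iB)).
  by exists e => // e' /eP; rewrite mulrN opprK; lra.
have {}eP i : i \in C1 :\ p1 -> 0 < lam1 i - e * lam2 i by apply: eP; rewrite e0 lexx.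
pose lam i := if i == p2 then e else lam1 i - e * lam2 i.
have BE : (p2 |: C1) :\ p1 = p2 |: (C1 :\ p1).
  by apply/setP => i; rewrite !inE; case: eqVneq => // ->; rewrite (negbTE p12).
have p2B : p2 \notin C1 :\ p1 by rewrite !inE (negbTE p2C1) andbF.
have lamB i : i \in C1 :\ p1 -> lam i = lam1 i - e * lam2 i.
  by rewrite /lam; case: eqVneq => // -> ; rewrite (negbTE p2B).
have rel : hyperbolic_relation V (p2 |: C1) p1 lam.
  split => [i|].
    rewrite BE in_setU1 => /orP[/eqP ->|iB]; first by rewrite /lam eqxx.
    by rewrite lamB//; exact: eP.
  rewrite BE big_setU1//= {1}/lam eqxx r2.2 -B12 scaler_sumr.
  rewrite [X in _ = _ + X](eq_bigr (fun i => lam1 i *: row i V - (e *: (lam2 i *: row i V)))).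
    by rewrite sumrB addrCA subrr addr0; exact: r1.2.
  by move=> i iB; rewrite lamB// scalerBl scalerA.
have := clir_slack_ge0 rel yclir.
move: w1y; rewrite !slack_funE !slackE BE big_setU1//= {1}/lam eqxx -B12.
set h := quot_section V *m y => /eqP; rewrite subr_eq0 => /eqP <-.
rewrite [X in _ + X - _](eq_bigr (fun i => lam1 i * h i 0 - e * (lam2 i * h i 0))).
  rewrite sumrB -mulr_sumr => ?.
  rewrite -(pmulr_rle0 _ e0) mulrBr; lra.
by move=> i iB; rewrite lamB// mulrBl mulrA.
Qed.

Lemma slack_active (C : {set 'I_n}) p lam h x : hyperbolic_relation V C p lam -> p \in C ->
  slack lam C p h = 0 -> polyhedron V h x -> p \in active V h x -> C \subset active V h x.
Proof.
move=> rel pC sh Px pa; apply/fintype.subsetP => i iC.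
have [->//|ip] := eqVneq i p; have iB : i \in C :\ p by rewrite !inE ip.
pose l : 'cV[R]_n := \col_j (if j \in C :\ p then lam j else 0).
have sumE (k : 'cV[R]_n) : \sum_j l j 0 * k j 0 = \sum_(j in C :\ p) lam j * k j 0.
  rewrite [RHS]big_mkcond/=; apply: eq_bigr => j _; rewrite mxE.
  by case: ifP => _ //; rewrite mul0r.
apply: (comb_eq_active (l := l) _ Px).
- by move=> j; rewrite mxE; case: ifP => // jB; rewrite ltW// rel.1.
- rewrite dot_comb !sumE -(hyperbolic_row x rel); move/activeP: pa => ->.
  by move: sh; rewrite slackE => /eqP; rewrite subr_eq0 => /eqP.
- by rewrite mxE iB rel.1.
Qed.

(** A family of d independent vectors in R^d is a basis. *)
Lemma base_maximal (B J : {set 'I_n}) :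
  rows_indep V B -> #|B| = d -> rows_indep V J -> B \subset J -> J = B.
Proof.
move=> indB cardB /rows_indep_solve[M [VM _]] BJ; apply/eqP; rewrite finset.eqEsubset BJ andbT.
apply/fintype.subsetP => j jJ; apply: contraT => jB.
have z0 : M *m delta_mx j 0 = 0 :> 'cV[R]_d.
  apply: (rows_indep_inj indB cardB) => i iB; rewrite VM ?(fintype.subsetP BJ)// mxE andbT.
  by case: eqVneq iB jB => // -> ->.
have := VM (delta_mx j 0) j jJ; rewrite z0 mulmx0 !mxE !eqxx => /eqP.
by rewrite eq_sym oner_eq0.
Qed.

(** h violates some relation of every dependent family that avoids p1 and p2, so
    that the hyperplanes of such a family have no common point. *)
Definition generic h := forall J : {set 'I_n}, p1 \notin J -> p2 \notin J -> ~ rows_indep V J ->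
  exists mu : 'rV[R]_n, [/\ forall i, i \notin J -> mu 0 i = 0, mu *m V = 0 & (mu *m h) 0 0 != 0].

(** The active indices other than p1 and p2 are independent by genericity.  If p_k
    is active at x, so is C_k, because the slack is zero; its base has d elements
    and hence exhausts the other active indices.  Both p1 and p2 active would make
    the bases equal. *)
Lemma generic_active h x : C1 :\ p1 <> C2 :\ p2 -> generic h -> s1 h = 0 -> s2 h = 0 ->
  polyhedron V h x -> [\/ active V h x = C1, active V h x = C2 |
    [/\ rows_indep V (active V h x), p1 \notin active V h x & p2 \notin active V h x]].
Proof.
move=> B12 gen s1h s2h Px.
pose J := active V h x :\ p1 :\ p2.
have indJ : rows_indep V J.
  apply: contrapT => /gen[||mu [muJ muV]]; rewrite ?inE ?eqxx ?andbF//.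
  have -> : (mu *m h) 0 0 = (mu *m (V *m x)) 0 0.
    rewrite [LHS]mxE [RHS]mxE; apply: eq_bigr => i _.
    have [iJ|/muJ ->] := boolP (i \in J); last by rewrite !mul0r.
    by move: iJ; rewrite !finset.in_setD1 => /and3P[_ _ /activeP ->].
  by rewrite mulmxA muV mul0mx mxE eqxx.
have J1 : p1 \in active V h x -> J = C1 :\ p1.
  move=> pa; apply: base_maximal (circuit_indep c1 pC1) (card_base pC1 d1) indJ _.
  apply/fintype.subsetP => i iB; rewrite !finset.in_setD1.
  have iC : i \in C1 by move: iB; rewrite !inE => /andP[].
  rewrite (fintype.subsetP (slack_active r1 pC1 s1h Px pa))// andbT.
  move: iB; rewrite !inE => /andP[-> _]; rewrite andbT.
  by apply: contraNneq p2C1 => <-.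
have J2 : p2 \in active V h x -> J = C2 :\ p2.
  move=> pa; apply: base_maximal (circuit_indep c2 pC2) (card_base pC2 d2) indJ _.
  apply/fintype.subsetP => i iB; rewrite !finset.in_setD1.
  have iC : i \in C2 by move: iB; rewrite !inE => /andP[].
  rewrite (fintype.subsetP (slack_active r2 pC2 s2h Px pa))// andbT.
  move: iB; rewrite !inE => /andP[-> _]/=.
  by apply: contraNneq p1C2 => <-.
have [a1|a1] := boolP (p1 \in active V h x); have [a2|a2] := boolP (p2 \in active V h x).
- by case: B12; rewrite -J1// -J2.
- apply: Or31; rewrite -(finset.setD1K pC1) -(J1 a1); apply/setP => i.
  rewrite !(finset.in_setU1, finset.in_setD1); case: eqVneq => [->//|_] /=.
  by case: eqVneq => [->|_]//=; exact: negbTE.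
- apply: Or32; rewrite -(finset.setD1K pC2) -(J2 a2); apply/setP => i.
  rewrite !(finset.in_setU1, finset.in_setD1); case: eqVneq => [->//|_] /=.
  by case: eqVneq => [->|_]//=; exact: negbTE.
- apply: Or33; split => //; suff <- : J = active V h x by [].
  apply/setP => i; rewrite !finset.in_setD1.
  case: eqVneq => [->|_] /=; first by rewrite (negbTE a2).
  by case: eqVneq => [->|_]//=; rewrite (negbTE a1).
Qed.

(** p is attained on type cone points near the lift of g, and this is a closed
    condition. *)
Lemma corner_vertex D g (C : {set 'I_n}) p lam : hyperbolic_relation V C p lam -> p \in C ->
  fan_rays V D -> closure (type_cone V D) g -> dot (slack_fun V lam C p) g = 0 ->
  exists2 x, polyhedron V (quot_section V *m g) x & C \subset active V (quot_section V *m g) x.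
Proof.
move=> rel pC rays cg sg.
have [x Px pa] : exists2 x, polyhedron V (quot_section V *m g) x &
    [set p]%SET \subset active V (quot_section V *m g) x.
  apply: contrapT => /near_active nh.
  have [h hD []] := type_cone_near cg nh.
  have [x Px xp] := active_singleton V_distinct V_unit p rays hD.
  by exists x => //; rewrite xp.
exists x => //; apply: slack_active rel pC _ Px _; first by rewrite -slack_funE.
by rewrite -finset.sub1set.
Qed.

(** At a point where p alone is active all other inequalities are strict. *)
Lemma type_cone_slack_gt0 D h (C : {set 'I_n}) p lam : hyperbolic_relation V C p lam -> p \in C ->
  #|C| = d.+1 -> fan_rays V D -> type_cone_lift V D h -> 0 < slack lam C p h.
Proof.
move=> rel pC dC rays hD.
have [x Px xp] := active_singleton V_distinct V_unit p rays hD.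
have lt i : i \in C :\ p -> (V *m x) i 0 < h i 0.
  rewrite !inE => /andP[ip _]; rewrite lt_neqAle Px andbT.
  have : i \notin active V h x by rewrite xp inE.
  by rewrite inE.
have /activeP hp : p \in active V h x by rewrite xp inE.
rewrite slackE -hp (hyperbolic_row x rel) -sumrB.
have [k kB] : exists k, k \in C :\ p.
  by apply/set0Pn; rewrite -card_gt0 card_base//; lia.
rewrite (bigD1 k)//= ltr_pwDl//; first by rewrite -mulrBr mulr_gt0 ?rel.1// subr_gt0 lt.
rewrite sumr_ge0// => i /andP[iB _].
by rewrite -mulrBr mulr_ge0 ?(ltW (rel.1 _ iB))// subr_ge0 ltW ?lt.
Qed.

(** G contains a point g0 and a basis of the space w1 = w2 = 0.  No functional that
    must be avoided vanishes on this space, as it can be evaluated at the class of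
    some e_j corrected along u1 and u2.  A small generic positive combination of
    the basis is added to g0; the result stays in the convex cone, on the face,
    and in the region q > 0, and it is rescaled to q = 1. *)
Lemma generic_point D (G : set 'cV[R]_(quot_dim V)) : fan_rays V D -> complete_fan D ->
  face_at_level 0 (hcell V K D) G -> codim G 2 ->
  (forall y, G y -> dot w1 y = 0 /\ dot w2 y = 0) ->
  exists2 g, G g & generic (quot_section V *m g).
Proof.
move=> rays compl [[g0 Gg0] [u [uH GE]]] [k [[A [Afree AG GA]] k2]] Gw.
have GL x : G x -> L *m x = 0 by move=> Gx; apply/LP; exact: Gw.
have spanA := codim_kernel_span LE GL k2 Afree AG.
pose bad (J : {set 'I_n}) := `[< [/\ p1 \notin J, p2 \notin J & ~ rows_indep V J] >].
have /choice[mu muP] : forall J : {set 'I_n}, exists mu : 'rV[R]_n, bad J ->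
    [/\ forall i, i \notin J -> mu 0 i = 0, mu *m V = 0 & mu <> 0].
  move=> J; have [badJ|] := boolP (bad J); last by exists 0.
  have /asboolP[_ _] := badJ.
  by move=> /existsNP[mu /not_implyP[a /not_implyP[b c]]]; exists mu.
pose l J := mu J *m quot_section V.
have lproj J h : bad J -> (l J *m quot_proj V h) 0 0 = (mu J *m h) 0 0.
  move=> /muP[_ muV _]; rewrite /l -mulmxA; have [z ->] := quot_section_proj V h.
  by rewrite mulmxDr mulmxA muV mul0mx addr0.
have lA J : bad J -> l J *m A^T != 0.
  move=> badJ; apply/eqP => lA0; have [muJ muV mu0] := muP J badJ.
  have /asboolP[p1J p2J _] := badJ.
  apply: mu0; apply/rowP => j; rewrite [RHS]mxE.
  pose y0 := quot_proj V (delta_mx j 0).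
  have Ly : L *m (y0 - dot w1 y0 *: u1 - dot w2 y0 *: u2) = 0.
    by apply/LP; rewrite !dotBr !dotZr w11 w12 w21 w22; split; ring.
  have /submxP[c yE] := spanA _ Ly.
  have : l J *m (y0 - dot w1 y0 *: u1 - dot w2 y0 *: u2) = 0.
    by rewrite -[X in _ *m X]trmxK yE trmx_mul mulmxA lA0 mul0mx.
  move=> /(congr1 (fun X : 'M[R]_1 => X 0 0)).
  rewrite !mulmxBr -!scalemxAr !mulmxN !colB !colZ !colN !lproj// -!colE !mxE.
  by rewrite (muJ p1 p1J) (muJ p2 p2J) !oppr0 !mulr0 !subr0.
have [c c0 lc] := generic_combination lA.
have [e1 e10 H1] : exists2 e : R, 0 < e & forall J e', 0 < e' <= e ->
    bad J -> (l J *m (g0 + e' *: (A^T *m c))) 0 0 != 0.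
  apply: finite_eps => J; have [badJ|] := boolP (bad J); last by exists 1.
  have b0 := lc J badJ.
  have [a0|a0] := eqVneq ((l J *m g0) 0 0) 0.
    exists 1 => // e' /andP[e'0 _] _; rewrite mulmxDr -scalemxAr colD colZ a0 add0r.
    by rewrite mulf_neq0// gt_eqF.
  have [e e0 eP] := @gap_eps R `|(l J *m g0) 0 0| 0 (- `|(l J *m (A^T *m c)) 0 0|)
    (etrans (normr_gt0 _) a0).
  exists e => // e' e'e _; have := eP e' e'e; rewrite mulrN opprK add0r.
  rewrite mulmxDr -scalemxAr colD colZ; apply: contraTneq => /eqP.
  rewrite addr_eq0 => /eqP ->; case/andP: e'e => e'0 _.
  by rewrite normrN normrM gtr0_norm// ltxx.
have q0 : 0 < bform (quot_form V K D) g0 g0.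
  by have := Gg0; rewrite GE => -[[_ /= ->] _]; exact: ltr01.
have [e2 e20 H2] := near_line (A^T *m c)
  (near_lt (@cst_continuous _ _ 0 _) (@bform_continuous _ _ _ g0) q0).
pose t := Num.min e1 e2.
have t0 : 0 < t by rewrite lt_min e10.
have {}H1 J := H1 J t; rewrite t0 ge_min lexx in H1.
have {}H2 := H2 t; rewrite t0 ge_min lexx orbT in H2.
have GT x : G x -> closure (type_cone V D) x by rewrite GE => -[[]].
have uG x : G x -> dot u x = 0 by rewrite GE => -[].
have cg : closure (type_cone V D) (g0 + t *: (A^T *m c)).
  rewrite scalemxAr; apply: closure_type_cone_comb => //; first exact: GT.
    by move=> r; exact: GT.
  by move=> r; rewrite colZ mulr_gt0.
have [r r0 Hr] := hcell_scale cg (H2 isT).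
exists (r *: (g0 + t *: (A^T *m c))).
  rewrite GE; split => //=; rewrite dotZr dotDr dotZr uG// add0r.
  rewrite /dot mulmxA (_ : u^T *m A^T = 0) ?mul0mx ?mxE ?mulr0//.
  apply/rowP => i; rewrite [RHS]mxE -(uG _ (AG i)) /dot tr_row colE mulmxA -colE.
  by rewrite [RHS]mxE.
move=> J p1J p2J dJ; have badJ : bad J by apply/asboolP.
have [muJ muV _] := muP J badJ; exists (mu J); split => //.
rewrite mulmxA -/(l J) -scalemxAr colZ mulf_neq0//; first by rewrite gt_eqF.
exact: H1.
Qed.

Lemma hcomplex_right_angle D (G : set 'cV[R]_(quot_dim V)) :
  codim (clir_circuit V C1 p1) 1 -> simplicial_polytopal V D ->
  hyp_face 2 (hcell V K D) G ->
  G `<=` hcomplex_circuit V K C1 p1 `&` hcomplex_circuit V K C2 p2 ->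
  hcomplex_angle V K G = pi / 2.
Proof.
move=> facet1 Dsp [Gface Gcodim] GC.
have [_ compl _ _ rays] := Dsp.
have Gw y : G y -> dot w1 y = 0 /\ dot w2 y = 0.
  by move=> /GC[[_ y1] [_ y2]]; split; [exact: clir_circuit_slack y1|exact: clir_circuit_slack y2].
have [g Gg gen] := generic_point rays compl Gface Gcodim Gw.
have GH : G `<=` hcell V K D by have [_ [u [_ ->]]] := Gface => y [].
have [w1g w2g] := Gw g Gg.
pose h0 := quot_section V *m g.
have s1h0 : s1 h0 = 0 by rewrite /s1 /h0 -slack_funE.
have s2h0 : s2 h0 = 0 by rewrite /s2 /h0 -slack_funE.
have cg : closure (type_cone V D) g by have [] := GH g Gg.
have act x : polyhedron V h0 x -> _ :=
  fun Px => generic_active (bases_differ facet1) gen s1h0 s2h0 Px.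
have [x1 Px1 Cx1] := corner_vertex r1 pC1 rays cg w1g.
have ax1 : active V h0 x1 = C1.
  have pa := fintype.subsetP Cx1 _ pC1.
  have [//|E|[_ /negP[]//]] := act x1 Px1.
  by rewrite E (negbTE p1C2) in pa.
have [x2 Px2 Cx2] := corner_vertex r2 pC2 rays cg w2g.
have ax2 : active V h0 x2 = C2.
  have pa := fintype.subsetP Cx2 _ pC2.
  have [E|//|[_ _ /negP[]//]] := act x2 Px2.
  by rewrite E (negbTE p2C1) in pa.
have [F nearF] : exists F : set {set 'I_n}, \forall h \near h0,
    0 < s1 h -> 0 < s2 h -> active_sets V h = F.
  apply: (local_fan c1 pC1 r1 d1 c2 pC2 r2 d2) => x /act[?|?|[? _ _]].
  - exact: Or31.
  - exact: Or32.
  - exact: Or33.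
have fanF D' : fan_rays V D' -> closure (type_cone V D') g ->
    exists2 h, type_cone_lift V D' h & active_sets V h = F.
  move=> rays' cg'; have [h hD' hF] := type_cone_near cg' nearF.
  exists h => //; apply: hF; first exact: type_cone_slack_gt0 d1 rays' hD'.
  exact: type_cone_slack_gt0 d2 rays' hD'.
have [hD hDD hDF] := fanF D rays cg.
have unique D' : simplicial_polytopal V D' -> G `<=` hcell V K D' -> D' = D.
  move=> [_ _ _ _ rays'] GH'.
  have [h' hD' hF'] := fanF D' rays' (GH' g Gg).1.
  by rewrite -hD' -hDD !normal_fanE hF' hDF.
have nearD : \forall h \near h0, 0 < s1 h -> 0 < s2 h -> type_cone_lift V D h.
  apply: near_sub nearF => h hF h1 h2; apply: (type_cone_lift_eq hDD).
  by rewrite hF.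
have HQ := hcell_mixed_form (GH g Gg).
have local y : 0 <= dot w1 y -> 0 <= dot w2 y ->
    exists s r, [/\ 0 < s, 0 < r & hcell V K D (r *: (g + s *: y))].
  move=> y1 y2.
  have nearT : \forall z \near g, 0 < dot w1 z -> 0 < dot w2 z -> type_cone V D z.
    have := @mulmx_cV_continuous _ _ _ (quot_section V) g _ nearD.
    by apply: near_sub => z Hz z1 z2; apply/type_coneP/Hz; rewrite /s1 /s2 -slack_funE.
  have q0 : 0 < bform (quot_form V K D) g g by have [_ /= ->] := GH g Gg; exact: ltr01.
  have [e1 e10 H1] := near_line y (nbhs_interior nearT).
  have [e2 e20 H2] := near_line y
    (near_lt (@cst_continuous _ _ 0 _) (@bform_continuous _ _ _ g) q0).
  pose s := Num.min e1 e2; have s0 : 0 < s by rewrite lt_min e10.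
  have {}H1 := H1 s; rewrite s0 ge_min lexx in H1.
  have {}H2 := H2 s; rewrite s0 ge_min lexx orbT in H2.
  have cs : closure (type_cone V D) (g + s *: y).
    move=> B nB; have nB' : \forall z \near (g + s *: y),
        B z /\ (0 < dot w1 z -> 0 < dot w2 z -> type_cone V D z).
      by apply: near_and => //; exact: (H1 isT).
    (* The slacks of y may vanish; moving along u1 + u2 makes both positive. *)
    have [e e0 He] := near_line (u1 + u2) nB'.
    have ee : 0 < e <= e by rewrite e0 lexx.
    have [Bz Tz] := He e ee; exists (g + s *: y + e *: (u1 + u2)); split => //.
    apply: Tz; rewrite !(dotDr, dotZr) ?w1g ?w2g ?w11 ?w12 ?w21 ?w22.
      by rewrite add0r addr0 mulr1 ltr_wpDl// mulr_ge0// ltW.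
    by rewrite !add0r mulr1 ltr_wpDl// mulr_ge0// ltW.
  have [r r0 Hr] := hcell_scale cs (H2 isT).
  by exists s, r.
have Hw y : hcell V K D y -> 0 <= dot w1 y /\ 0 <= dot w2 y.
  move=> [cy _].
  have pos C p lam : hyperbolic_relation V C p lam -> p \in C -> #|C| = d.+1 ->
      0 <= dot (slack_fun V lam C p) y.
    move=> rel pC dC.
    have : closed [set z | 0 <= dot (slack_fun V lam C p) z].
      by apply: closed_superlevel; exact: dot_continuous.
    apply; apply: closure_subset cy => z /type_coneP zD /=; rewrite slack_funE ltW//.
    exact: type_cone_slack_gt0 zD.
  by split; exact: pos.
have [hb near_hb] : exists hb : 'cV[R]_n, \forall h \near hb, [/\ type_cone_lift V D h,
    polyhedron V h !=set0, simplex_corner V C1 p1 h & simplex_corner V C2 p2 h].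
  have simp1 := near_corner_simplex c1 pC1 r1 d1 Px1 ax1.
  have simp2 := near_corner_simplex c2 pC2 r2 d2 Px2 ax2.
  have : \forall h \near h0, (0 < s1 h -> 0 < s2 h -> type_cone_lift V D h) /\
      (simplex_corner V C1 p1 h /\ simplex_corner V C2 p2 h).
    by apply: near_and nearD _; exact: near_and simp1 simp2.
  move=> /nbhs_interior/(near_line (- (delta_mx p1 0 + delta_mx p2 0)))[e e0 He].
  have ee : 0 < e <= e by rewrite e0 lexx.
  (* Lowering h_(p1) and h_(p2) makes both slacks equal to e. *)
  pose hb := h0 + e *: - (delta_mx p1 0 + delta_mx p2 0).
  have sd (C : {set 'I_n}) p q lam : q \notin C -> p != q -> slack lam C p (delta_mx q 0) = 0.
    by move=> qC pq; rewrite slack_delta !inE (negbTE qC) andbF eq_sym (negbTE pq) subrr.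
  have sp (C : {set 'I_n}) p lam : slack lam C p (delta_mx p 0) = -1.
    by rewrite slack_delta !inE eqxx sub0r.
  have hb1 : 0 < s1 hb.
    rewrite /s1 slackD (s1h0 : slack lam1 C1 p1 h0 = 0) slackZ -scaleN1r slackZ slackD.
    by rewrite sp sd// add0r addr0 mulrNN !mulr1.
  have hb2 : 0 < s2 hb.
    rewrite /s2 slackD (s2h0 : slack lam2 C2 p2 h0 = 0) slackZ -scaleN1r slackZ slackD.
    rewrite sp sd 1?eq_sym//.
    by rewrite !add0r mulrNN !mulr1.
  exists hb; have n1 := near_lt (@cst_continuous _ _ 0 hb) (@slack_continuous _ _ _ _ _ hb) hb1.
  have n2 := near_lt (@cst_continuous _ _ 0 hb) (@slack_continuous _ _ _ _ _ hb) hb2.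
  apply: near_sub2 (near_and n1 n2) (He e ee) => h [h1 h2] [T [S1 S2]].
  have hT := T h1 h2; split => //.
  by have [x Px _] := active_singleton V_distinct V_unit p1 rays hT; exists x.
have Q1 y : dot w1 y = 0 -> bform (quot_form V K D) y u1 = 0.
  move=> y1; rewrite quot_formE mulmxN bformNr.
  have [z ->] := quot_section_proj V (delta_mx p1 0).
  rewrite (mixed_form_orthogonal V_pos_span K_body c1 pC1 r1 z HQ (hb := hb)) ?oppr0//.
    by apply: near_sub near_hb => h [].
  by rewrite -slack_funE.
have Q2 y : dot w2 y = 0 -> bform (quot_form V K D) y u2 = 0.
  move=> y2; rewrite quot_formE mulmxN bformNr.
  have [z ->] := quot_section_proj V (delta_mx p2 0).
  rewrite (mixed_form_orthogonal V_pos_span K_body c2 pC2 r2 z HQ (hb := hb)) ?oppr0//.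
    by apply: near_sub near_hb => h [].
  by rewrite -slack_funE.
rewrite /hcomplex_angle.
have -> : [set D' | simplicial_polytopal V D' /\ G `<=` hcell V K D'] = [set D].
  by apply/seteqP; split => [D' [sD' GD']|_ ->] //; exact: unique.
rewrite fsbig_set1.
exact: (right_wedge (quot_form_sym HQ) w11 w12 w21 w22 Hw Gg GH Gw Gcodim local Q1 Q2).
Qed.

End TwoCircuits.

(** * The angle between the two facets *)

Theorem theorem3p1 (R : realType) (n d : nat) (d_ge2 : (2 <= d)%N)
    (V : 'M[R]_(n, d))
    (V_distinct : injective (fun i => row i V))
    (V_unit : forall i, \sum_j V i j ^+ 2 = 1)
    (V_pos_span : pos_hull V = setT)
    (K : 'I_(d - 2) -> set 'cV[R]_d)
    (K_body : forall j, convex_body (K j))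
    (K_form : forall D : set (set 'cV[R]_d), simplicial_polytopal V D ->
       \rank (kermx (mixed_form V K D)) = d /\
       one_positive_eigenvalue (mixed_form V K D))
    (C1 C2 : {set 'I_n}) (p1 p2 : 'I_n)
    (C1_hyp : hyperbolic_circuit V C1 p1)
    (C2_hyp : hyperbolic_circuit V C2 p2)
    (C1_card : #|C1| = d.+1) (C2_card : #|C2| = d.+1)
    (p1_notin : p1 \notin C2) (p2_notin : p2 \notin C1)
    (C1_facet : codim_face 1 (clir V) (clir_circuit V C1 p1))
    (C2_facet : codim_face 1 (clir V) (clir_circuit V C2 p2))
    (C12_face : codim_face 2 (clir V)
       (clir_circuit V C1 p1 `&` clir_circuit V C2 p2)) :
  forall G : set 'cV[R]_(quot_dim V),
    hcomplex_cell V K 2 G ->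
    G `<=` hcomplex_circuit V K C1 p1 `&` hcomplex_circuit V K C2 p2 ->
    hcomplex_angle V K G = pi / 2.
Proof.
have [c1 pC1 [lam1 r1]] := C1_hyp; have [c2 pC2 [lam2 r2]] := C2_hyp.
move=> G [D [Dsp Gface]] GC.
exact: (hcomplex_right_angle d_ge2 V_distinct V_unit V_pos_span K_body c1 pC1 r1 c2 pC2 r2
  C1_card C2_card p1_notin p2_notin C1_facet.2 Dsp Gface GC).
Qed.
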